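(* $$L(g,4)=\frac{\pi^{4}}{768}\left(2\,F^{1;3;2}_{1;2;1}\left[\left.\begin{matrix}\tfrac12\\ 1\end{matrix};\begin{matrix}1,1,1\\ \tfrac32,\tfrac32\end{matrix};\begin{matrix}\tfrac12,\tfrac12\\ 1\end{matrix}\right|1,1\right]+F^{1;3;2}_{1;2;1}\left[\left.\begin{matrix}\tfrac12\\ 2\end{matrix};\begin{matrix}1,1,1\\ \tfrac32,\tfrac32\end{matrix};\begin{matrix}\tfrac12,\tfrac12\\ 1\end{matrix}\right|1,1\right]\right).$$
   Context: For $|q|<1$ let $\theta_2(q)=\sum_{n\in\mathbb Z}q^{(n+1/2)^2}$, $\theta_3(q)=\sum_{n\in\mathbb Z}q^{n^2}$, $\theta_4(q)=\sum_{n\in\mathbb Z}(-1)^nq^{n^2}$. Let $g(q)=\frac1{16}\theta_2^4(q)\theta_4^2(q^2)=\sum_{n\ge0}b_nq^n$ and $L(g,s)=\sum_{n\ge1}b_nn^{-s}$ (analytically continued). $(a)_n=\Gamma(a+n)/\Gamma(a)$. The Kampé de Fériet function is $$F^{A;B;B'}_{C;D;D'}\left[\left.\begin{matrix}a_1,\dots,a_A\\ c_1,\dots,c_C\end{matrix};\begin{matrix}b_1,\dots,b_B\\ d_1,\dots,d_D\end{matrix};\begin{matrix}b'_1,\dots,b'_{B'}\\ d'_1,\dots,d'_{D'}\end{matrix}\right|x,y\right]=\sum_{m,n\ge0}\frac{\prod_i(a_i)_{m+n}\prod_i(b_i)_m\prod_i(b'_i)_n}{\prod_i(c_i)_{m+n}\prod_i(d_i)_m\prod_i(d'_i)_n}\frac{x^my^n}{m!\,n!},$$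 which converges absolutely at $x=y=1$ for the parameters used here. *)

(* Defs.v *)
From Stdlib Require Import Reals ZArith List.
Open Scope R_scope.

(* ---------- Theta-series coefficients ----------
   We use the auxiliary variable t = q^(1/4), so that all exponents are
   natural numbers:
     theta2(q)   = sum_{n in Z} t^((2n+1)^2)
     theta4(q^2) = sum_{n in Z} (-1)^n t^(8 n^2).                        *)

Definition zsum (K : nat) (f : Z -> R) : R :=
  sum_f_R0 (fun i => f (Z.of_nat i - Z.of_nat K)%Z) (2 * K).

(* coefficient of t^k in theta2(q) = sum_{n in Z} t^((2n+1)^2);
   only |n| <= k can contribute *)
Definition theta2_coef (k : nat) : R :=
  zsum k (fun n => if Z.eqb ((2 * n + 1) * (2 * n + 1))%Z (Z.of_nat k) then 1 else 0).

Definition theta4_q2_coef (k : nat) : R :=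
  zsum k (fun n => if Z.eqb (8 * n * n)%Z (Z.of_nat k) then (-1) ^ Z.abs_nat n else 0).

Definition conv (a b : nat -> R) (N : nat) : R :=
  sum_f_R0 (fun i => a i * b (N - i)%nat) N.

Definition prod_coef : nat -> R :=
  conv theta2_coef (conv theta2_coef (conv theta2_coef
    (conv theta2_coef (conv theta4_q2_coef theta4_q2_coef)))).

(* g(q) = 1/16 theta2(q)^4 theta4(q^2)^2 = sum_n b_n q^n, q^n = t^(4n) *)
Definition b (n : nat) : R := prod_coef (4 * n)%nat / 16.

Fixpoint poch (a : R) (n : nat) : R :=
  match n with
  | O => 1
  | S k => poch a k * (a + INR k)
  end.

Definition poch_prod (l : list R) (n : nat) : R :=
  fold_right (fun a acc => poch a n * acc) 1 l.

(* the (m,n) term of the Kampe de Feriet series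
   F^{A;B;B'}_{C;D;D'}[as; bs; bs' / cs; ds; ds' | x, y] *)
Definition kdf_term (as_ cs bs ds bs' ds' : list R) (x y : R) (m n : nat) : R :=
  poch_prod as_ (m + n) * poch_prod bs m * poch_prod bs' n
  / (poch_prod cs (m + n) * poch_prod ds m * poch_prod ds' n)
  * (x ^ m * y ^ n) / (INR (fact m) * INR (fact n)).

Definition kdf_diag (as_ cs bs ds bs' ds' : list R) (x y : R) (N : nat) : R :=
  sum_f_R0 (fun m => kdf_term as_ cs bs ds bs' ds' x y m (N - m)%nat) N.

Definition kdf_abs_conv (as_ cs bs ds bs' ds' : list R) (x y : R) : Prop :=
  exists M, forall N, sum_f_R0 (fun k =>
    sum_f_R0 (fun m => Rabs (kdf_term as_ cs bs ds bs' ds' x y m (k - m)%nat)) k) N <= M.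

Definition is_kdf (as_ cs bs ds bs' ds' : list R) (x y F : R) : Prop :=
  kdf_abs_conv as_ cs bs ds bs' ds' x y /\
  infinite_sum (kdf_diag as_ cs bs ds bs' ds' x y) F.

(* L(g,s) at a point of absolute convergence: sum_{n>=1} b_n n^{-s} *)
Definition is_L_g_4 (L : R) : Prop :=
  infinite_sum (fun k => b (S k) / INR (S k) ^ 4) L.

(* Main.v *)
Require Import Defs.
From Stdlib Require Import Reals ZArith List.
From Stdlib Require Import Ranalysis5 Lra Lia Classical ClassicalEpsilon FunctionalExtensionality.
From Coquelicot Require Import Coquelicot.
Import ListNotations.
Open Scope R_scope.

(* With w > 0 and q = exp (-2 w), put alpha = theta3(q)^2, beta = theta2(q)^2, gamma = theta4(q)^2.
   The even and the odd part of sum sech (n w) over n in Z obey the same doubling relations w -> 2 w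
   as alpha and beta, and Landen's recursion contracts, so they agree; this is the two squares
   theorem.  Telescoping sech x sech y = (tanh x - tanh y) / sinh (x - y) along lines x - y = const
   then gives sum n / sinh (n w) = alpha beta and
   sum n^3 / sinh (n w) = alpha beta (alpha^2 + beta^2) over odd n.
   The doubling relations also force the derivative formulas
   (log (alpha / gamma))' = - beta^2 and (log alpha)'' = ((log alpha)')^2 + beta^2 gamma^2:
   in each case the defect, suitably scaled, does not decrease under w -> 2 w and tends to 0 at
   infinity.  Hence, with x = beta^2 / alpha^2, one has 2F1(1/2,1/2;1;x) = alpha and
   sqrt x 3F2(1,1,1;3/2,3/2;x) = 2 alpha U, where U(w) = sum sech (m w) / m^2 over odd m > 0 and
   U'' = beta gamma^2 / 2; the solution 2F1(1/2,1/2;1;1-x) gives the inversion w -> PI^2 / (4 w).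
   Now g = alpha beta gamma / 4 at q = exp (-w), so 24 L(g,4) is the integral of w^3 alpha beta gamma.
   Following Rogers and Zudilin, expand alpha beta in n / sinh (n w), the inverted gamma in
   sech (m PI^2 / (4 w)), and rescale w termwise by m / n: the integral becomes a multiple of that of
   alpha gamma (alpha^2 + gamma^2) U, which in the variable x is a sum of beta integrals. *)

(** * Unordered sums of nonnegative terms *)

(** Positivity shapes the argument: sums and integrals are suprema of nonnegative finite sums and of
    integrals over compact intervals, so every interchange is Tonelli's theorem and existence comes
    from comparison. Two signed objects must be fitted in. The series of [th4] alternates, but [2 *
    s / PI * gamma s = beta (PI^2 / (4 s))] is a sum of positive [sech] terms; this is why the
    inversion has to precede the exchange of the two series. The coefficients [b n] are signed as
    well, and [L(g,4)] is obtained as a difference of two series with nonnegative coefficients, the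
    first having all signs of [th4] removed.

    The doubling relations stand in for Poisson summation: quantities invariant under [w -> 2 w],
    and constants of integration, are fixed by the limit [q -> 0], where power series in [q] are
    simply evaluated. The inversion also uses [w -> 0], where [alpha w] is compared with
    [PI / (2 w)].

    The constant [PI^4 / 768] arises from [L(g,4) = J / 24] and [16 J / PI^3 = PI (F1 + F2 / 2)],
    where [J] is the integral of [s^3 alpha beta gamma] and [F1], [F2] are the two double series. *)

Definition lsum {I : Type} (f : I -> R) (l : list I) : R :=
  fold_right (fun i s => f i + s) 0 l.

(** The supremum runs over duplicate-free finite lists, so the index type needs neither an order nor
    an enumeration. Nonnegativity and finiteness are part of the predicate, so reindexing and
    interchange need no separate summability hypothesis. *)
Definition nnsum {I : Type} (f : I -> R) (S : R) : Prop :=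
  (forall i, 0 <= f i) /\ is_lub (fun s => exists l, NoDup l /\ s = lsum f l) S.

Lemma lsum_ext {I} (f g : I -> R) l :
  (forall i, In i l -> f i = g i) -> lsum f l = lsum g l.
Proof.
  induction l as [|i l IH]; intros H; simpl; auto.
  rewrite (H i (or_introl eq_refl)), IH; auto.
  intros j Hj; apply H; right; exact Hj.
Qed.

Lemma lsum_le {I} (f g : I -> R) l :
  (forall i, In i l -> f i <= g i) -> lsum f l <= lsum g l.
Proof.
  induction l as [|i l IH]; intros H; simpl; [lra|].
  apply Rplus_le_compat; [apply H; left; auto|apply IH; intros; apply H; right; auto].
Qed.

Lemma lsum_nonneg {I} (f : I -> R) l : (forall i, 0 <= f i) -> 0 <= lsum f l.
Proof. intros H; induction l as [|i l IH]; simpl; [lra|]. specialize (H i); lra. Qed.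

Lemma lsum_app {I} (f : I -> R) l m : lsum f (l ++ m) = lsum f l + lsum f m.
Proof. induction l as [|i l IH]; simpl; [ring|rewrite IH; ring]. Qed.

Lemma lsum_plus {I} (f g : I -> R) l : lsum (fun i => f i + g i) l = lsum f l + lsum g l.
Proof. induction l as [|i l IH]; simpl; [ring|rewrite IH; ring]. Qed.

Lemma lsum_scal {I} c (f : I -> R) l : lsum (fun i => c * f i) l = c * lsum f l.
Proof. induction l as [|i l IH]; simpl; [ring|rewrite IH; ring]. Qed.

Lemma lsum_map {I J} (h : J -> I) (f : I -> R) l : lsum f (map h l) = lsum (fun j => f (h j)) l.
Proof. induction l as [|i l IH]; simpl; [ring|rewrite IH; ring]. Qed.

Lemma lsum_incl {I} (f : I -> R) l m :
  (forall i, 0 <= f i) -> NoDup l -> incl l m -> lsum f l <= lsum f m.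
Proof.
  intros Hf Hl; revert m; induction Hl as [|x l Hx Hl IH]; intros m Hm; simpl.
  - apply lsum_nonneg; auto.
  - destruct (in_split x m (Hm x (or_introl eq_refl))) as [m1 [m2 ->]].
    rewrite lsum_app; simpl.
    assert (lsum f l <= lsum f (m1 ++ m2)).
    { apply IH. intros y Hy. specialize (Hm y (or_intror Hy)).
      apply in_app_iff in Hm. apply in_app_iff. simpl in Hm.
      destruct Hm as [H|[H|H]]; auto. subst; contradiction. }
    rewrite lsum_app in H; lra.
Qed.

(** Classical decidable equality on an arbitrary index type, needed to merge lists with [nodup] and
    to single out one index. *)
Definition eqc {I : Type} (x y : I) : {x = y} + {x <> y} :=
  excluded_middle_informative (x = y).

Lemma nnsum_unique {I} (f : I -> R) S T : nnsum f S -> nnsum f T -> S = T.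
Proof. intros [_ [H1 H2]] [_ [H3 H4]]; apply Rle_antisym; auto. Qed.

Lemma nnsum_ext {I} (f g : I -> R) S : (forall i, f i = g i) -> nnsum f S -> nnsum g S.
Proof. intros H; assert (f = g) as -> by (apply functional_extensionality; auto); auto. Qed.

Lemma nnsum_nonneg {I} (f : I -> R) S : nnsum f S -> 0 <= S.
Proof. intros [_ [H _]]; apply H. exists []; split; [constructor|reflexivity]. Qed.

Lemma nnsum_ge_lsum {I} (f : I -> R) S l : nnsum f S -> NoDup l -> lsum f l <= S.
Proof. intros [_ [H _]] Hl; apply H; eauto. Qed.

Lemma nnsum_ge {I} (f : I -> R) S i : nnsum f S -> f i <= S.
Proof.
  intros H. generalize (nnsum_ge_lsum f S [i] H); simpl; intros H1.
  assert (f i + 0 <= S) by (apply H1; constructor; [simpl; tauto|constructor]). lra.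
Qed.

Lemma nnsum_le_bound {I} (f : I -> R) S M :
  nnsum f S -> (forall l, NoDup l -> lsum f l <= M) -> S <= M.
Proof. intros [_ [_ H]] HM; apply H; intros s [l [Hl ->]]; auto. Qed.

Lemma nnsum_ex {I} (f : I -> R) M :
  (forall i, 0 <= f i) -> (forall l, NoDup l -> lsum f l <= M) ->
  exists S, nnsum f S /\ S <= M.
Proof.
  intros Hf HM.
  destruct (completeness (fun s => exists l, NoDup l /\ s = lsum f l)) as [S HS].
  - exists M; intros s [l [Hl ->]]; auto.
  - exists 0, []; split; [constructor|reflexivity].
  - exists S; split; [split; auto|].
    apply HS; intros s [l [Hl ->]]; auto.
Qed.

Lemma nnsum_approx {I} (f : I -> R) S e :
  nnsum f S -> 0 < e -> exists l, NoDup l /\ S - e < lsum f l.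
Proof.
  intros H He. apply NNPP; intros Hn.
  assert (S <= S - e); [|lra].
  apply (nnsum_le_bound f); auto; intros l Hl.
  apply Rnot_lt_le; intros H1; apply Hn; exists l; auto.
Qed.

Lemma nnsum_intro {I} (f : I -> R) S :
  (forall i, 0 <= f i) -> (forall l, NoDup l -> lsum f l <= S) ->
  (forall e, 0 < e -> exists l, NoDup l /\ S - e <= lsum f l) -> nnsum f S.
Proof.
  intros Hf H1 H2; split; auto; split.
  - intros s [l [Hl ->]]; auto.
  - intros M HM. apply le_epsilon; intros e He.
    destruct (H2 e He) as [l [Hl Hs]].
    assert (lsum f l <= M) by (apply HM; eauto). lra.
Qed.

Lemma nnsum_le_ex {I} (f g : I -> R) T :
  (forall i, 0 <= f i <= g i) -> nnsum g T -> exists S, nnsum f S /\ S <= T.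
Proof.
  intros H HT. apply nnsum_ex; [apply H|].
  intros l Hl. apply Rle_trans with (lsum g l).
  - apply lsum_le; intros; apply H.
  - apply nnsum_ge_lsum; auto.
Qed.

Lemma nnsum_le {I} (f g : I -> R) S T :
  (forall i, f i <= g i) -> nnsum f S -> nnsum g T -> S <= T.
Proof.
  intros H HS HT. apply (nnsum_le_bound f); auto.
  intros l Hl. apply Rle_trans with (lsum g l).
  - apply lsum_le; auto.
  - apply nnsum_ge_lsum; auto.
Qed.

Lemma nnsum_zero {I} : nnsum (fun _ : I => 0) 0.
Proof.
  assert (H : forall l : list I, lsum (fun _ => 0) l = 0).
  { induction l as [|x l IH]; simpl; [|rewrite IH]; ring. }
  apply nnsum_intro; intros; try lra.
  - rewrite H; lra.
  - exists []; split; [constructor|simpl; lra].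
Qed.

Lemma nnsum_scal {I} c (f : I -> R) S :
  0 <= c -> nnsum f S -> nnsum (fun i => c * f i) (c * S).
Proof.
  intros Hc H. apply nnsum_intro.
  - intros i; apply Rmult_le_pos; auto; apply H.
  - intros l Hl; rewrite lsum_scal; apply Rmult_le_compat_l; auto; apply nnsum_ge_lsum; auto.
  - intros e He. destruct (nnsum_approx f S (e / (c + 1)) H) as [l [Hl Hs]].
    { apply Rdiv_lt_0_compat; lra. }
    exists l; split; auto. rewrite lsum_scal.
    assert (c * (e / (c + 1)) <= e).
    { replace (c * (e / (c + 1))) with (e * (c / (c + 1))) by (field; lra).
      rewrite <- (Rmult_1_r e) at 2. apply Rmult_le_compat_l; [lra|].
      apply (Rdiv_le_1 c (c + 1)); lra. }
    nra.
Qed.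

Lemma nnsum_plus {I} (f g : I -> R) S T :
  nnsum f S -> nnsum g T -> nnsum (fun i => f i + g i) (S + T).
Proof.
  intros HS HT. apply nnsum_intro.
  - intros i; apply Rplus_le_le_0_compat; [apply HS|apply HT].
  - intros l Hl; rewrite lsum_plus; apply Rplus_le_compat; apply nnsum_ge_lsum; auto.
  - intros e He.
    destruct (nnsum_approx f S (e / 2) HS) as [l [Hl Hs]]; [lra|].
    destruct (nnsum_approx g T (e / 2) HT) as [m [Hm Ht]]; [lra|].
    exists (nodup eqc (l ++ m)); split; [apply NoDup_nodup|].
    rewrite lsum_plus.
    assert (lsum f l <= lsum f (nodup eqc (l ++ m))).
    { apply lsum_incl; [apply HS|auto|]. intros x Hx; apply nodup_In, in_app_iff; auto. }
    assert (lsum g m <= lsum g (nodup eqc (l ++ m))).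
    { apply lsum_incl; [apply HT|auto|]. intros x Hx; apply nodup_In, in_app_iff; auto. }
    lra.
Qed.

(** Comparison with the larger family gives [f] some sum, and additivity then pins its value. Sums
    with no direct evaluation are isolated this way later. *)
Lemma nnsum_minus {I} (f g : I -> R) S T :
  (forall i, 0 <= f i) -> nnsum (fun i => f i + g i) S -> nnsum g T -> nnsum f (S - T).
Proof.
  intros Hf HS HT.
  destruct (nnsum_le_ex f (fun i => f i + g i) S) as [S' [HS' _]]; auto.
  { intros i; split; auto. assert (0 <= g i) by apply HT. lra. }
  replace (S - T) with S'; auto.
  rewrite (nnsum_unique _ _ _ HS (nnsum_plus _ _ _ _ HS' HT)); ring.
Qed.

Lemma NoDup_map_inj {I J} (h : J -> I) l :
  (forall x y, h x = h y -> x = y) -> NoDup l -> NoDup (map h l).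
Proof.
  intros Hh; induction 1 as [|x l Hx Hl IH]; simpl; constructor; auto.
  rewrite in_map_iff; intros [y [Hy Hy']]; apply Hh in Hy; subst; auto.
Qed.

(** After dropping the indices where [f] vanishes, a finite list in [I] is the image of a list in
    [J]; hence both families of finite sums have the same supremum. *)
Lemma nnsum_inj {I J} (h : J -> I) (f : I -> R) S :
  (forall x y, h x = h y -> x = y) -> (forall i, 0 <= f i) ->
  (forall i, (exists j, i = h j) \/ f i = 0) ->
  nnsum (fun j => f (h j)) S <-> nnsum f S.
Proof.
  intros Hh Hf Hr.
  assert (Hlist : forall l, NoDup l -> exists m, NoDup m /\ lsum f l = lsum (fun j => f (h j)) m
             /\ (forall j, In j m -> In (h j) l)).
  { induction 1 as [|x l Hx Hl [m [Hm [Hs Hi]]]]; simpl.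
    - exists []; repeat split; [constructor|simpl; tauto].
    - destruct (Hr x) as [[j ->]|H0].
      + exists (j :: m); simpl; repeat split.
        * constructor; auto.
        * rewrite Hs; ring.
        * intros k [->|Hk]; auto.
      + exists m; repeat split; auto. rewrite H0, Hs; ring. }
  split; intros H.
  - apply nnsum_intro; auto.
    + intros l Hl. destruct (Hlist l Hl) as [m [Hm [-> _]]]. apply (nnsum_ge_lsum _ _ _ H Hm).
    + intros e He. destruct (nnsum_approx _ _ e H He) as [l [Hl Hs]].
      exists (map h l); split; [apply NoDup_map_inj; auto|]. rewrite lsum_map; lra.
  - apply nnsum_intro; auto.
    + intros l Hl. rewrite <- lsum_map. apply (nnsum_ge_lsum _ _ _ H), NoDup_map_inj; auto.
    + intros e He. destruct (nnsum_approx _ _ e H He) as [l [Hl Hs]].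
      destruct (Hlist l Hl) as [m [Hm [E _]]]. exists m; split; auto. lra.
Qed.

Lemma nnsum_bij {I J} (h : J -> I) (k : I -> J) (f : I -> R) S :
  (forall x, k (h x) = x) -> (forall y, h (k y) = y) ->
  nnsum f S -> nnsum (fun j => f (h j)) S.
Proof.
  intros H1 H2 H. apply (nnsum_inj h f S); auto.
  - intros x y E; rewrite <- (H1 x), <- (H1 y), E; auto.
  - apply H.
  - intros i; left; exists (k i); auto.
Qed.

Lemma lsum_single {I} (i0 : I) c l :
  NoDup l -> In i0 l -> lsum (fun i => if eqc i0 i then c else 0) l = c.
Proof.
  induction 1 as [|x l Hx Hl IH]; simpl; [tauto|].
  intros [->|Hi].
  - destruct (eqc i0 i0) as [_|n]; [|congruence].
    rewrite (lsum_ext _ (fun i => 0 * 0)), lsum_scal; [ring|].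
    intros i Hi. destruct (eqc i0 i) as [->|_]; [contradiction|ring].
  - rewrite IH; auto. destruct (eqc i0 x) as [->|_]; [contradiction|ring].
Qed.

Lemma nnsum_fubini_approx {I J} (f : I -> J -> R) (g : I -> R) A :
  (forall i, nnsum (f i) (g i)) -> NoDup A -> forall e, 0 < e ->
  exists L, NoDup L /\ (forall p, In p L -> In (fst p) A) /\
    lsum g A - e <= lsum (fun p => f (fst p) (snd p)) L.
Proof.
  intros Hg; induction 1 as [|i A Hi HA IH]; intros e He.
  - exists []; simpl; repeat split; [constructor|tauto|lra].
  - destruct (IH (e / 2)) as [L [HL [Hin Hs]]]; [lra|].
    destruct (nnsum_approx _ _ (e / 2) (Hg i)) as [l [Hl Hs']]; [lra|].
    exists (map (pair i) l ++ L); repeat split.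
    + apply NoDup_app; auto.
      * apply NoDup_map_inj; auto; congruence.
      * intros p Hp Hp'. apply in_map_iff in Hp. destruct Hp as [j [<- _]].
        apply Hin in Hp'; contradiction.
    + intros p Hp; apply in_app_iff in Hp; destruct Hp as [Hp|Hp].
      * apply in_map_iff in Hp; destruct Hp as [j [<- _]]; left; auto.
      * right; auto.
    + rewrite lsum_app, lsum_map; simpl.
      change (fun j => f i j) with (f i). lra.
Qed.

Lemma lsum_group {I J} (f : I -> J -> R) (L : list (I * J)) A :
  NoDup A -> (forall p, In p L -> In (fst p) A) ->
  lsum (fun p => f (fst p) (snd p)) L =
  lsum (fun i => lsum (f i) (map snd (filter (fun p => if eqc (fst p) i then true else false) L))) A.
Proof.
  intros HA; induction L as [|[i0 j0] L IH]; intros Hin; simpl.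
  - rewrite (lsum_ext _ (fun _ => 0 * 0)), lsum_scal; [ring|intros; ring].
  - rewrite IH by (intros; apply Hin; right; auto).
    rewrite <- (lsum_single i0 (f i0 j0) A); auto; [|apply (Hin (i0, j0)); left; auto].
    rewrite <- lsum_plus. apply lsum_ext; intros i Hi.
    destruct (eqc i0 i) as [->|n]; simpl; ring.
Qed.

Lemma nnsum_fubini_1 {I J} (f : I -> J -> R) (g : I -> R) S :
  (forall i, nnsum (f i) (g i)) -> nnsum g S ->
  nnsum (fun p => f (fst p) (snd p)) S.
Proof.
  intros Hg HS. apply nnsum_intro.
  - intros [i j]; apply Hg.
  - intros L HL. rewrite (lsum_group f L (nodup eqc (map fst L))).
    + apply Rle_trans with (lsum g (nodup eqc (map fst L))).
      * apply lsum_le; intros i _. apply nnsum_ge_lsum; auto.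
        clear - HL. induction HL as [|[i0 j0] L Hx HL IH]; simpl; [constructor|].
        destruct (eqc i0 i) as [->|_]; simpl; auto. constructor; auto.
        intros H; apply in_map_iff in H; destruct H as [[i1 j1] [E H]]; simpl in E; subst.
        apply filter_In in H; destruct H as [H E]; simpl in E.
        destruct (eqc i1 i) as [->|_]; [contradiction|discriminate].
      * apply nnsum_ge_lsum; auto. apply NoDup_nodup.
    + apply NoDup_nodup.
    + intros p Hp; apply nodup_In, in_map; auto.
  - intros e He. destruct (nnsum_approx g S (e / 2) HS) as [A [HA Hs]]; [lra|].
    destruct (nnsum_fubini_approx f g A Hg HA (e / 2)) as [L [HL [_ Hs']]]; [lra|].
    exists L; split; auto. lra.
Qed.

(** Tonelli in both directions. The converse first bounds finite sums of row sums by the sum over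
    pairs, which gives existence, and then uses the direct implication for the value. *)
Lemma nnsum_fubini {I J} (f : I -> J -> R) (g : I -> R) S :
  (forall i, nnsum (f i) (g i)) ->
  (nnsum g S <-> nnsum (fun p => f (fst p) (snd p)) S).
Proof.
  intros Hg; split; intros HS; [apply (nnsum_fubini_1 f g); auto|].
  destruct (nnsum_ex g S) as [S' [HS' _]].
  - intros i; apply (nnsum_nonneg (f i)); auto.
  - intros A HA. apply le_epsilon; intros e He.
    destruct (nnsum_fubini_approx f g A Hg HA e He) as [L [HL [_ Hs']]].
    assert (H := nnsum_ge_lsum _ _ _ HS HL). lra.
  - assert (H := nnsum_fubini_1 f g S' Hg HS').
    rewrite (nnsum_unique _ _ _ HS H); auto.
Qed.

(** A column is a subfamily of a summable family of pairs, so its sum exists; a choice principle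
    collects these sums into a function of [j]. *)
Lemma nnsum_swap {I J} (f : I -> J -> R) (g : I -> R) S :
  (forall i, nnsum (f i) (g i)) -> nnsum g S ->
  exists h : J -> R, (forall j, nnsum (fun i => f i j) (h j)) /\ nnsum h S.
Proof.
  intros Hg HS.
  assert (HP : nnsum (fun p : J * I => f (snd p) (fst p)) S).
  { apply (nnsum_bij (fun p : J * I => (snd p, fst p)) (fun p => (snd p, fst p))
      (fun p => f (fst p) (snd p))); try (intros [x y]; reflexivity).
    apply (nnsum_fubini_1 f g); auto. }
  assert (Hex : forall j, exists h, nnsum (fun i => f i j) h).
  { intros j. destruct (nnsum_ex (fun i => f i j) S) as [h [Hh _]].
    - intros i; apply Hg.
    - intros l Hl. assert (H := nnsum_ge_lsum _ _ (map (pair j) l) HP).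
      rewrite lsum_map in H; simpl in H. apply H.
      apply NoDup_map_inj; auto; congruence.
    - eauto. }
  exists (fun j => proj1_sig (constructive_indefinite_description _ (Hex j))).
  assert (Hh : forall j, nnsum (fun i => f i j)
     (proj1_sig (constructive_indefinite_description _ (Hex j)))).
  { intros j; apply (proj2_sig (constructive_indefinite_description _ (Hex j))). }
  split; auto.
  apply (nnsum_fubini (fun j i => f i j)); auto.
Qed.

Lemma nnsum_swap_eq {I J} (f : I -> J -> R) (g : I -> R) (h : J -> R) S :
  (forall i, nnsum (f i) (g i)) -> (forall j, nnsum (fun i => f i j) (h j)) ->
  nnsum g S -> nnsum h S.
Proof.
  intros Hg Hh HS. destruct (nnsum_swap f g S Hg HS) as [h' [Hh' HS']].
  apply (nnsum_ext h'); auto. intros j; apply (nnsum_unique _ _ _ (Hh' j) (Hh j)).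
Qed.

Lemma nnsum_prod {I J} (f : I -> R) (g : J -> R) S T :
  nnsum f S -> nnsum g T -> nnsum (fun p => f (fst p) * g (snd p)) (S * T).
Proof.
  intros HS HT.
  apply (nnsum_fubini_1 (fun i j => f i * g j) (fun i => f i * T)).
  - intros i; apply nnsum_scal; auto; apply HS.
  - apply (nnsum_ext (fun i => T * f i)); [intros; ring|].
    rewrite Rmult_comm. apply nnsum_scal; auto. apply (nnsum_nonneg g); auto.
Qed.

Lemma nnsum_sumtype {I J} (f : I + J -> R) S T :
  nnsum (fun i => f (inl i)) S -> nnsum (fun j => f (inr j)) T -> nnsum f (S + T).
Proof.
  intros HS HT.
  apply (nnsum_ext (fun x => match x with inl i => f (inl i) | inr _ => 0 end
                          + match x with inl _ => 0 | inr j => f (inr j) end)).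
  { intros [i|j]; ring. }
  apply nnsum_plus.
  - apply (nnsum_inj (@inl I J)); auto; [congruence| |].
    + intros [i|j]; [apply HS|lra].
    + intros [i|j]; eauto.
  - apply (nnsum_inj (@inr I J)); auto; [congruence| |].
    + intros [i|j]; [lra|apply HT].
    + intros [i|j]; eauto.
Qed.

Lemma nnsum_sumtype_ex {I J} (f : I + J -> R) S :
  nnsum f S -> exists S1 S2, nnsum (fun i => f (inl i)) S1 /\ nnsum (fun j => f (inr j)) S2 /\ S = S1 + S2.
Proof.
  intros H.
  destruct (nnsum_ex (fun i => f (inl i)) S) as [S1 [H1 _]].
  { intros; apply H. }
  { intros l Hl; rewrite <- (lsum_map inl f). apply nnsum_ge_lsum; auto.
    apply NoDup_map_inj; auto; congruence. }
  destruct (nnsum_ex (fun i => f (inr i)) S) as [S2 [H2 _]].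
  { intros; apply H. }
  { intros l Hl; rewrite <- (lsum_map inr f). apply nnsum_ge_lsum; auto.
    apply NoDup_map_inj; auto; congruence. }
  exists S1, S2; repeat split; try apply H1; try apply H2.
  apply (nnsum_unique f); auto. apply nnsum_sumtype; auto.
Qed.

Lemma nnsum_finite {I} (f : I -> R) l :
  (forall i, 0 <= f i) -> NoDup l -> (forall i, ~ In i l -> f i = 0) -> nnsum f (lsum f l).
Proof.
  intros Hf Hl H0. apply nnsum_intro; auto.
  - intros m Hm.
    assert (Hm' : lsum f m = lsum f (filter (fun i => if excluded_middle_informative (In i l) then true else false) m)).
    { clear Hm; induction m as [|x m IH]; simpl; auto.
      destruct (excluded_middle_informative (In x l)); simpl; rewrite IH; auto.
      rewrite H0; auto; ring. }
    rewrite Hm'. apply lsum_incl; auto.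
    + apply NoDup_filter; auto.
    + intros x Hx. apply filter_In in Hx; destruct Hx as [_ Hx].
      destruct (excluded_middle_informative (In x l)); auto; discriminate.
  - intros e He; exists l; split; auto; lra.
Qed.

Lemma sum_f_R0_lsum (f : nat -> R) n : sum_f_R0 f n = lsum f (seq 0 (S n)).
Proof.
  induction n as [|n IH]; [simpl; ring|].
  rewrite seq_S, lsum_app. simpl plus. rewrite <- IH. simpl; ring.
Qed.

Lemma nnsum_is_series (f : nat -> R) S : nnsum f S -> is_series f S.
Proof.
  intros H. change (is_lim_seq (sum_n f) S). apply is_lim_seq_spec; intros [e He]; simpl.
  destruct (nnsum_approx f S e H He) as [l [Hl Hs]].
  exists (list_max l); intros n Hn. rewrite sum_n_Reals, sum_f_R0_lsum.
  assert (H1 : lsum f (seq 0 (Datatypes.S n)) <= S) by (apply nnsum_ge_lsum; auto; apply seq_NoDup).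
  assert (H2 : lsum f l <= lsum f (seq 0 (Datatypes.S n))).
  { apply lsum_incl; auto; [apply H|]. intros x Hx; apply in_seq.
    assert (x <= list_max l)%nat; [|lia].
    assert (HF := proj1 (list_max_le l (list_max l)) (le_n _)).
    rewrite Forall_forall in HF; auto. }
  apply Rabs_def1; lra.
Qed.

Lemma is_series_nnsum (f : nat -> R) S : (forall n, 0 <= f n) -> is_series f S -> nnsum f S.
Proof.
  intros Hf HS.
  assert (Hb : forall n, sum_n f n <= S).
  { intros n. apply (is_lim_seq_incr_compare (sum_n f)); [exact HS|].
    intros k; rewrite sum_Sn. unfold plus; simpl. specialize (Hf (Datatypes.S k)); lra. }
  destruct (nnsum_ex f S) as [S' [HS' _]]; auto.
  - intros l Hl. apply Rle_trans with (sum_n f (list_max l)); auto.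
    rewrite sum_n_Reals, sum_f_R0_lsum. apply lsum_incl; auto.
    intros x Hx; apply in_seq.
    assert (HF := proj1 (list_max_le l (list_max l)) (le_n _)).
    rewrite Forall_forall in HF. specialize (HF x Hx). lia.
  - assert (H := nnsum_is_series f S' HS').
    rewrite <- (is_series_unique _ _ HS), (is_series_unique _ _ H); auto.
Qed.

(** Reindexing by [(m + n, m)], with rows padded by zeros beyond [m = N], makes every row finite. It
    serves both Cauchy products and the diagonal summation order of [kdf_diag]. *)
Lemma nnsum_diag (f : nat -> nat -> R) S :
  (forall m n, 0 <= f m n) ->
  nnsum (fun p => f (fst p) (snd p)) S <->
  nnsum (fun N => sum_f_R0 (fun m => f m (N - m)%nat) N) S.
Proof.
  intros Hf.
  set (g := fun N m => if (m <=? N)%nat then f m (N - m)%nat else 0).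
  assert (E : forall m n, g (m + n)%nat m = f m n).
  { intros m n; unfold g. rewrite (proj2 (Nat.leb_le m (m + n))) by lia.
    replace (m + n - m)%nat with n by lia; auto. }
  assert (Hin : forall N, nnsum (g N) (sum_f_R0 (fun m => f m (N - m)%nat) N)).
  { intros N. rewrite sum_f_R0_lsum.
    rewrite (lsum_ext _ (g N)).
    - apply nnsum_finite.
      + intros m; unfold g; destruct (m <=? N)%nat; auto; lra.
      + apply seq_NoDup.
      + intros m Hm; unfold g. destruct (Nat.leb_spec m N); auto.
        exfalso; apply Hm, in_seq; lia.
    - intros m Hm; apply in_seq in Hm. unfold g. rewrite (proj2 (Nat.leb_le m N)) by lia; auto. }
  rewrite (nnsum_fubini g) by auto.
  rewrite <- (nnsum_inj (fun p : nat * nat => (fst p + snd p, fst p)%nat)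
                 (fun p => g (fst p) (snd p)) S).
  - split; apply nnsum_ext; intros [m n]; simpl; auto; rewrite E; auto.
  - intros [m n] [m' n']; simpl; intros H; injection H; intros; subst; f_equal; lia.
  - intros [m n]; unfold g; simpl. destruct (n <=? m)%nat; auto; lra.
  - intros [N m]; unfold g; simpl. destruct (Nat.leb_spec m N); auto.
    left; exists (m, N - m)%nat; simpl; f_equal; lia.
Qed.

Lemma nnsum_geom y : 0 <= y < 1 -> nnsum (fun n => y ^ n) (/ (1 - y)).
Proof.
  intros Hy. apply is_series_nnsum.
  - intros n; apply pow_le; lra.
  - apply is_series_geom. rewrite Rabs_pos_eq; lra.
Qed.

(* Summing over [p + q = N] the product of two geometric series. *)
Lemma nnsum_geom_deriv y : 0 <= y < 1 -> nnsum (fun n => INR (S n) * y ^ n) (/ (1 - y) ^ 2).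
Proof.
  intros Hy. replace (/ (1 - y) ^ 2) with (/ (1 - y) * / (1 - y)) by (field; lra).
  assert (H := nnsum_prod _ _ _ _ (nnsum_geom y Hy) (nnsum_geom y Hy)).
  apply (nnsum_diag (fun m n => y ^ m * y ^ n)) in H.
  - revert H; apply nnsum_ext; intros N.
    rewrite (sum_eq _ (fun _ => y ^ N)), sum_cte; [ring|].
    intros i Hi; rewrite <- pow_add; f_equal; lia.
  - intros; apply Rmult_le_pos; apply pow_le; lra.
Qed.

Lemma Z_even_odd_nnsum (f : Z -> R) S T :
  nnsum (fun k => f (2 * k)%Z) S -> nnsum (fun k => f (2 * k + 1)%Z) T -> nnsum f (S + T).
Proof.
  intros HS HT.
  assert (H := nnsum_sumtype (fun x : Z + Z => match x with inl k => f (2 * k)%Z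
     | inr k => f (2 * k + 1)%Z end) S T HS HT).
  set (h := fun n : Z => if Z.even n then inl (n / 2)%Z else inr (n / 2)%Z : Z + Z).
  apply (nnsum_bij h (fun x => match x with inl k => (2 * k)%Z | inr k => (2 * k + 1)%Z end)) in H.
  - revert H; apply nnsum_ext; intros n; unfold h.
    assert (Hn := Zmod_even n). assert (Hd := Z.div_mod n 2 ltac:(lia)).
    destruct (Z.even n); f_equal; lia.
  - intros n; unfold h. assert (Hn := Zmod_even n). assert (Hd := Z.div_mod n 2 ltac:(lia)).
    destruct (Z.even n); lia.
  - intros [k|k]; unfold h.
    + replace (Z.even (2 * k)) with true by (rewrite Z.even_mul; auto).
      f_equal; rewrite Z.mul_comm, Z.div_mul; lia.
    + replace (Z.even (2 * k + 1)) with false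
        by (rewrite Z.even_add, Z.even_mul; auto).
      f_equal; symmetry; apply (Z.div_unique _ _ _ 1); lia.
Qed.

Lemma nnsum_shift (f : Z -> R) c S : nnsum f S -> nnsum (fun k => f (k + c)%Z) S.
Proof. apply (nnsum_bij (fun k => k + c)%Z (fun k => k - c)%Z); intros; lia. Qed.

Lemma nnsum_refl (f : Z -> R) c S : nnsum f S -> nnsum (fun k => f (c - k)%Z) S.
Proof. apply (nnsum_bij (fun k => c - k)%Z (fun k => c - k)%Z); intros; lia. Qed.

Definition Z_of_sum (x : nat + nat) : Z :=
  match x with inl n => Z.of_nat n | inr n => (- Z.of_nat (Datatypes.S n))%Z end.

Definition sum_of_Z (k : Z) : nat + nat :=
  if (0 <=? k)%Z then inl (Z.to_nat k) else inr (Z.to_nat (- k - 1)).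

Lemma sum_of_Z_K k : Z_of_sum (sum_of_Z k) = k.
Proof. unfold sum_of_Z; destruct (Z.leb_spec 0 k); simpl Z_of_sum; lia. Qed.

Lemma Z_of_sum_K x : sum_of_Z (Z_of_sum x) = x.
Proof.
  destruct x as [n|n]; unfold Z_of_sum, sum_of_Z.
  - destruct (Z.leb_spec 0 (Z.of_nat n)); [f_equal; lia|lia].
  - destruct (Z.leb_spec 0 (- Z.of_nat (Datatypes.S n))); [lia|f_equal; lia].
Qed.

Lemma nnsum_Z (f : Z -> R) S T :
  nnsum (fun n => f (Z.of_nat n)) S -> nnsum (fun n => f (- Z.of_nat (Datatypes.S n))%Z) T ->
  nnsum f (S + T).
Proof.
  intros HS HT.
  assert (H := nnsum_sumtype (fun x => f (Z_of_sum x)) S T HS HT).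
  apply (nnsum_bij sum_of_Z Z_of_sum) in H.
  - revert H; apply nnsum_ext; intros k; rewrite sum_of_Z_K; auto.
  - apply sum_of_Z_K.
  - apply Z_of_sum_K.
Qed.

Lemma nnsum_Z_ex (f : Z -> R) S :
  nnsum f S -> exists S1 S2, nnsum (fun n => f (Z.of_nat n)) S1 /\
    nnsum (fun n => f (- Z.of_nat (Datatypes.S n))%Z) S2 /\ S = S1 + S2.
Proof.
  intros H. apply (nnsum_bij Z_of_sum sum_of_Z) in H;
    [|apply Z_of_sum_K|apply sum_of_Z_K].
  apply nnsum_sumtype_ex in H. exact H.
Qed.

Lemma nnsum_split1 {I} (f : I -> R) i0 S :
  (forall i, 0 <= f i) ->
  nnsum (fun i => if eqc i0 i then 0 else f i) S <-> nnsum f (f i0 + S).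
Proof.
  intros Hf.
  assert (H1 : nnsum (fun i => if eqc i0 i then f i0 else 0) (f i0)).
  { assert (H := nnsum_finite (fun i => if eqc i0 i then f i0 else 0) [i0]).
    simpl in H. destruct (eqc i0 i0) as [_|n]; [|congruence].
    rewrite Rplus_0_r in H. apply H.
    - intros i; destruct (eqc i0 i); auto; lra.
    - constructor; [simpl; tauto|constructor].
    - intros i Hi; destruct (eqc i0 i) as [->|]; auto. elim Hi; left; auto. }
  split; intros H.
  - apply (nnsum_ext (fun i => (if eqc i0 i then f i0 else 0) + (if eqc i0 i then 0 else f i))).
    + intros i; destruct (eqc i0 i) as [->|]; ring.
    + apply nnsum_plus; auto.
  - replace S with (f i0 + S - f i0) by ring.
    apply (nnsum_minus _ (fun i => if eqc i0 i then f i0 else 0)); auto.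
    + intros i; destruct (eqc i0 i); auto; lra.
    + revert H; apply nnsum_ext; intros i; destruct (eqc i0 i) as [->|]; ring.
Qed.

(* [tsum f] is the junk value [0] when the sum is infinite. *)
Definition tsum {I : Type} (f : I -> R) : R :=
  real (Lub_Rbar (fun s => exists l, NoDup l /\ s = lsum f l)).

Lemma tsum_unique {I} (f : I -> R) S : nnsum f S -> tsum f = S.
Proof.
  intros [_ [H1 H2]]. unfold tsum.
  rewrite (is_lub_Rbar_unique _ (Finite S)); auto.
  split.
  - intros s Hs; apply (H1 s Hs).
  - intros [M| |] HM.
    + apply H2; intros s Hs; apply (HM s Hs).
    + exact Logic.I.
    + exact (HM 0 (ex_intro _ [] (conj (NoDup_nil _) eq_refl))).
Qed.

Lemma tsum_correct {I} (f : I -> R) : (exists S, nnsum f S) -> nnsum f (tsum f).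
Proof. intros [S HS]; rewrite (tsum_unique f S); auto. Qed.

(** * Improper integrals of nonnegative continuous functions *)

Definition oint (p q : Rbar) (x : R) : Prop := Rbar_lt p x /\ Rbar_lt x q.

(** The integral analogue of [nnsum]: a supremum over compact subintervals of an open, possibly
    unbounded interval. Continuity is included so that the inner Riemann integrals exist; nothing is
    assumed at the endpoints. *)
Definition nnint (p q : Rbar) (f : R -> R) (l : R) : Prop :=
  (forall x, oint p q x -> 0 <= f x /\ continuous f x) /\
  is_lub (fun s => exists x y, oint p q x /\ oint p q y /\ x <= y /\ s = RInt f x y) l.

Lemma oint_between p q x y z : oint p q x -> oint p q y -> x <= z <= y -> oint p q z.
Proof.
  intros [H1 H2] [H3 H4] Hz; split.
  - apply Rbar_lt_le_trans with x; simpl; tauto.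
  - apply Rbar_le_lt_trans with y; simpl; tauto.
Qed.

Lemma oint_RInt_ex p q (f : R -> R) x y : (forall z, oint p q z -> continuous f z) ->
  oint p q x -> oint p q y -> ex_RInt f x y.
Proof.
  intros Hf Hx Hy. apply (ex_RInt_continuous (V := R_CompleteNormedModule)).
  intros z Hz. apply Hf.
  destruct (Rle_dec x y).
  - rewrite Rmin_left, Rmax_right in Hz by lra. apply (oint_between p q x y); auto.
  - rewrite Rmin_right, Rmax_left in Hz by lra. apply (oint_between p q y x); auto.
Qed.

Lemma nnint_unique p q f S T : nnint p q f S -> nnint p q f T -> S = T.
Proof. intros [_ [H1 H2]] [_ [H3 H4]]; apply Rle_antisym; auto. Qed.

Lemma oint_locally p q x : oint p q x -> locally x (oint p q).
Proof.
  intros [H1 H2]. apply filter_and.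
  - apply (open_Rbar_gt' x p); auto.
  - apply (open_Rbar_lt' x q); auto.
Qed.

Lemma nnint_ext p q f g S : (forall x, oint p q x -> f x = g x) -> nnint p q f S -> nnint p q g S.
Proof.
  intros E [H [H1 H2]]. split; [|split].
  - intros x Hx; split; [rewrite <- E; auto; apply H; auto|].
    apply (continuous_ext_loc _ f); [|apply H; auto].
    generalize (oint_locally p q x Hx); apply filter_imp; auto.
  - intros s [x [y [Hx [Hy [Hxy ->]]]]]. apply H1; exists x, y; repeat (split; auto).
    apply RInt_ext; intros z Hz. symmetry; apply E.
    rewrite Rmin_left, Rmax_right in Hz by lra. apply (oint_between p q x y); auto; lra.
  - intros M HM; apply H2. intros s [x [y [Hx [Hy [Hxy ->]]]]]. apply HM; exists x, y; repeat (split; auto).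
    apply RInt_ext; intros z Hz. apply E.
    rewrite Rmin_left, Rmax_right in Hz by lra. apply (oint_between p q x y); auto; lra.
Qed.

Lemma nnint_cont p q f S x : nnint p q f S -> oint p q x -> continuous f x.
Proof. intros [H _] Hx; apply H; auto. Qed.

Lemma nnint_pos p q f S x : nnint p q f S -> oint p q x -> 0 <= f x.
Proof. intros [H _] Hx; apply H; auto. Qed.

Lemma nnint_ge p q f S x y : nnint p q f S -> oint p q x -> oint p q y -> x <= y -> RInt f x y <= S.
Proof. intros [_ [H _]] Hx Hy Hxy; apply H; exists x, y; auto. Qed.

Lemma nnint_le_bound p q f S M : nnint p q f S ->
  (forall x y, oint p q x -> oint p q y -> x <= y -> RInt f x y <= M) -> S <= M.
Proof. intros [_ [_ H]] HM; apply H; intros s [x [y [Hx [Hy [Hxy ->]]]]]; auto. Qed.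

Lemma RInt_oint_sub p q f x y x' y' : (forall z, oint p q z -> 0 <= f z /\ continuous f z) ->
  oint p q x -> oint p q y -> x <= x' -> x' <= y' -> y' <= y -> RInt f x' y' <= RInt f x y.
Proof.
  intros Hf Hx Hy H1 H2 H3.
  assert (Hx' : oint p q x') by (apply (oint_between p q x y); auto; lra).
  assert (Hy' : oint p q y') by (apply (oint_between p q x y); auto; lra).
  assert (Hex : forall u v, oint p q u -> oint p q v -> ex_RInt f u v).
  { intros u v Hu Hv; apply (oint_RInt_ex p q); auto; intros; apply Hf; auto. }
  assert (Hpos : forall u v, oint p q u -> oint p q v -> u <= v -> 0 <= RInt f u v).
  { intros u v Hu Hv Huv; apply RInt_ge_0; auto.
    intros z Hz; apply Hf, (oint_between p q u v); auto; lra. }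
  rewrite <- (RInt_Chasles f x x' y), <- (RInt_Chasles f x' y' y) by auto.
  unfold plus; simpl. assert (A := Hpos x x' Hx Hx' H1). assert (B := Hpos y' y Hy' Hy H3).
  lra.
Qed.

Lemma nnint_approx p q f S e : nnint p q f S -> 0 < e ->
  exists x y, oint p q x /\ oint p q y /\ x <= y /\ S - e < RInt f x y.
Proof.
  intros H He. apply NNPP; intros Hn.
  assert (S <= S - e); [|lra].
  apply (nnint_le_bound p q f); auto; intros x y Hx Hy Hxy.
  apply Rnot_lt_le; intros H1; apply Hn; exists x, y; auto.
Qed.

Lemma oint_nonempty p q : Rbar_lt p q -> exists x, oint p q x.
Proof.
  destruct p as [p| |], q as [q| |]; simpl; intros H; try tauto.
  - exists ((p + q) / 2); split; simpl; lra.
  - exists (p + 1); split; simpl; auto; lra.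
  - exists (q - 1); split; simpl; auto; lra.
  - exists 0; split; simpl; auto.
Qed.

Lemma nnint_ex p q f M : Rbar_lt p q ->
  (forall x, oint p q x -> 0 <= f x /\ continuous f x) ->
  (forall x y, oint p q x -> oint p q y -> x <= y -> RInt f x y <= M) ->
  exists S, nnint p q f S /\ S <= M.
Proof.
  intros Hpq Hf HM.
  destruct (completeness (fun s => exists x y, oint p q x /\ oint p q y /\ x <= y /\ s = RInt f x y)) as [S HS].
  - exists M; intros s [x [y [Hx [Hy [Hxy ->]]]]]; auto.
  - destruct (oint_nonempty p q Hpq) as [x Hx]. exists (RInt f x x), x, x; repeat (split; auto); lra.
  - exists S; split; [split; auto|].
    apply HS; intros s [x [y [Hx [Hy [Hxy ->]]]]]; auto.
Qed.

Lemma nnint_le_ex p q f g T : Rbar_lt p q ->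
  (forall x, oint p q x -> 0 <= f x <= g x /\ continuous f x) ->
  nnint p q g T -> exists S, nnint p q f S /\ S <= T.
Proof.
  intros Hpq H HT. apply nnint_ex; auto.
  - intros x Hx; split; apply H; auto.
  - intros x y Hx Hy Hxy. apply Rle_trans with (RInt g x y); [|apply (nnint_ge p q); auto].
    apply RInt_le; auto.
    + apply (oint_RInt_ex p q); auto; intros; apply H; auto.
    + apply (oint_RInt_ex p q); auto; intros; apply (nnint_cont p q g T); auto.
    + intros z Hz; apply H, (oint_between p q x y); auto; lra.
Qed.

Lemma nnint_intro p q f S :
  (forall x, oint p q x -> 0 <= f x /\ continuous f x) ->
  (forall x y, oint p q x -> oint p q y -> x <= y -> RInt f x y <= S) ->
  (forall e, 0 < e -> exists x y, oint p q x /\ oint p q y /\ x <= y /\ S - e <= RInt f x y) ->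
  nnint p q f S.
Proof.
  intros Hf H1 H2; split; auto; split.
  - intros s [x [y [Hx [Hy [Hxy ->]]]]]; auto.
  - intros M HM. apply le_epsilon; intros e He.
    destruct (H2 e He) as [x [y [Hx [Hy [Hxy Hs]]]]].
    assert (RInt f x y <= M) by (apply HM; exists x, y; auto). lra.
Qed.

Lemma nnint_scal p q c f S : 0 <= c -> nnint p q f S -> nnint p q (fun x => c * f x) (c * S).
Proof.
  intros Hc H.
  assert (E : forall x y, oint p q x -> oint p q y -> RInt (fun z => c * f z) x y = c * RInt f x y).
  { intros x y Hx Hy. apply (RInt_scal (V := R_CompleteNormedModule) f x y c).
    apply (oint_RInt_ex p q); auto. intros; apply (nnint_cont p q f S); auto. }
  apply nnint_intro.
  - intros x Hx; split; [apply Rmult_le_pos; auto; apply (nnint_pos p q f S); auto|].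
    apply (continuous_scal_r c f x). apply (nnint_cont p q f S); auto.
  - intros x y Hx Hy Hxy; rewrite E by auto; apply Rmult_le_compat_l; auto.
    apply (nnint_ge p q f); auto.
  - intros e He. destruct (nnint_approx p q f S (e / (c + 1)) H) as [x [y [Hx [Hy [Hxy Hs]]]]].
    { apply Rdiv_lt_0_compat; lra. }
    exists x, y; repeat (split; auto). rewrite E by auto.
    assert (c * (e / (c + 1)) <= e).
    { replace (c * (e / (c + 1))) with (e * (c / (c + 1))) by (field; lra).
      rewrite <- (Rmult_1_r e) at 2. apply Rmult_le_compat_l; [lra|].
      apply (Rdiv_le_1 c (c + 1)); lra. }
    nra.
Qed.

Lemma nnint_plus p q f g S T : nnint p q f S -> nnint p q g T -> nnint p q (fun x => f x + g x) (S + T).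
Proof.
  intros HS HT.
  assert (Ef : forall x y, oint p q x -> oint p q y -> ex_RInt f x y).
  { intros; apply (oint_RInt_ex p q); auto. intros; apply (nnint_cont p q f S); auto. }
  assert (Eg : forall x y, oint p q x -> oint p q y -> ex_RInt g x y).
  { intros; apply (oint_RInt_ex p q); auto. intros; apply (nnint_cont p q g T); auto. }
  assert (E : forall x y, oint p q x -> oint p q y ->
     RInt (fun z => f z + g z) x y = RInt f x y + RInt g x y).
  { intros x y Hx Hy. apply (RInt_plus (V := R_CompleteNormedModule) f g x y); auto. }
  apply nnint_intro.
  - intros x Hx; split.
    + apply Rplus_le_le_0_compat; [apply (nnint_pos p q f S)|apply (nnint_pos p q g T)]; auto.
    + apply (continuous_plus f g x); [apply (nnint_cont p q f S)|apply (nnint_cont p q g T)]; auto.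
  - intros x y Hx Hy Hxy; rewrite E by auto; apply Rplus_le_compat;
    [apply (nnint_ge p q f)|apply (nnint_ge p q g)]; auto.
  - intros e He.
    destruct (nnint_approx p q f S (e / 2) HS) as [x [y [Hx [Hy [Hxy Hs]]]]]; [lra|].
    destruct (nnint_approx p q g T (e / 2) HT) as [x' [y' [Hx' [Hy' [Hxy' Ht]]]]]; [lra|].
    assert (HX : oint p q (Rmin x x')) by (apply Rmin_case; auto).
    assert (HY : oint p q (Rmax y y')) by (apply Rmax_case; auto).
    assert (A1 := Rmin_l x x'). assert (A2 := Rmin_r x x').
    assert (A3 := Rmax_l y y'). assert (A4 := Rmax_r y y').
    exists (Rmin x x'), (Rmax y y'); repeat (split; auto); [lra|].
    rewrite E by auto.
    assert (RInt f x y <= RInt f (Rmin x x') (Rmax y y')).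
    { apply (RInt_oint_sub p q f); auto. apply HS. }
    assert (RInt g x' y' <= RInt g (Rmin x x') (Rmax y y')).
    { apply (RInt_oint_sub p q g); auto. apply HT. }
    lra.
Qed.

Lemma continuous_lsum {I} (f : I -> R -> R) l x :
  (forall i, continuous (f i) x) -> continuous (fun y => lsum (fun i => f i y) l) x.
Proof.
  intros H; induction l as [|i l IH]; simpl.
  - apply continuous_const.
  - apply (continuous_plus (f i) (fun y => lsum (fun i => f i y) l)); auto.
Qed.

Lemma RInt_lsum {I} (f : I -> R -> R) l x y :
  (forall i, ex_RInt (f i) x y) ->
  is_RInt (fun z => lsum (fun i => f i z) l) x y (lsum (fun i => RInt (f i) x y) l).
Proof.
  intros H; induction l as [|i l IH]; simpl.
  - assert (H0 := is_RInt_const (V := R_NormedModule) x y 0).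
    change (scal (y - x) 0) with ((y - x) * 0) in H0.
    rewrite Rmult_0_r in H0. exact H0.
  - apply (is_RInt_plus (V := R_NormedModule) (f i)); auto.
    apply (RInt_correct (V := R_CompleteNormedModule)); auto.
Qed.

(* Dini's theorem: by compactness finitely many terms approximate [F] uniformly. *)
Lemma RInt_nnsum {I} (f : I -> R -> R) F x y : x <= y ->
  (forall i z, x <= z <= y -> continuous (f i) z) ->
  (forall z, x <= z <= y -> nnsum (fun i => f i z) (F z)) ->
  (forall z, x <= z <= y -> continuous F z) ->
  nnsum (fun i => RInt (f i) x y) (RInt F x y).
Proof.
  intros Hxy Hf HF HcF.
  assert (Hex : forall g : R -> R, (forall z, x <= z <= y -> continuous g z) -> ex_RInt g x y).
  { intros g Hg. apply (ex_RInt_continuous (V := R_CompleteNormedModule)).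
    rewrite Rmin_left, Rmax_right by lra; auto. }
  assert (Hl : forall l, RInt (fun z => lsum (fun i => f i z) l) x y = lsum (fun i => RInt (f i) x y) l).
  { intros l; apply is_RInt_unique, RInt_lsum; auto. }
  assert (Hxl : forall l, ex_RInt (fun z => lsum (fun i => f i z) l) x y).
  { intros l; eexists; apply RInt_lsum; auto. }
  apply nnsum_intro.
  - intros i; apply RInt_ge_0; auto. intros z Hz. apply (proj1 (HF z ltac:(lra))).
  - intros l Hnd. rewrite <- Hl. apply RInt_le; auto.
    intros z Hz. apply (nnsum_ge_lsum (fun i => f i z)); auto. apply HF; lra.
  - intros e He. set (d := e / (y - x + 1)).
    assert (Hd : 0 < d) by (apply Rdiv_lt_0_compat; lra).
    assert (Hloc : forall t, exists Ld : list I * posreal, NoDup (fst Ld) /\ (x <= t <= y ->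
       forall u, Rabs (u - t) < snd Ld -> F u - d <= lsum (fun i => f i u) (fst Ld))).
    { intros t. destruct (classic (x <= t <= y)) as [Ht|Ht];
        [|exists ([], mkposreal 1 Rlt_0_1); split; [constructor|tauto]].
      destruct (nnsum_approx _ _ d (HF t Ht) Hd) as [L [HL Hs]].
      assert (Hc : continuous (fun u => lsum (fun i => f i u) L - F u) t).
      { apply (continuous_minus (fun u => lsum (fun i => f i u) L) F); auto.
        apply continuous_lsum; auto. }
      assert (Ho : locally (lsum (fun i => f i t) L - F t) (fun v => - d < v)).
      { apply (open_gt (- d)). lra. }
      destruct (Hc _ Ho) as [del Hdel].
      exists (L, del); split; [exact HL|]; intros _ u Hu; simpl.
      specialize (Hdel u Hu). simpl in Hdel. lra. }
    set (Ld := fun t => proj1_sig (constructive_indefinite_description _ (Hloc t))).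
    assert (HLd : forall t, x <= t <= y ->
       forall u, Rabs (u - t) < snd (Ld t) -> F u - d <= lsum (fun i => f i u) (fst (Ld t))).
    { intros t; apply (proj2_sig (constructive_indefinite_description _ (Hloc t))). }
    assert (HLd0 : forall t, NoDup (fst (Ld t))).
    { intros t; apply (proj2_sig (constructive_indefinite_description _ (Hloc t))). }
    destruct (NNPP _ (compactness_list 1 (x, tt) (y, tt) (fun t => snd (Ld (fst t))))) as [l Hc].
    set (L := nodup eqc (flat_map (fun t : R * unit => fst (Ld (fst t))) l)).
    exists L; split; [apply NoDup_nodup|].
    assert (HL : forall u, x <= u <= y -> F u - d <= lsum (fun i => f i u) L).
    { intros u Hu. destruct (Hc (u, tt)) as [[t []] [Hin [[Ht _] [Hcl _]]]]; [simpl; auto|].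
      simpl in Hcl, Ht.
      apply Rle_trans with (lsum (fun i => f i u) (nodup eqc (fst (Ld t)))).
      - apply Rle_trans with (lsum (fun i => f i u) (fst (Ld t))).
        + apply HLd; auto.
        + apply lsum_incl; [apply HF; auto|apply HLd0|]. intros i Hi; apply nodup_In; auto.
      - apply lsum_incl; [apply HF; auto|apply NoDup_nodup|].
        intros i Hi. apply nodup_In in Hi. apply nodup_In, in_flat_map.
        exists (t, tt); auto. }
    rewrite <- Hl.
    apply Rle_trans with (RInt (fun u => F u - d) x y).
    + replace (RInt (fun u => F u - d) x y) with (RInt F x y - d * (y - x)).
      * assert (d * (y - x) <= e); [|lra].
        unfold d. replace (e / (y - x + 1) * (y - x)) with (e * ((y - x) / (y - x + 1))) by (field; lra).
        rewrite <- (Rmult_1_r e) at 2. apply Rmult_le_compat_l; [lra|].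
        apply (Rdiv_le_1 (y - x) (y - x + 1)); lra.
      * symmetry. apply is_RInt_unique.
        apply (is_RInt_minus (V := R_NormedModule) F (fun _ => d)).
        -- apply (RInt_correct (V := R_CompleteNormedModule)); auto.
        -- assert (H0 := is_RInt_const (V := R_NormedModule) x y d).
           unfold scal in H0; simpl in H0; unfold mult in H0; simpl in H0.
           rewrite Rmult_comm in H0; exact H0.
    + apply RInt_le; auto.
      * apply Hex; intros z Hz. apply (continuous_minus F (fun _ => d)); auto. apply continuous_const.
      * intros z Hz; apply HL; lra.
Qed.

(** Integrals of nonnegative functions grow with the interval, so finitely many approximating
    intervals may be replaced by one containing them all. *)
Lemma oint_cover {I} p q (f : I -> R -> R) (g : I -> R) e l : Rbar_lt p q -> 0 < e ->
  (forall i, nnint p q (f i) (g i)) ->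
  exists x y, oint p q x /\ oint p q y /\ x <= y /\ forall i, In i l -> g i - e <= RInt (f i) x y.
Proof.
  intros Hpq He Hg. induction l as [|i l [x [y [Hx [Hy [Hxy IH]]]]]].
  - destruct (oint_nonempty p q Hpq) as [x Hx]. exists x, x; repeat (split; auto); simpl; [lra|tauto].
  - destruct (nnint_approx p q (f i) (g i) e (Hg i) He) as [x' [y' [Hx' [Hy' [Hxy' Hs]]]]].
    assert (A1 := Rmin_l x x'). assert (A2 := Rmin_r x x').
    assert (A3 := Rmax_l y y'). assert (A4 := Rmax_r y y').
    assert (HX : oint p q (Rmin x x')) by (apply Rmin_case; auto).
    assert (HY : oint p q (Rmax y y')) by (apply Rmax_case; auto).
    exists (Rmin x x'), (Rmax y y'); repeat (split; auto); [lra|].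
    intros j [<-|Hj].
    + apply Rle_trans with (RInt (f i) x' y'); [lra|].
      apply (RInt_oint_sub p q); auto. apply Hg.
    + apply Rle_trans with (RInt (f j) x y); auto.
      apply (RInt_oint_sub p q); auto. apply Hg.
Qed.

Lemma lsum_const {I} (c : R) (l : list I) : lsum (fun _ => c) l = INR (length l) * c.
Proof.
  induction l as [|i l IH]; [simpl; ring|].
  change (length (i :: l)) with (S (length l)). rewrite S_INR; simpl; rewrite IH; ring.
Qed.

(** Both values are suprema, over lists and over intervals, and these commute: Dini's theorem
    handles each compact interval, and a common interval handles each finite list. *)
Lemma nnint_nnsum {I} p q (f : I -> R -> R) F g S : Rbar_lt p q ->
  (forall i, nnint p q (f i) (g i)) ->
  (forall z, oint p q z -> nnsum (fun i => f i z) (F z)) ->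
  (forall z, oint p q z -> continuous F z) ->
  (nnsum g S <-> nnint p q F S).
Proof.
  intros Hpq Hg HF HcF.
  assert (Hg0 : forall i, 0 <= g i).
  { intros i. destruct (oint_nonempty p q Hpq) as [x Hx].
    assert (H := nnint_ge p q _ _ x x (Hg i) Hx Hx (Rle_refl x)).
    rewrite RInt_point in H; exact H. }
  assert (HD : forall x y, oint p q x -> oint p q y -> x <= y ->
     nnsum (fun i => RInt (f i) x y) (RInt F x y)).
  { intros x y Hx Hy Hxy. apply RInt_nnsum; auto; intros; try (apply HF || apply HcF);
    try (apply (oint_between p q x y); auto).
    apply (nnint_cont p q (f i) (g i)); auto. apply (oint_between p q x y); auto. }
  assert (Hfin : forall T, (forall x y, oint p q x -> oint p q y -> x <= y -> RInt F x y <= T) ->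
     forall l, NoDup l -> lsum g l <= T).
  { intros T HT l Hl. apply le_epsilon; intros e He.
    set (d := e / (INR (length l) + 1)).
    assert (Hlen := pos_INR (length l)).
    assert (Hd : 0 < d) by (apply Rdiv_lt_0_compat; lra).
    destruct (oint_cover p q f g d l Hpq Hd Hg) as [x [y [Hx [Hy [Hxy Hi]]]]].
    assert (H1 : lsum (fun i => g i + - d) l <= lsum (fun i => RInt (f i) x y) l).
    { apply lsum_le; intros i Hin; specialize (Hi i Hin); lra. }
    rewrite lsum_plus, lsum_const in H1.
    assert (H2 := nnsum_ge_lsum _ _ _ (HD x y Hx Hy Hxy) Hl).
    assert (H3 := HT x y Hx Hy Hxy).
    assert (INR (length l) * d <= e).
    { unfold d. replace (INR (length l) * (e / (INR (length l) + 1)))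
        with (e * (INR (length l) / (INR (length l) + 1))) by (field; lra).
      rewrite <- (Rmult_1_r e) at 2. apply Rmult_le_compat_l; [lra|].
      apply (Rdiv_le_1 (INR (length l)) (INR (length l) + 1)); lra. }
    lra. }
  assert (HF0 : forall x, oint p q x -> 0 <= F x /\ continuous F x).
  { intros x Hx; split; auto. apply (nnsum_nonneg (fun i => f i x)); auto. }
  assert (Hle : forall T, nnsum g T -> forall x y, oint p q x -> oint p q y -> x <= y -> RInt F x y <= T).
  { intros T HT x y Hx Hy Hxy.
    apply (nnsum_le (fun i => RInt (f i) x y) g); auto.
    intros i. apply (nnint_ge p q (f i)); auto. }
  split; intros HS.
  - apply nnint_intro; auto.
    intros e He.
    apply NNPP; intros Hn.
    assert (S <= S - e); [|lra].
    apply (nnsum_le_bound g); auto. apply Hfin.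
    intros x y Hx Hy Hxy. apply Rnot_lt_le; intros Hlt. apply Hn; exists x, y; repeat (split; auto); lra.
  - assert (Hb : forall l, NoDup l -> lsum g l <= S).
    { apply Hfin. intros x y Hx Hy Hxy; apply (nnint_ge p q F); auto. }
    destruct (nnsum_ex g S Hg0 Hb) as [T [HT HTS]].
    replace S with T; auto. apply Rle_antisym; auto.
    apply (nnint_le_bound p q F); auto.
Qed.

Lemma nnint_antideriv p q (f G : R -> R) l :
  (forall x, oint p q x -> 0 <= f x /\ continuous f x) ->
  (forall x, oint p q x -> is_derive G x (f x)) ->
  (forall x y, oint p q x -> oint p q y -> x <= y -> G y - G x <= l) ->
  (forall e, 0 < e -> exists x y, oint p q x /\ oint p q y /\ x <= y /\ l - e <= G y - G x) ->
  nnint p q f l.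
Proof.
  intros Hf HG H1 H2.
  assert (E : forall x y, oint p q x -> oint p q y -> x <= y -> RInt f x y = G y - G x).
  { intros x y Hx Hy Hxy. apply is_RInt_unique, (is_RInt_derive (V := R_CompleteNormedModule) G f).
    - intros z Hz; rewrite Rmin_left, Rmax_right in Hz by lra.
      apply HG, (oint_between p q x y); auto.
    - intros z Hz; rewrite Rmin_left, Rmax_right in Hz by lra.
      apply Hf, (oint_between p q x y); auto. }
  apply nnint_intro; auto.
  - intros x y Hx Hy Hxy; rewrite E; auto.
  - intros e He. destruct (H2 e He) as [x [y [Hx [Hy [Hxy H]]]]].
    exists x, y; repeat (split; auto). rewrite E; auto.
Qed.

(** The sign [s] is [1] for an increasing and [-1] for a decreasing substitution, so [s * dg] is the
    absolute Jacobian. Since [g] is monotone and onto, both suprema run over the same set of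
    values. *)
Lemma nnint_subst (s : R) p q p' q' f (g dg : R -> R) l : s * s = 1 ->
  (forall x, oint p q x -> is_derive g x (dg x) /\ continuous dg x) ->
  (forall x, oint p q x -> 0 <= s * dg x) ->
  (forall x, oint p q x -> oint p' q' (g x)) ->
  (forall y, oint p' q' y -> exists x, oint p q x /\ g x = y) ->
  (forall y, oint p' q' y -> 0 <= f y /\ continuous f y) ->
  (nnint p' q' f l <-> nnint p q (fun x => f (g x) * (s * dg x)) l).
Proof.
  intros Hs Hd Hm Hr Hsur Hf.
  set (k := fun x => f (g x) * (s * dg x)).
  assert (Hcg : forall x, oint p q x -> continuous g x).
  { intros x Hx. apply (ex_derive_continuous (V := R_NormedModule)). exists (dg x); apply Hd; auto. }
  assert (Hk : forall x, oint p q x -> 0 <= k x /\ continuous k x).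
  { intros x Hx; split.
    - apply Rmult_le_pos; auto. apply Hf; auto.
    - apply (continuous_mult (fun x => f (g x)) (fun x => s * dg x)).
      + apply continuous_comp; auto. apply Hf; auto.
      + apply (continuous_scal_r s dg x). apply Hd; auto. }
  assert (E : forall x y, oint p q x -> oint p q y -> x <= y -> RInt k x y = s * RInt f (g x) (g y)).
  { intros x y Hx Hy Hxy.
    rewrite <- (RInt_comp f g dg).
    - transitivity (RInt (fun z => s * scal (dg z) (f (g z))) x y).
      + apply RInt_ext; intros z _. unfold k, scal; simpl; unfold mult; simpl; ring.
      + apply (RInt_scal (V := R_CompleteNormedModule) (fun z => scal (dg z) (f (g z))) x y s).
        apply (oint_RInt_ex p q); auto. intros z Hz.
        apply (continuous_mult dg (fun z => f (g z))); [apply Hd; auto|].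
        apply continuous_comp; auto. apply Hf; auto.
    - intros z Hz; rewrite Rmin_left, Rmax_right in Hz by lra.
      apply Hf, Hr, (oint_between p q x y); auto.
    - intros z Hz; rewrite Rmin_left, Rmax_right in Hz by lra.
      apply Hd, (oint_between p q x y); auto. }
  assert (Hmon : forall x y, oint p q x -> oint p q y -> x <= y -> 0 <= s * (g y - g x)).
  { intros x y Hx Hy Hxy.
    destruct (MVT_gen g x y dg) as [c [Hc E']].
    - intros z Hz; rewrite Rmin_left, Rmax_right in Hz by lra.
      apply Hd, (oint_between p q x y); auto; lra.
    - intros z Hz; rewrite Rmin_left, Rmax_right in Hz by lra.
      apply continuity_pt_filterlim, Hcg, (oint_between p q x y); auto.
    - rewrite Rmin_left, Rmax_right in Hc by lra.
      rewrite E'. assert (H := Hm c (oint_between p q x y c Hx Hy Hc)). nra. }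
  assert (Hs' : s = 1 \/ s = -1).
  { assert ((s - 1) * (s + 1) = 0) by nra.
    apply Rmult_integral in H; destruct H; [left|right]; lra. }
  assert (Hset : forall r,
     (exists u v, oint p' q' u /\ oint p' q' v /\ u <= v /\ r = RInt f u v) <->
     (exists x y, oint p q x /\ oint p q y /\ x <= y /\ r = RInt k x y)).
  { intros r; split.
    - intros [u [v [Hu [Hv [Huv ->]]]]].
      destruct (Hsur u Hu) as [x [Hx <-]]. destruct (Hsur v Hv) as [y [Hy <-]].
      destruct (Req_dec (g x) (g y)) as [Hxy|Hxy].
      + exists x, x; repeat (split; auto); [lra|]. rewrite <- Hxy, !RInt_point; auto.
      + destruct Hs' as [->| ->].
        * assert (x <= y).
          { apply Rnot_lt_le; intros Hlt. assert (H := Hmon y x Hy Hx ltac:(lra)). lra. }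
          exists x, y; repeat (split; auto). rewrite E; auto; symmetry; apply Rmult_1_l.
        * assert (y <= x).
          { apply Rnot_lt_le; intros Hlt. assert (H := Hmon x y Hx Hy ltac:(lra)). lra. }
          exists y, x; repeat (split; auto). rewrite E; auto.
          rewrite <- (opp_RInt_swap f (g x) (g y)).
          -- change (RInt f (g x) (g y) = -1 * - RInt f (g x) (g y)); lra.
          -- apply (oint_RInt_ex p' q'); auto; intros; apply Hf; auto.
    - intros [x [y [Hx [Hy [Hxy ->]]]]].
      assert (H := Hmon x y Hx Hy Hxy).
      destruct Hs' as [Es|Es]; rewrite Es in H.
      + exists (g x), (g y); repeat (split; auto); [lra|]. rewrite E, Es; auto; apply Rmult_1_l.
      + exists (g y), (g x); repeat (split; auto); [lra|]. rewrite E, Es; auto.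
        rewrite <- (opp_RInt_swap f (g y) (g x)).
        * change (-1 * - RInt f (g y) (g x) = RInt f (g y) (g x)); lra.
        * apply (oint_RInt_ex p' q'); auto; intros; apply Hf; auto. }
  assert (Hlub : forall (P Q : R -> Prop), (forall r, P r <-> Q r) -> is_lub P l -> is_lub Q l).
  { intros P Q HPQ [A B]; split.
    - intros r Hr'; apply A, HPQ; auto.
    - intros M HM; apply B; intros r Hr'; apply HM, HPQ; auto. }
  split; intros [_ H]; (split; [assumption|]); revert H; apply Hlub; intros r; auto; symmetry; auto.
Qed.

Lemma nnsum_sub_ex {I J} (h : J -> I) (f : I -> R) S :
  (forall x y, h x = h y -> x = y) -> nnsum f S -> exists T, nnsum (fun j => f (h j)) T.
Proof.
  intros Hh H. destruct (nnsum_ex (fun j => f (h j)) S) as [T [HT _]]; eauto.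
  - intros; apply H.
  - intros l Hl; rewrite <- lsum_map. apply nnsum_ge_lsum; auto. apply NoDup_map_inj; auto.
Qed.

(** * Hyperbolic sums *)

Lemma pow_exp x n : exp x ^ n = exp (INR n * x).
Proof.
  induction n as [|n IH]; [simpl; rewrite Rmult_0_l, exp_0; auto|].
  rewrite S_INR; simpl; rewrite IH, <- exp_plus; f_equal; ring.
Qed.

Lemma exp_mono x y : x <= y -> exp x <= exp y.
Proof. intros [H| ->]; [apply Rlt_le, exp_increasing|]; auto; lra. Qed.

Definition sech (x : R) : R := / cosh x.

Lemma cosh_pos x : 0 < cosh x.
Proof. unfold cosh. assert (A := exp_pos x). assert (B := exp_pos (- x)). lra. Qed.

Lemma cosh_ge_1 x : 1 <= cosh x.
Proof.
  unfold cosh. assert (A := exp_pos x). rewrite exp_Ropp.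
  assert (H : 0 <= (exp x - 1) ^ 2 / exp x).
  { apply Rdiv_le_0_compat; auto. apply pow2_ge_0. }
  replace ((exp x - 1) ^ 2 / exp x) with (exp x + / exp x - 2) in H by (field; lra). lra.
Qed.

Lemma cosh_even x : cosh (- x) = cosh x.
Proof. unfold cosh; rewrite Ropp_involutive; lra. Qed.

Lemma sinh_odd x : sinh (- x) = - sinh x.
Proof. unfold sinh; rewrite Ropp_involutive; lra. Qed.

Lemma sinh_pos x : 0 < x -> 0 < sinh x.
Proof. intros H. rewrite <- sinh_0; apply sinh_lt; auto. Qed.

Lemma sinh_neq_0 x : x <> 0 -> sinh x <> 0.
Proof.
  intros H. destruct (Rlt_dec 0 x) as [Hx|Hx].
  - assert (A := sinh_pos x Hx). lra.
  - assert (A := sinh_pos (- x) ltac:(lra)). rewrite sinh_odd in A; lra.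
Qed.

Lemma sech_pos x : 0 < sech x.
Proof. apply Rinv_0_lt_compat, cosh_pos. Qed.

Lemma sech_le_1 x : sech x <= 1.
Proof. unfold sech. rewrite <- Rinv_1. apply Rinv_le_contravar; [lra|apply cosh_ge_1]. Qed.

Lemma sech_even x : sech (- x) = sech x.
Proof. unfold sech; rewrite cosh_even; auto. Qed.

Lemma sech_le_exp x : sech x <= 2 * exp (- Rabs x).
Proof.
  assert (H : forall y, sech y <= 2 * exp (- y)).
  { intros y. unfold sech, cosh. rewrite !exp_Ropp. assert (A := exp_pos y).
    rewrite <- (Rinv_inv (2 * / exp y)). apply Rinv_le_contravar.
    - apply Rinv_0_lt_compat, Rmult_lt_0_compat; [lra|apply Rinv_0_lt_compat; auto].
    - assert (B := Rinv_0_lt_compat _ A).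
      replace (/ (2 * / exp y)) with (exp y / 2) by (field; lra). lra. }
  unfold Rabs; destruct (Rcase_abs x); auto. rewrite <- sech_even; auto.
Qed.

(** On either half of the integers [2 k + e] has absolute value at least [n], the position of [k] in
    that half, so a geometric series dominates. *)
Lemma nnsum_exp_decay (phi : Z -> R) (e : Z) C v : (0 <= e <= 1)%Z -> 0 < v ->
  (forall i, 0 <= phi i <= C * exp (- (Rabs (IZR i) * v))) ->
  exists S, nnsum (fun k => phi (2 * k + e)%Z) S.
Proof.
  intros He Hv H.
  set (y := exp (- v)).
  assert (Hy : 0 <= y < 1).
  { unfold y; split; [apply Rlt_le, exp_pos|]. rewrite <- exp_0; apply exp_increasing; lra. }
  assert (HC : 0 <= C).
  { specialize (H 0%Z). rewrite Rabs_R0, Rmult_0_l, Ropp_0, exp_0 in H. lra. }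
  assert (Hb : forall i n, (Z.of_nat n <= Z.abs i)%Z -> 0 <= phi i <= C * y ^ n).
  { intros i n Hi. specialize (H i). split; [tauto|].
    apply Rle_trans with (1 := proj2 H). apply Rmult_le_compat_l; auto.
    unfold y. rewrite pow_exp. apply exp_mono.
    rewrite <- abs_IZR. apply IZR_le in Hi. rewrite <- INR_IZR_INZ in Hi. nra. }
  assert (HG := nnsum_scal C _ _ HC (nnsum_geom y Hy)).
  destruct (nnsum_le_ex (fun n => phi (2 * Z.of_nat n + e)%Z) _ _
    (fun n => Hb (2 * Z.of_nat n + e)%Z n ltac:(lia)) HG) as [S [HS _]].
  destruct (nnsum_le_ex (fun n => phi (2 * (- Z.of_nat (Datatypes.S n)) + e)%Z) _ _
    (fun n => Hb (2 * (- Z.of_nat (Datatypes.S n)) + e)%Z n ltac:(lia)) HG) as [T [HT _]].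
  exists (S + T). apply (nnsum_Z (fun k => phi (2 * k + e)%Z)); auto.
Qed.

Section HyperbolicSums.
Variable w : R.
Hypothesis Hw : 0 < w.

Let s (i : Z) : R := sech (IZR i * w).
Let tau (i : Z) : R := tanh (IZR i * w).

Lemma tau_opp i : tau (- i) = - tau i.
Proof.
  unfold tau, tanh; rewrite opp_IZR, <- Ropp_mult_distr_l, sinh_odd, cosh_even.
  unfold Rdiv; ring.
Qed.

Lemma tanh_sub x y : tanh x - tanh y = sinh (x - y) * (sech x * sech y).
Proof.
  unfold tanh, sech.
  assert (E : sinh (x - y) = sinh x * cosh y - cosh x * sinh y).
  { unfold sinh, cosh, Rminus. rewrite !Ropp_plus_distr, !exp_plus, !Ropp_involutive. field. }
  rewrite E. field. split; apply Rgt_not_eq, cosh_pos.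
Qed.

Lemma tau_step i : 0 <= tau (i + 1) - tau i.
Proof.
  unfold tau. rewrite tanh_sub. apply Rmult_le_pos.
  - apply Rlt_le, sinh_pos. rewrite plus_IZR. lra.
  - apply Rmult_le_pos; apply Rlt_le, sech_pos.
Qed.

Lemma tanh_lim_1 : is_lim_seq (fun n => tau (Z.of_nat n)) 1.
Proof.
  assert (E : forall n, tau (Z.of_nat n) = 1 - 2 * (exp (- 2 * w)) ^ n / (1 + (exp (- 2 * w)) ^ n)).
  { intros n. unfold tau, tanh, sinh, cosh. rewrite <- INR_IZR_INZ, pow_exp.
    replace (INR n * (-2 * w)) with (- (INR n * w) + - (INR n * w)) by ring.
    rewrite exp_plus, exp_Ropp. assert (A := exp_pos (INR n * w)).
    field. repeat split; try lra; try nra. }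
  apply (is_lim_seq_ext (fun n => 1 - 2 * (exp (- 2 * w)) ^ n / (1 + (exp (- 2 * w)) ^ n))); [intros; rewrite E; auto|].
  assert (Hg : is_lim_seq (fun n => (exp (- 2 * w)) ^ n) 0).
  { apply is_lim_seq_geom. rewrite Rabs_pos_eq by apply Rlt_le, exp_pos.
    rewrite <- exp_0; apply exp_increasing; lra. }
  replace (Finite 1) with (Finite (1 - 2 * 0 / (1 + 0))) by (f_equal; field).
  apply is_lim_seq_minus'; [apply is_lim_seq_const|].
  apply is_lim_seq_div'; try lra.
  - apply is_lim_seq_mult'; auto. apply is_lim_seq_const.
  - apply is_lim_seq_plus'; auto. apply is_lim_seq_const.
Qed.

Lemma tau_half_sum : nnsum (fun n => tau (Z.of_nat n + 1) - tau (Z.of_nat n)) 1.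
Proof.
  apply is_series_nnsum; [intros; apply tau_step|].
  change (is_lim_seq (sum_n (fun n => tau (Z.of_nat n + 1) - tau (Z.of_nat n))) 1).
  apply (is_lim_seq_ext (fun n => tau (Z.of_nat (S n)))).
  - induction n as [|n IH].
    + rewrite sum_O. unfold tau at 3, tanh. simpl IZR. rewrite Rmult_0_l, sinh_0.
      unfold Rdiv; rewrite Rmult_0_l, Rminus_0_r. reflexivity.
    + rewrite sum_Sn, <- IH.
      replace (Z.of_nat (S n) + 1)%Z with (Z.of_nat (S (S n))) by lia.
      change (tau (Z.of_nat (S (S n))) =
        tau (Z.of_nat (S n)) + (tau (Z.of_nat (S (S n))) - tau (Z.of_nat (S n)))). ring.
  - apply (is_lim_seq_incr_1 (fun n => tau (Z.of_nat n))), tanh_lim_1.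
Qed.

Lemma tau_total_sum : nnsum (fun n => tau (n + 1) - tau n) 2.
Proof.
  replace 2 with (1 + 1) by ring. apply nnsum_Z; [apply tau_half_sum|].
  apply (nnsum_ext (fun n => tau (Z.of_nat n + 1) - tau (Z.of_nat n))); [|apply tau_half_sum].
  intros n. replace (- Z.of_nat (S n) + 1)%Z with (- Z.of_nat n)%Z by lia.
  replace (Z.of_nat n + 1)%Z with (Z.of_nat (S n)) by lia.
  rewrite !tau_opp; ring.
Qed.

(* Reflection exchanges the steps at even and at odd places, so each class carries half of the total jump [2]. *)
Lemma tau_parity_sum e : nnsum (fun k => tau (2 * k + e + 1) - tau (2 * k + e)) 1.
Proof.
  assert (HT := tau_total_sum).
  destruct (fun H => nnsum_sub_ex (fun k => 2 * k)%Z _ 2 H HT) as [E HE];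
    [intros x y; cbv beta; lia|].
  assert (HO : nnsum (fun k => tau (2 * k + 1 + 1) - tau (2 * k + 1)) E).
  { apply (nnsum_refl _ (-1)) in HE. revert HE; apply nnsum_ext; intros k.
    replace (2 * (-1 - k) + 1)%Z with (- (2 * k + 1))%Z by lia.
    replace (2 * (-1 - k))%Z with (- (2 * k + 1 + 1))%Z by lia.
    rewrite !tau_opp; ring. }
  assert (HE2 := Z_even_odd_nnsum (fun n => tau (n + 1) - tau n) E E HE HO).
  assert (E = 1) by (assert (H := nnsum_unique _ _ _ HT HE2); lra). subst E.
  assert (Hd := Z.div_mod e 2 ltac:(lia)). assert (Hm := Z.mod_pos_bound e 2 ltac:(lia)).
  assert (He : e = (2 * (e / 2))%Z \/ e = (2 * (e / 2) + 1)%Z) by lia.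
  destruct He as [He|He].
  - apply (nnsum_shift _ (e / 2)) in HE. revert HE; apply nnsum_ext; intros k.
    replace (2 * (k + e / 2))%Z with (2 * k + e)%Z by lia. ring.
  - apply (nnsum_shift _ (e / 2)) in HO. revert HO; apply nnsum_ext; intros k.
    replace (2 * (k + e / 2) + 1)%Z with (2 * k + e)%Z by lia. ring.
Qed.

(** A gap of length [d] is a stack of [d] unit gaps, and each of these, summed over [k], contributes
    1 by [tau_parity_sum], whatever its parity. *)
Lemma tau_gap_sum (d : nat) e :
  nnsum (fun k => tau (2 * k + e) - tau (2 * k + e - Z.of_nat d)) (INR d).
Proof.
  induction d as [|d IH].
  - apply (nnsum_ext (fun _ => 0)); [|apply nnsum_zero].
    intros k. rewrite Z.sub_0_r; ring.
  - rewrite S_INR.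
    apply (nnsum_ext (fun k => (tau (2 * k + e) - tau (2 * k + e - Z.of_nat d))
      + (tau (2 * k + (e - Z.of_nat (S d)) + 1) - tau (2 * k + (e - Z.of_nat (S d)))))).
    + intros k. replace (2 * k + (e - Z.of_nat (S d)) + 1)%Z with (2 * k + e - Z.of_nat d)%Z by lia.
      replace (2 * k + (e - Z.of_nat (S d)))%Z with (2 * k + e - Z.of_nat (S d))%Z by lia. ring.
    + apply nnsum_plus; auto. apply tau_parity_sum.
Qed.

Lemma sech_gap_sum e d : d <> 0%Z ->
  nnsum (fun k => s (2 * k + e) * s (2 * k + e - d)) (IZR d / sinh (IZR d * w)).
Proof.
  assert (Hp : forall e n, nnsum (fun k => s (2 * k + e) * s (2 * k + e - Z.of_nat (S n)))
     (IZR (Z.of_nat (S n)) / sinh (IZR (Z.of_nat (S n)) * w))).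
  { intros e' n. set (x := IZR (Z.of_nat (S n)) * w).
    assert (Hx : 0 < x) by (apply Rmult_lt_0_compat; auto; apply IZR_lt; lia).
    assert (Hsx := sinh_pos x Hx).
    apply (nnsum_ext (fun k => / sinh x * (tau (2 * k + e') - tau (2 * k + e' - Z.of_nat (S n))))).
    - intros k. unfold tau. rewrite tanh_sub.
      replace (IZR (2 * k + e') * w - IZR (2 * k + e' - Z.of_nat (S n)) * w) with x
        by (unfold x; rewrite minus_IZR; ring).
      unfold s. field; lra.
    - replace (IZR (Z.of_nat (S n)) / sinh x) with (/ sinh x * INR (S n)).
      + apply nnsum_scal; [apply Rlt_le, Rinv_0_lt_compat; auto|apply tau_gap_sum].
      + rewrite <- INR_IZR_INZ; field; lra. }
  intros Hd. destruct (Z_lt_le_dec 0 d) as [H|H].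
  - replace d with (Z.of_nat (S (Z.to_nat (d - 1)))) by lia. apply Hp.
  (* For negative [d] the two factors are exchanged by starting from [e - d]; the value is even in
     [d]. *)
  - specialize (Hp (e - d)%Z (Z.to_nat (- d - 1))).
    replace (Z.of_nat (S (Z.to_nat (- d - 1)))) with (- d)%Z in Hp by lia.
    rewrite opp_IZR, <- Ropp_mult_distr_l, sinh_odd in Hp.
    replace (IZR d / sinh (IZR d * w)) with (- IZR d / - sinh (IZR d * w)).
    + revert Hp; apply nnsum_ext; intros k.
      replace (2 * k + (e - d) - - d)%Z with (2 * k + e)%Z by lia.
      replace (2 * k + (e - d))%Z with (2 * k + e - d)%Z by lia. ring.
    + field. apply sinh_neq_0. apply Rmult_integral_contrapositive_currified; [|lra].
      apply not_0_IZR; auto.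
Qed.

End HyperbolicSums.

(** The parity class is a parameter because the product sums mix the classes. The values are
    identified later: [sech_sum 0] is [alpha] and [sech_sum 1] is [beta]. *)
Definition sech_sum (e : Z) (w : R) : R := tsum (fun k => sech (IZR (2 * k + e) * w)).
Definition sech_sum2 (e : Z) (w : R) : R := tsum (fun k => sech (IZR (2 * k + e) * w) ^ 2).
Definition sech_mom (e : Z) (w : R) : R :=
  tsum (fun k => IZR (2 * k + e) ^ 2 * sech (IZR (2 * k + e) * w)).

Lemma exp_ge_sq x : 0 <= x -> x ^ 2 / 2 <= exp x.
Proof.
  intros Hx. assert (H := exp_ge_taylor x 2 Hx). simpl in H. simpl. lra.
Qed.

Section Parity.
Variables (w : R) (e : Z).
Hypothesis Hw : 0 < w.
Hypothesis He : (0 <= e <= 1)%Z.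

Lemma sech_sum_correct : nnsum (fun k => sech (IZR (2 * k + e) * w)) (sech_sum e w).
Proof.
  apply tsum_correct, (nnsum_exp_decay (fun i => sech (IZR i * w)) e 2 w); auto.
  intros i; split; [apply Rlt_le, sech_pos|].
  eapply Rle_trans; [apply sech_le_exp|]. rewrite Rabs_mult, (Rabs_pos_eq w) by lra; lra.
Qed.

Lemma sech_sum2_correct : nnsum (fun k => sech (IZR (2 * k + e) * w) ^ 2) (sech_sum2 e w).
Proof.
  apply tsum_correct.
  destruct (fun H => nnsum_le_ex (fun k => sech (IZR (2 * k + e) * w) ^ 2) _ _ H sech_sum_correct)
    as [S [HS _]]; eauto.
  intros k. assert (A := sech_pos (IZR (2 * k + e) * w)). assert (B := sech_le_1 (IZR (2 * k + e) * w)).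
  split; [apply pow2_ge_0|]. nra.
Qed.

Lemma sech_mom_correct : nnsum (fun k => IZR (2 * k + e) ^ 2 * sech (IZR (2 * k + e) * w)) (sech_mom e w).
Proof.
  apply tsum_correct, (nnsum_exp_decay (fun i => IZR i ^ 2 * sech (IZR i * w)) e (16 / w ^ 2) (w / 2)); auto; [lra|].
  intros i; split; [apply Rmult_le_pos; [apply pow2_ge_0|apply Rlt_le, sech_pos]|].
  assert (A := sech_le_exp (IZR i * w)). rewrite Rabs_mult, (Rabs_pos_eq w) in A by lra.
  set (x := Rabs (IZR i) * w) in *.
  (* Half of the exponential decay absorbs the square: [x^2 <= 8 exp (x / 2)]. *)
  assert (B := exp_ge_sq (x / 2)).
  assert (Hx : 0 <= x) by (apply Rmult_le_pos; [apply Rabs_pos|lra]).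
  specialize (B ltac:(lra)).
  assert (E : IZR i ^ 2 = x ^ 2 / w ^ 2).
  { unfold x. rewrite Rpow_mult_distr, pow2_abs. field; lra. }
  rewrite E. replace (Rabs (IZR i) * (w / 2)) with (x / 2) by (unfold x; field).
  apply Rle_trans with (8 * exp (x / 2) / w ^ 2 * (2 * exp (- x))).
  - apply Rmult_le_compat; auto.
    + apply Rdiv_le_0_compat; [apply pow2_ge_0|nra].
    + apply Rlt_le, sech_pos.
    + apply Rmult_le_compat_r; [apply Rlt_le, Rinv_0_lt_compat; nra|]. lra.
  - right. replace (exp (- (x / 2))) with (exp (x / 2) * exp (- x)).
    + field; lra.
    + rewrite <- exp_plus; f_equal; field.
Qed.

End Parity.

(** The value of the sum along a line of constant difference [d]. The telescoped formula would read
    [0 / 0 = 0] at [d = 0], where the line carries the sum of squares instead. *)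
Definition gap_sum (w : R) (e d : Z) : R :=
  if Z.eqb d 0 then sech_sum2 e w else IZR d / sinh (IZR d * w).

(* Sum over pairs with a fixed difference first; [sech x sech y] telescopes along each such line. *)
Lemma sech_conv w e e' (G : Z -> R) S : 0 < w -> (0 <= e <= 1)%Z -> (forall d, 0 <= G d) ->
  nnsum (fun p : Z * Z => G (2 * fst p + e - (2 * snd p + e'))%Z *
     (sech (IZR (2 * fst p + e) * w) * sech (IZR (2 * snd p + e') * w))) S ->
  nnsum (fun m => G (2 * m + e - e')%Z * gap_sum w e (2 * m + e - e')) S.
Proof.
  intros Hw He HG H.
  apply (nnsum_bij (fun p : Z * Z => (snd p, snd p - fst p)%Z)
                   (fun p => (fst p - snd p, fst p)%Z)) in H.
  - apply (nnsum_fubini (fun m k => G (2 * m + e - e')%Z *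
     (sech (IZR (2 * k + e) * w) * sech (IZR (2 * k + e - (2 * m + e - e')) * w)))).
    + intros m. apply nnsum_scal; auto. unfold gap_sum.
      destruct (Z.eqb_spec (2 * m + e - e') 0) as [E|E].
      * apply (nnsum_ext (fun k => sech (IZR (2 * k + e) * w) ^ 2)); [|apply sech_sum2_correct; auto].
        intros k; rewrite E, Z.sub_0_r; ring.
      * apply sech_gap_sum; auto.
    + revert H; apply nnsum_ext; intros [m k]; simpl fst; simpl snd.
      replace (2 * k + e - (2 * (k - m) + e'))%Z with (2 * m + e - e')%Z by lia.
      replace (2 * (k - m) + e')%Z with (2 * k + e - (2 * m + e - e'))%Z by lia. auto.
  - intros [m k]; simpl; f_equal; lia.
  - intros [m k]; simpl; f_equal; lia.
Qed.

Section Convolutions.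
Variable w : R.
Hypothesis Hw : 0 < w.

Lemma sech_sum_prod e e' : (0 <= e <= 1)%Z -> (0 <= e' <= 1)%Z ->
  nnsum (fun m => gap_sum w e (2 * m + e - e')) (sech_sum e w * sech_sum e' w).
Proof.
  intros He He'.
  apply (nnsum_ext (fun m => 1 * gap_sum w e (2 * m + e - e'))); [intros; ring|].
  apply (sech_conv w e e' (fun _ => 1)); auto; [intros; lra|].
  apply (nnsum_ext (fun p : Z * Z => sech (IZR (2 * fst p + e) * w) * sech (IZR (2 * snd p + e') * w)));
    [intros; ring|].
  apply (nnsum_prod (fun k => sech (IZR (2 * k + e) * w)) (fun k => sech (IZR (2 * k + e') * w)));
  apply sech_sum_correct; auto.
Qed.

(* [(i - j)^2 + (i + j)^2 = 2 i^2 + 2 j^2], and the two squares on the left have the same sum. *)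
Lemma sech_mom_prod e e' : (0 <= e <= 1)%Z -> (0 <= e' <= 1)%Z ->
  nnsum (fun m => IZR (2 * m + e - e') ^ 2 * gap_sum w e (2 * m + e - e'))
    (sech_mom e w * sech_sum e' w + sech_sum e w * sech_mom e' w).
Proof.
  intros He He'.
  apply (sech_conv w e e' (fun d => IZR d ^ 2)); auto; [intros; apply pow2_ge_0|].
  set (s := fun (i : Z) => sech (IZR i * w)).
  assert (Hs : forall i, 0 < s i) by (intros; apply sech_pos).
  set (Q := fun p : Z * Z => IZR (2 * fst p + e - (2 * snd p + e')) ^ 2 *
     (s (2 * fst p + e)%Z * s (2 * snd p + e')%Z)).
  set (Q' := fun p : Z * Z => IZR (2 * fst p + e + (2 * snd p + e')) ^ 2 *
     (s (2 * fst p + e)%Z * s (2 * snd p + e')%Z)).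
  change (nnsum Q (sech_mom e w * sech_sum e' w + sech_sum e w * sech_mom e' w)).
  assert (HQ0 : forall p, 0 <= Q p).
  { intros p; apply Rmult_le_pos; [apply pow2_ge_0|apply Rmult_le_pos; apply Rlt_le, Hs]. }
  assert (HQ0' : forall p, 0 <= Q' p).
  { intros p; apply Rmult_le_pos; [apply pow2_ge_0|apply Rmult_le_pos; apply Rlt_le, Hs]. }
  assert (H : nnsum (fun p => Q p + Q' p) (2 * (sech_mom e w * sech_sum e' w + sech_sum e w * sech_mom e' w))).
  { apply (nnsum_ext (fun p : Z * Z => 2 * (
       (IZR (2 * fst p + e) ^ 2 * s (2 * fst p + e)%Z) * s (2 * snd p + e')%Z
       + s (2 * fst p + e)%Z * (IZR (2 * snd p + e') ^ 2 * s (2 * snd p + e')%Z)))).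
    { intros p; unfold Q, Q'. rewrite minus_IZR, plus_IZR.
      rewrite (plus_IZR _ (2 * snd p + e')). rewrite (plus_IZR (2 * fst p)). rewrite (plus_IZR (2 * snd p)). ring. }
    apply nnsum_scal; [lra|]. apply nnsum_plus.
    - apply (nnsum_prod (fun k => IZR (2 * k + e) ^ 2 * s (2 * k + e)%Z) (fun k => s (2 * k + e')%Z)).
      + apply sech_mom_correct; auto.
      + apply sech_sum_correct; auto.
    - apply (nnsum_prod (fun k => s (2 * k + e)%Z) (fun k => IZR (2 * k + e') ^ 2 * s (2 * k + e')%Z)).
      + apply sech_sum_correct; auto.
      + apply sech_mom_correct; auto. }
  destruct (fun H' => nnsum_le_ex Q (fun p => Q p + Q' p) _ H' H) as [S [HS _]].
  { intros p; split; auto. specialize (HQ0' p); lra. }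
  assert (HS' : nnsum Q' S).
  { apply (nnsum_bij (fun p : Z * Z => (fst p, - snd p - e')%Z)
                   (fun p => (fst p, - snd p - e')%Z)) in HS.
    - revert HS; apply nnsum_ext; intros [k l]; unfold Q, Q'; simpl fst; simpl snd.
      replace (2 * k + e - (2 * (- l - e') + e'))%Z with (2 * k + e + (2 * l + e'))%Z by lia.
      replace (2 * (- l - e') + e')%Z with (- (2 * l + e'))%Z by lia.
      unfold s at 2. rewrite opp_IZR, <- Ropp_mult_distr_l, sech_even. reflexivity.
    - intros [k l]; simpl; f_equal; lia.
    - intros [k l]; simpl; f_equal; lia. }
  assert (E := nnsum_unique _ _ _ H (nnsum_plus _ _ _ _ HS HS')).
  replace (sech_mom e w * sech_sum e' w + sech_sum e w * sech_mom e' w) with S by lra. auto.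
Qed.

End Convolutions.

(** The last argument of [nnsum] is left open: these are predicates on the value, so that
    convergence travels with it. *)
Definition Xodd w := nnsum (fun m => IZR (2 * m + 1) / sinh (IZR (2 * m + 1) * w)).
Definition Vodd w := nnsum (fun m => IZR (2 * m + 1) ^ 3 / sinh (IZR (2 * m + 1) * w)).
(* The term [m = 0] is [0 / sinh 0 = 0]. *)
Definition Xev w := nnsum (fun m => IZR (2 * m) / sinh (IZR (2 * m) * w)).
Definition Vev w := nnsum (fun m => IZR (2 * m) ^ 3 / sinh (IZR (2 * m) * w)).

Lemma Xodd_eq w : 0 < w -> Xodd w (sech_sum 1 w * sech_sum 0 w).
Proof.
  intros Hw. assert (H := sech_sum_prod w Hw 1 0 ltac:(lia) ltac:(lia)).
  revert H; apply nnsum_ext; intros m. unfold gap_sum.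
  rewrite Z.sub_0_r. destruct (Z.eqb_spec (2 * m + 1) 0); [lia|auto].
Qed.

Lemma Vodd_eq w : 0 < w -> Vodd w (sech_mom 1 w * sech_sum 0 w + sech_sum 1 w * sech_mom 0 w).
Proof.
  intros Hw. assert (H := sech_mom_prod w Hw 1 0 ltac:(lia) ltac:(lia)).
  revert H; apply nnsum_ext; intros m. unfold gap_sum.
  rewrite Z.sub_0_r. destruct (Z.eqb_spec (2 * m + 1) 0); [lia|].
  unfold Rdiv; ring.
Qed.

(** Even differences occur within either parity class, so [e = 0] and [e = 1] evaluate the same sum;
    equating them yields [sech_mom_even_odd]. The diagonal drops out because its weight is 0. *)
Lemma Vev_eq w e : 0 < w -> (0 <= e <= 1)%Z -> Vev w (2 * (sech_sum e w * sech_mom e w)).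
Proof.
  intros Hw He. assert (H := sech_mom_prod w Hw e e He He).
  replace (2 * (sech_sum e w * sech_mom e w)) with (sech_mom e w * sech_sum e w + sech_sum e w * sech_mom e w) by ring.
  revert H; apply nnsum_ext; intros m. unfold gap_sum.
  replace (2 * m + e - e)%Z with (2 * m)%Z by lia.
  destruct (Z.eqb_spec (2 * m) 0) as [->|].
  - simpl; unfold Rdiv; ring.
  - unfold Rdiv; ring.
Qed.

(** As for [Vev], except that without a weight the diagonal contributes [sech_sum2], which has to be
    removed. *)
Lemma Xev_eq w e : 0 < w -> (0 <= e <= 1)%Z -> Xev w (sech_sum e w ^ 2 - sech_sum2 e w).
Proof.
  intros Hw He. assert (H := sech_sum_prod w Hw e e He He).
  replace (sech_sum e w ^ 2 - sech_sum2 e w) with (sech_sum e w * sech_sum e w - sech_sum2 e w) by ring.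
  replace (sech_sum e w * sech_sum e w) with (gap_sum w e (2 * 0 + e - e) +
     (sech_sum e w * sech_sum e w - sech_sum2 e w)) in H.
  - apply (nnsum_split1 (fun m => gap_sum w e (2 * m + e - e))) in H.
    + revert H; apply nnsum_ext; intros m. unfold gap_sum.
      replace (2 * m + e - e)%Z with (2 * m)%Z by lia.
      destruct (eqc 0%Z m) as [<-|n].
      * simpl; unfold Rdiv; ring.
      * destruct (Z.eqb_spec (2 * m) 0); [lia|auto].
    + apply H.
  - unfold gap_sum. replace (2 * 0 + e - e)%Z with 0%Z by lia. simpl; ring.
Qed.

Lemma Xev_double w S T : Xodd (2 * w) S -> Xev (2 * w) T -> Xev w (2 * S + 2 * T).
Proof.
  intros HS HT. rewrite Rplus_comm.
  apply (Z_even_odd_nnsum (fun m => IZR (2 * m) / sinh (IZR (2 * m) * w))).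
  - apply (nnsum_scal 2) in HT; [|lra]. revert HT; apply nnsum_ext; intros m.
    rewrite (mult_IZR 2 (2 * m)).
    replace (IZR 2 * IZR (2 * m) * w) with (IZR (2 * m) * (2 * w)) by ring. unfold Rdiv; ring.
  - apply (nnsum_scal 2) in HS; [|lra]. revert HS; apply nnsum_ext; intros m.
    rewrite (mult_IZR 2 (2 * m + 1)).
    replace (IZR 2 * IZR (2 * m + 1) * w) with (IZR (2 * m + 1) * (2 * w)) by ring. unfold Rdiv; ring.
Qed.

Lemma Vev_double w S T : Vodd (2 * w) S -> Vev (2 * w) T -> Vev w (8 * S + 8 * T).
Proof.
  intros HS HT. rewrite Rplus_comm.
  apply (Z_even_odd_nnsum (fun m => IZR (2 * m) ^ 3 / sinh (IZR (2 * m) * w))).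
  - apply (nnsum_scal 8) in HT; [|lra]. revert HT; apply nnsum_ext; intros m.
    rewrite (mult_IZR 2 (2 * m)).
    replace (IZR 2 * IZR (2 * m) * w) with (IZR (2 * m) * (2 * w)) by ring. unfold Rdiv; ring.
  - apply (nnsum_scal 8) in HS; [|lra]. revert HS; apply nnsum_ext; intros m.
    rewrite (mult_IZR 2 (2 * m + 1)).
    replace (IZR 2 * IZR (2 * m + 1) * w) with (IZR (2 * m + 1) * (2 * w)) by ring. unfold Rdiv; ring.
Qed.

Lemma nnsum_Z_odd_sym (f : Z -> R) S : (forall k, f (- k - 1)%Z = f k) ->
  nnsum f S -> nnsum (fun n => f (Z.of_nat n)) (S / 2).
Proof.
  intros Hf H. destruct (nnsum_Z_ex f S H) as [S1 [S2 [H1 [H2 ->]]]].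
  assert (H3 : nnsum (fun n => f (Z.of_nat n)) S2).
  { revert H2; apply nnsum_ext; intros n. rewrite <- (Hf (Z.of_nat n)). f_equal; lia. }
  rewrite (nnsum_unique _ _ _ H3 H1) in *. replace ((S1 + S1) / 2) with S1 by field. auto.
Qed.

Lemma nnsum_Z_odd_sym_conv (f : Z -> R) S : (forall k, f (- k - 1)%Z = f k) ->
  nnsum (fun n => f (Z.of_nat n)) S -> nnsum f (2 * S).
Proof.
  intros Hf H. replace (2 * S) with (S + S) by ring. apply nnsum_Z; auto.
  revert H; apply nnsum_ext; intros n. rewrite <- (Hf (Z.of_nat n)). f_equal; lia.
Qed.

Lemma nnsum_Z_even_sym (f : Z -> R) S : (forall k, f (- k)%Z = f k) ->
  nnsum f S -> nnsum (fun n => f (Z.of_nat (Datatypes.S n))) ((S - f 0%Z) / 2).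
Proof.
  intros Hf H. destruct (nnsum_Z_ex f S H) as [S1 [S2 [H1 [H2 ->]]]].
  assert (H3 : nnsum (fun n => f (Z.of_nat (Datatypes.S n))) S2).
  { revert H2; apply nnsum_ext; intros n. auto. }
  assert (H4 : nnsum (fun n => f (Z.of_nat n)) (f 0%Z + S2)).
  { apply (nnsum_split1 (fun n => f (Z.of_nat n)) 0%nat); [intros; apply H|].
    apply (nnsum_inj Datatypes.S (fun i => if eqc 0%nat i then 0 else f (Z.of_nat i))).
    - intros; lia.
    - intros i; destruct (eqc 0%nat i); [lra|apply H].
    - intros [|i]; [right; destruct (eqc 0%nat 0%nat); congruence|eauto].
    - revert H3; apply nnsum_ext; intros n. destruct (eqc 0%nat (Datatypes.S n)); congruence. }
  rewrite (nnsum_unique _ _ _ H1 H4). replace ((f 0%Z + S2 + S2 - f 0%Z) / 2) with S2 by field. auto.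
Qed.

(** * Doubling relations and cubes of [sech] *)

Lemma csch2_series x : 0 < x ->
  nnsum (fun n => 4 * (INR (S n) * exp (- 2 * x) ^ S n)) (/ sinh x ^ 2).
Proof.
  intros Hx. set (y := exp (- 2 * x)).
  assert (Hy : 0 < y < 1).
  { split; [apply exp_pos|]. rewrite <- exp_0; apply exp_increasing; lra. }
  replace (/ sinh x ^ 2) with (4 * y * / (1 - y) ^ 2).
  - apply (nnsum_ext (fun n => 4 * y * (INR (S n) * y ^ n))); [intros; simpl pow; ring|].
    apply nnsum_scal; [lra|]. apply nnsum_geom_deriv; lra.
  - unfold sinh. assert (E : y = exp (- x) * exp (- x)).
    { unfold y; rewrite <- exp_plus; f_equal; ring. }
    rewrite exp_Ropp in *. assert (A := exp_pos x).
    assert (B : 1 < exp x) by (rewrite <- exp_0; apply exp_increasing; auto).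
    rewrite E. field. repeat split; nra.
Qed.

(* Expand [csch^2] in exponentials and sum over the odd index first. *)
Lemma csch2_odd_sum w S : 0 < w -> Xev w S ->
  nnsum (fun k => / sinh (IZR (2 * k + 1) * w) ^ 2) S.
Proof.
  intros Hw H.
  replace S with (2 * (S / 2)) by field.
  apply nnsum_Z_odd_sym_conv.
  { intros k. replace (2 * (- k - 1) + 1)%Z with (- (2 * k + 1))%Z by lia.
    rewrite opp_IZR, <- Ropp_mult_distr_l, sinh_odd. f_equal; ring. }
  apply nnsum_Z_even_sym in H.
  2:{ intros k. replace (2 * - k)%Z with (- (2 * k))%Z by lia.
      rewrite opp_IZR, <- Ropp_mult_distr_l, sinh_odd.
      unfold Rdiv; rewrite Rinv_opp; ring. }
  replace ((S - IZR (2 * 0) / sinh (IZR (2 * 0) * w)) / 2) with (S / 2) in H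
    by (simpl; unfold Rdiv; ring).
  apply (nnsum_swap_eq (fun n j => 4 * (INR (Datatypes.S n) * exp (- 2 * (IZR (2 * Z.of_nat j + 1) * w)) ^ Datatypes.S n))
     (fun n => IZR (2 * Z.of_nat (Datatypes.S n)) / sinh (IZR (2 * Z.of_nat (Datatypes.S n)) * w))); auto.
  - intros n. set (N := Datatypes.S n).
    assert (HN : 0 < INR N) by (apply lt_0_INR; unfold N; lia).
    set (z := exp (- 2 * INR N * w)).
    assert (Hz : 0 < z < 1).
    { split; [apply exp_pos|]. rewrite <- exp_0; apply exp_increasing. nra. }
    assert (HG := nnsum_geom (z ^ 2) ltac:(split; nra)).
    apply (nnsum_scal (4 * INR N * z)) in HG; [|nra].
    replace (IZR (2 * Z.of_nat N) / sinh (IZR (2 * Z.of_nat N) * w)) with (4 * INR N * z * / (1 - z ^ 2)).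
    + revert HG; apply nnsum_ext; intros j. rewrite !Rmult_assoc. f_equal. f_equal.
      unfold z. rewrite <- pow_mult, !pow_exp, <- exp_plus. f_equal.
      rewrite plus_IZR, mult_IZR, <- INR_IZR_INZ, mult_INR. simpl (INR 2). ring.
    + rewrite mult_IZR, <- INR_IZR_INZ. unfold sinh.
      replace (- (2 * INR N * w)) with (- 2 * INR N * w) by ring. fold z.
      replace (2 * INR N * w) with (- (- 2 * INR N * w)) by ring.
      rewrite exp_Ropp. fold z. field. split; nra.
  - intros j. apply csch2_series. apply Rmult_lt_0_compat; auto. apply IZR_lt; lia.
Qed.

(** Summed over odd multiples of [w], the term at [2 x] is the [csch^2] series at [2 w]; this gives
    a second link between [Xev w] and [Xev (2 w)]. *)
Lemma sech2_csch2 x : x <> 0 -> sech x ^ 2 + 4 * / sinh (2 * x) ^ 2 = / sinh x ^ 2.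
Proof.
  intros Hx. unfold sech.
  assert (E : sinh (2 * x) = 2 * sinh x * cosh x).
  { unfold sinh, cosh. replace (2 * x) with (x + x) by ring. rewrite Ropp_plus_distr, !exp_plus. field. }
  assert (E1 : cosh x ^ 2 - sinh x ^ 2 = 1).
  { unfold sinh, cosh. rewrite exp_Ropp. field. apply Rgt_not_eq, exp_pos. }
  assert (A := sinh_neq_0 x Hx). assert (B := cosh_pos x).
  rewrite E. 
  replace ((/ cosh x) ^ 2 + 4 * / (2 * sinh x * cosh x) ^ 2) with ((sinh x ^ 2 + 1) / (sinh x ^ 2 * cosh x ^ 2)) by (field; lra).
  replace (sinh x ^ 2 + 1) with (cosh x ^ 2) by lra. field; lra.
Qed.

(** Write [X], [X'] for the values of [Xev] at [w], [2 w], and [S] for [sech_sum2 1 w]. Three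
    evaluations are available: [X = sech_sum 1 w ^ 2 - S], then [X = S + 4 X'] through [csch^2], and
    [X = 2 X' + 2 sech_sum 0 (2 w) sech_sum 1 (2 w)] by splitting. Eliminating [S] and [X'] leaves
    the claim. *)
Lemma sech_sum_odd_sq w : 0 < w -> sech_sum 1 w ^ 2 = 4 * (sech_sum 0 (2 * w) * sech_sum 1 (2 * w)).
Proof.
  intros Hw.
  assert (Hw2 : 0 < 2 * w) by lra.
  assert (H1 := Xev_eq w 1 Hw ltac:(lia)). assert (H2 := Xev_eq (2 * w) 1 Hw2 ltac:(lia)).
  assert (H3 := Xev_double w _ _ (Xodd_eq (2 * w) Hw2) H2).
  assert (E := nnsum_unique _ _ _ H1 H3).
  assert (Y1 := csch2_odd_sum w _ Hw H1). assert (Y2 := csch2_odd_sum (2 * w) _ Hw2 H2).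
  assert (Y3 : nnsum (fun k => sech (IZR (2 * k + 1) * w) ^ 2 + 4 * / sinh (IZR (2 * k + 1) * (2 * w)) ^ 2)
    (sech_sum2 1 w + 4 * (sech_sum 1 (2 * w) ^ 2 - sech_sum2 1 (2 * w)))).
  { apply nnsum_plus; [apply sech_sum2_correct; auto; lia|]. apply nnsum_scal; [lra|]. apply Y2. }
  assert (E2 : sech_sum2 1 w + 4 * (sech_sum 1 (2 * w) ^ 2 - sech_sum2 1 (2 * w))
     = sech_sum 1 w ^ 2 - sech_sum2 1 w).
  { apply (nnsum_unique _ _ _ Y3). revert Y1; apply nnsum_ext; intros k.
    rewrite <- sech2_csch2.
    - replace (2 * (IZR (2 * k + 1) * w)) with (IZR (2 * k + 1) * (2 * w)) by ring. auto.
    - apply Rmult_integral_contrapositive_currified; [apply not_0_IZR; lia|lra]. }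
  lra.
Qed.

Lemma sech_sum_even_split w : 0 < w -> sech_sum 0 w = sech_sum 0 (2 * w) + sech_sum 1 (2 * w).
Proof.
  intros Hw. apply (nnsum_unique (fun k => sech (IZR (2 * k + 0) * w))).
  - apply sech_sum_correct; auto; lia.
  - apply (Z_even_odd_nnsum (fun k => sech (IZR (2 * k + 0) * w))).
    + assert (H := sech_sum_correct (2 * w) 0 ltac:(lra) ltac:(lia)).
      revert H; apply nnsum_ext; intros k. f_equal.
      rewrite !plus_IZR, !mult_IZR. ring.
    + assert (H := sech_sum_correct (2 * w) 1 ltac:(lra) ltac:(lia)).
      revert H; apply nnsum_ext; intros k. f_equal.
      rewrite Z.add_0_r, (mult_IZR 2 (2 * k + 1)). ring.
Qed.

Lemma sech_sum2_even_split w : 0 < w -> sech_sum2 0 w = sech_sum2 0 (2 * w) + sech_sum2 1 (2 * w).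
Proof.
  intros Hw. apply (nnsum_unique (fun k => sech (IZR (2 * k + 0) * w) ^ 2)).
  - apply sech_sum2_correct; auto; lia.
  - apply (Z_even_odd_nnsum (fun k => sech (IZR (2 * k + 0) * w) ^ 2)).
    + assert (H := sech_sum2_correct (2 * w) 0 ltac:(lra) ltac:(lia)).
      revert H; apply nnsum_ext; intros k. f_equal. f_equal.
      rewrite !plus_IZR, !mult_IZR. ring.
    + assert (H := sech_sum2_correct (2 * w) 1 ltac:(lra) ltac:(lia)).
      revert H; apply nnsum_ext; intros k. f_equal. f_equal.
      rewrite Z.add_0_r, (mult_IZR 2 (2 * k + 1)). ring.
Qed.

Lemma sech_sum2_diff w : 0 < w ->
  sech_sum 0 w ^ 2 - sech_sum 1 w ^ 2 = sech_sum2 0 w - sech_sum2 1 w.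
Proof.
  intros Hw. assert (E := nnsum_unique _ _ _ (Xev_eq w 0 Hw ltac:(lia)) (Xev_eq w 1 Hw ltac:(lia))). lra.
Qed.

Lemma sech_mom_even_odd w : 0 < w -> sech_sum 0 w * sech_mom 0 w = sech_sum 1 w * sech_mom 1 w.
Proof.
  intros Hw. assert (E := nnsum_unique _ _ _ (Vev_eq w 0 Hw ltac:(lia)) (Vev_eq w 1 Hw ltac:(lia))). lra.
Qed.

Lemma sech_mom_double w : 0 < w -> sech_sum 0 w * sech_mom 0 w =
  4 * (sech_mom 1 (2 * w) * sech_sum 0 (2 * w) + sech_sum 1 (2 * w) * sech_mom 0 (2 * w))
  + 8 * (sech_sum 0 (2 * w) * sech_mom 0 (2 * w)).
Proof.
  intros Hw. assert (Hw2 : 0 < 2 * w) by lra.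
  assert (E := nnsum_unique _ _ _ (Vev_eq w 0 Hw ltac:(lia))
    (Vev_double w _ _ (Vodd_eq (2 * w) Hw2) (Vev_eq (2 * w) 0 Hw2 ltac:(lia)))). lra.
Qed.

(* The [sech * tanh] terms telescope; adding multiples of [sech] keeps every term nonnegative for [y < x]. *)
Lemma sech_cube_identity x y : y < x ->
  sech x * sech y * (sech x + sech y)
    + (/ sinh (x - y) * (sech y * (1 + tanh y)) + / sinh (x - y) * sech x)
  = / (1 + cosh (x - y)) * (sech x + sech y)
    + (/ sinh (x - y) * (sech x * (1 + tanh x)) + / sinh (x - y) * sech y).
Proof.
  intros Hxy. unfold sech, tanh, sinh, cosh, Rminus.
  rewrite !Ropp_plus_distr, !exp_plus, !Ropp_involutive, !exp_Ropp.
  assert (A := exp_pos x). assert (B := exp_pos y). assert (C := exp_increasing _ _ Hxy).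
  set (p := exp x) in *. set (q := exp y) in *.
  field. repeat split; nra.
Qed.

Section Cubes.
Variable w : R.
Hypothesis Hw : 0 < w.

Let s (i : Z) : R := sech (IZR i * w).

(** Both points lie in the odd class, so in the summed identity the auxiliary terms have equal
    totals on the two sides and cancel. What remains is [2 b / (1 + cosh (2 d w))], and
    [1 + cosh (2 y) = 2 cosh^2 y]. *)
Lemma sech_cube_gap (d : nat) : (0 < d)%nat ->
  nnsum (fun k => s (2 * k + 1) * s (2 * k + 1 - 2 * Z.of_nat d) *
     (s (2 * k + 1) + s (2 * k + 1 - 2 * Z.of_nat d)))
   (sech_sum 1 w * sech (IZR (Z.of_nat d) * w) ^ 2).
Proof.
  intros Hd. set (D := IZR (2 * Z.of_nat d) * w).
  assert (HD : 0 < D) by (apply Rmult_lt_0_compat; auto; apply IZR_lt; lia).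
  set (b := sech_sum 1 w).
  assert (Hb : nnsum (fun k => s (2 * k + 1)%Z) b) by (apply sech_sum_correct; auto; lia).
  assert (Hb' : nnsum (fun k => s (2 * k + 1 - 2 * Z.of_nat d)%Z) b).
  { apply (nnsum_shift _ (- Z.of_nat d)) in Hb. revert Hb; apply nnsum_ext; intros k. f_equal; lia. }
  assert (Ht : forall x, 0 <= 1 + tanh x <= 2).
  { intros x. unfold tanh. assert (Hc := cosh_pos x).
    assert (-1 <= sinh x / cosh x <= 1); [|lra].
    assert (Hep := exp_pos x). assert (Hem := exp_pos (- x)).
    split.
    - apply Rmult_le_reg_r with (cosh x); auto.
      unfold Rdiv; rewrite Rmult_assoc, Rinv_l by lra. unfold sinh, cosh; lra.
    - apply Rmult_le_reg_r with (cosh x); auto.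
      unfold Rdiv; rewrite Rmult_assoc, Rinv_l by lra. unfold sinh, cosh; lra. }
  destruct (fun H => nnsum_le_ex (fun k => s (2 * k + 1)%Z * (1 + tanh (IZR (2 * k + 1) * w))) _ _ H
     (nnsum_scal 2 _ _ ltac:(lra) Hb)) as [T [HT _]].
  { intros k; specialize (Ht (IZR (2 * k + 1) * w)).
    assert (0 < s (2 * k + 1)%Z) by apply sech_pos. split; nra. }
  assert (HT' : nnsum (fun k => s (2 * k + 1 - 2 * Z.of_nat d)%Z *
      (1 + tanh (IZR (2 * k + 1 - 2 * Z.of_nat d) * w))) T).
  { apply (nnsum_shift _ (- Z.of_nat d)) in HT. revert HT; apply nnsum_ext; intros k.
    replace (2 * (k + - Z.of_nat d) + 1)%Z with (2 * k + 1 - 2 * Z.of_nat d)%Z by lia. auto. }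
  assert (HsD := sinh_pos D HD). assert (HcD := cosh_ge_1 D).
  assert (Hi : 0 <= / sinh D) by (apply Rlt_le, Rinv_0_lt_compat; auto).
  assert (HR : nnsum (fun k => / sinh D * (s (2 * k + 1 - 2 * Z.of_nat d)%Z *
      (1 + tanh (IZR (2 * k + 1 - 2 * Z.of_nat d) * w))) + / sinh D * s (2 * k + 1)%Z) (/ sinh D * T + / sinh D * b)).
  { apply nnsum_plus; apply nnsum_scal; auto. }
  assert (HL : nnsum (fun k => / (1 + cosh D) * (s (2 * k + 1)%Z + s (2 * k + 1 - 2 * Z.of_nat d)%Z) +
    (/ sinh D * (s (2 * k + 1)%Z * (1 + tanh (IZR (2 * k + 1) * w))) + / sinh D * s (2 * k + 1 - 2 * Z.of_nat d)%Z))
    (/ (1 + cosh D) * (b + b) + (/ sinh D * T + / sinh D * b))).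
  { apply nnsum_plus; [|apply nnsum_plus; apply nnsum_scal; auto].
    apply nnsum_scal; [apply Rlt_le, Rinv_0_lt_compat; lra|]. apply nnsum_plus; auto. }
  replace (b * sech (IZR (Z.of_nat d) * w) ^ 2)
    with (/ (1 + cosh D) * (b + b) + (/ sinh D * T + / sinh D * b) - (/ sinh D * T + / sinh D * b)).
  - refine (nnsum_minus _ _ _ _ _ _ HR).
    + intros k. assert (0 < s (2 * k + 1)%Z) by apply sech_pos.
      assert (0 < s (2 * k + 1 - 2 * Z.of_nat d)%Z) by apply sech_pos.
      apply Rmult_le_pos; [apply Rmult_le_pos|]; lra.
    + revert HL; apply nnsum_ext; intros k. unfold s.
      replace D with (IZR (2 * k + 1) * w - IZR (2 * k + 1 - 2 * Z.of_nat d) * w)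
        by (unfold D; rewrite minus_IZR; ring).
      symmetry; apply sech_cube_identity.
      apply Rmult_lt_compat_r; auto. apply IZR_lt; lia.
  - assert (E : 1 + cosh D = 2 * cosh (IZR (Z.of_nat d) * w) ^ 2).
    { unfold D. rewrite mult_IZR. unfold cosh.
      replace (2 * IZR (Z.of_nat d) * w) with (IZR (Z.of_nat d) * w + IZR (Z.of_nat d) * w) by ring.
      rewrite Ropp_plus_distr, !exp_plus, exp_Ropp. field. apply Rgt_not_eq, exp_pos. }
    rewrite E. unfold sech. assert (Hc := cosh_pos (IZR (Z.of_nat d) * w)). field. lra.
Qed.

Lemma sech_cube_gap_Z (m : Z) : m <> 0%Z ->
  nnsum (fun k => s (2 * k + 1) * s (2 * k + 1 - 2 * m) * (s (2 * k + 1) + s (2 * k + 1 - 2 * m)))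
   (sech_sum 1 w * sech (IZR m * w) ^ 2).
Proof.
  intros Hm. destruct (Z_lt_le_dec 0 m) as [H|H].
  - replace m with (Z.of_nat (Z.to_nat m)) by lia. apply sech_cube_gap; lia.
  - assert (H1 := sech_cube_gap (Z.to_nat (- m)) ltac:(lia)).
    replace (Z.of_nat (Z.to_nat (- m))) with (- m)%Z in H1 by lia.
    rewrite opp_IZR, <- Ropp_mult_distr_l, sech_even in H1.
    apply (nnsum_shift _ (- m)) in H1. revert H1; apply nnsum_ext; intros k.
    replace (2 * (k + - m) + 1)%Z with (2 * k + 1 - 2 * m)%Z by lia.
    replace (2 * k + 1 - 2 * m - 2 * - m)%Z with (2 * k + 1)%Z by lia. ring.
Qed.

(** Sum [s i * s j * (s i + s j)] over all pairs of odd [i], [j] in two ways. As a product it is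
    [2 b s1], with [b], [s1] the odd sums of [sech] and [sech^2]; grouped by [i - j = 2 m] it is
    twice the sum of cubes for [m = 0] and [b * sech (m w)^2] otherwise. The argument [w / 2] makes
    [sech_sum2 0] run over all multiples of [w]. *)
Lemma sech_cube_sum :
  nnsum (fun k => s (2 * k + 1)%Z ^ 3)
    (sech_sum 1 w * sech_sum2 1 w - sech_sum 1 w * (sech_sum2 0 (w / 2) - 1) / 2).
Proof.
  set (b := sech_sum 1 w). set (s1 := sech_sum2 1 w).
  assert (Hb : nnsum (fun k => s (2 * k + 1)%Z) b) by (apply sech_sum_correct; auto; lia).
  assert (Hs1 : nnsum (fun k => s (2 * k + 1)%Z ^ 2) s1) by (apply sech_sum2_correct; auto; lia).
  assert (H0 : nnsum (fun m => s m ^ 2) (sech_sum2 0 (w / 2))).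
  { assert (H := sech_sum2_correct (w / 2) 0 ltac:(lra) ltac:(lia)).
    revert H; apply nnsum_ext; intros k. unfold s. do 2 f_equal.
    rewrite Z.add_0_r, mult_IZR; field. }
  assert (E0 : s 0 ^ 2 = 1).
  { unfold s, sech. rewrite Rmult_0_l, cosh_0. field. }
  assert (H0' : nnsum (fun m => if eqc 0%Z m then 0 else s m ^ 2) (sech_sum2 0 (w / 2) - 1)).
  { apply (nnsum_split1 (fun m => s m ^ 2)); [intros; apply pow2_ge_0|].
    rewrite E0. replace (1 + (sech_sum2 0 (w / 2) - 1)) with (sech_sum2 0 (w / 2)) by ring. auto. }
  assert (HP : nnsum (fun p : Z * Z => s (2 * fst p + 1)%Z * s (2 * snd p + 1)%Z *
      (s (2 * fst p + 1)%Z + s (2 * snd p + 1)%Z)) (2 * (b * s1))).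
  { replace (2 * (b * s1)) with (s1 * b + b * s1) by ring.
    apply (nnsum_ext (fun p : Z * Z => s (2 * fst p + 1)%Z ^ 2 * s (2 * snd p + 1)%Z +
       s (2 * fst p + 1)%Z * s (2 * snd p + 1)%Z ^ 2)); [intros; ring|].
    apply nnsum_plus.
    - apply (nnsum_prod (fun k => s (2 * k + 1)%Z ^ 2) (fun k => s (2 * k + 1)%Z)); auto.
    - apply (nnsum_prod (fun k => s (2 * k + 1)%Z) (fun k => s (2 * k + 1)%Z ^ 2)); auto. }
  destruct (fun H => nnsum_le_ex (fun k => s (2 * k + 1)%Z ^ 3) _ _ H Hs1) as [C [HC _]].
  { intros k. assert (0 < s (2 * k + 1)%Z <= 1) by (split; [apply sech_pos|apply sech_le_1]).
    split; [apply pow_le; lra|]. revert H; generalize (s (2 * k + 1)%Z); intros x Hx.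
    replace (x ^ 3) with (x * x ^ 2) by ring. assert (0 <= x ^ 2) by apply pow2_ge_0. nra. }
  assert (HG : nnsum (fun m => if eqc 0%Z m then 2 * C else b * s m ^ 2)  (2 * (b * s1))).
  { apply (nnsum_fubini (fun m k => s (2 * k + 1)%Z * s (2 * k + 1 - 2 * m)%Z * (s (2 * k + 1)%Z + s (2 * k + 1 - 2 * m)%Z))).
    - intros m. destruct (eqc 0%Z m) as [<-|n].
      + apply (nnsum_ext (fun k => 2 * s (2 * k + 1)%Z ^ 3)); [|apply nnsum_scal; auto; lra].
        intros k. replace (2 * k + 1 - 2 * 0)%Z with (2 * k + 1)%Z by lia. ring.
      + apply sech_cube_gap_Z; auto.
    - apply (nnsum_bij (fun p : Z * Z => (snd p, snd p - fst p)%Z)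
                   (fun p => (fst p - snd p, fst p)%Z)) in HP.
      + revert HP; apply nnsum_ext; intros [m k]; simpl fst; simpl snd.
        replace (2 * (k - m) + 1)%Z with (2 * k + 1 - 2 * m)%Z by lia. auto.
      + intros [m k]; simpl; f_equal; lia.
      + intros [m k]; simpl; f_equal; lia. }
  assert (HG2 : nnsum (fun m => if eqc 0%Z m then 2 * C else b * s m ^ 2) (2 * C + b * (sech_sum2 0 (w / 2) - 1))).
  { apply (nnsum_scal b) in H0'; [|apply (nnsum_nonneg _ _ Hb)].
    assert (H := proj1 (nnsum_split1 (fun m => if eqc 0%Z m then 2 * C else b * s m ^ 2) 0%Z
      (b * (sech_sum2 0 (w / 2) - 1)) (proj1 HG))).
    cbv beta in H. destruct (eqc 0%Z 0%Z) as [_|n]; [|congruence]. apply H.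
    revert H0'; apply nnsum_ext; intros m. destruct (eqc 0%Z m); ring. }
  assert (E := nnsum_unique _ _ _ HG HG2).
  replace (b * s1 - b * (sech_sum2 0 (w / 2) - 1) / 2) with C by lra. auto.
Qed.

End Cubes.

(* The alternating sum of [sech (2 k w)] over [k], written as a difference of nonnegative sums. *)
Definition sech_alt (w : R) : R := sech_sum 0 (2 * w) - sech_sum 1 (2 * w).

(** This is [(x - y)^2 = (x + y)^2 - 4 x y] for the even and odd sums at [2 w]. *)
Lemma sech_alt_sq w : 0 < w -> sech_alt w ^ 2 = sech_sum 0 w ^ 2 - sech_sum 1 w ^ 2.
Proof.
  intros Hw. unfold sech_alt. rewrite sech_sum_odd_sq, (sech_sum_even_split w) by auto. ring.
Qed.

(** Since [sech'' = sech - 2 sech^3], the quantity [sech_sum 1 w - 2 * C] is the sum of [sech'']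
    over the odd multiples of [w]; it becomes twice the second derivative of [odd_sech]. *)
Lemma sech_second_deriv_sum w : 0 < w ->
  exists C, nnsum (fun k => sech (IZR (2 * k + 1) * w) ^ 3) C /\
    sech_sum 1 w - 2 * C = sech_sum 1 w * sech_alt w ^ 2.
Proof.
  intros Hw. eexists; split; [apply sech_cube_sum; auto|].
  rewrite sech_alt_sq, sech_sum2_diff by auto.
  rewrite (sech_sum2_even_split (w / 2)) by lra.
  replace (2 * (w / 2)) with w by field. field.
Qed.

(** * Generating functions of the theta coefficients *)

Lemma zsum_lsum K f : zsum K f = lsum f (map (fun i => Z.of_nat i - Z.of_nat K)%Z (seq 0 (S (2 * K)))).
Proof. unfold zsum; rewrite sum_f_R0_lsum, lsum_map; auto. Qed.

Lemma zsum_window K : NoDup (map (fun i => Z.of_nat i - Z.of_nat K)%Z (seq 0 (S (2 * K)))) /\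
  forall n, In n (map (fun i => Z.of_nat i - Z.of_nat K)%Z (seq 0 (S (2 * K)))) <->
    (Z.abs n <= Z.of_nat K)%Z.
Proof.
  split.
  - apply NoDup_map_inj; [intros; lia|apply seq_NoDup].
  - intros n; rewrite in_map_iff; split.
    + intros [i [<- Hi]]; apply in_seq in Hi; lia.
    + intros H; exists (Z.to_nat (n + Z.of_nat K)); rewrite in_seq; lia.
Qed.

Lemma zsum_plus K f g : zsum K (fun n => f n + g n) = zsum K f + zsum K g.
Proof. rewrite !zsum_lsum, lsum_plus; auto. Qed.

Lemma zsum_nonneg K f : (forall n, 0 <= f n) -> 0 <= zsum K f.
Proof. intros; rewrite zsum_lsum; apply lsum_nonneg; auto. Qed.

(** Each [n] is recorded at its single exponent [k = phi n], and the sums are exchanged. The window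
    [K k] must contain every [n] with [phi n = k], otherwise the finite [zsum] would miss terms. *)
Lemma nnsum_coef (phi : Z -> Z) (g : Z -> R) (K : nat -> nat) t S :
  (forall n, 0 <= phi n)%Z -> (forall n, 0 <= g n) -> 0 <= t ->
  (forall n k, phi n = Z.of_nat k -> (Z.abs n <= Z.of_nat (K k))%Z) ->
  nnsum (fun n => g n * t ^ Z.to_nat (phi n)) S ->
  nnsum (fun k => zsum (K k) (fun n => if Z.eqb (phi n) (Z.of_nat k) then g n else 0) * t ^ k) S.
Proof.
  intros Hphi Hg Ht HK H.
  assert (Htk : forall k, 0 <= t ^ k) by (intros; apply pow_le; auto).
  assert (H0 : forall n k, 0 <= if Z.eqb (phi n) (Z.of_nat k) then g n else 0).
  { intros n k; destruct (Z.eqb _ _); auto; lra. }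
  refine (nnsum_swap_eq (fun n k => (if Z.eqb (phi n) (Z.of_nat k) then g n else 0) * t ^ k)
    _ _ S _ _ H).
  - intros n.
    assert (HF := nnsum_finite (fun k => (if Z.eqb (phi n) (Z.of_nat k) then g n else 0) * t ^ k)
      [Z.to_nat (phi n)]). cbn [lsum fold_right] in HF.
    rewrite Z2Nat.id, Z.eqb_refl, Rplus_0_r in HF by auto. apply HF.
    + intros k; apply Rmult_le_pos; auto.
    + constructor; [simpl; tauto|constructor].
    + intros k Hk. destruct (Z.eqb_spec (phi n) (Z.of_nat k)) as [E|E]; [|ring].
      elim Hk; left. rewrite E; lia.
  - intros k. destruct (zsum_window (K k)) as [W1 W2].
    rewrite Rmult_comm, zsum_lsum, <- lsum_scal.
    apply (nnsum_ext (fun n => t ^ k * (if Z.eqb (phi n) (Z.of_nat k) then g n else 0))); [intros; ring|].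
    apply nnsum_finite; auto.
    + intros n; apply Rmult_le_pos; auto.
    + intros n Hn. destruct (Z.eqb_spec (phi n) (Z.of_nat k)) as [E|E]; [|ring].
      elim Hn; apply W2; auto.
Qed.

Lemma pow_m1_even (n : Z) : (-1) ^ Z.abs_nat (2 * n) = 1.
Proof. rewrite Zabs2Nat.inj_mul. apply pow_1_even. Qed.

Lemma pow_m1_odd (n : Z) : (-1) ^ Z.abs_nat (2 * n + 1) = -1.
Proof.
  assert (Z.abs_nat (2 * n + 1) = S (2 * Z.abs_nat (if Z.leb 0 n then n else - n - 1)))%nat as ->.
  { destruct (Z.leb_spec 0 n); lia. }
  apply pow_1_odd.
Qed.

Section Coefficients.
Variables (phi : Z -> Z) (K : nat -> nat).
Hypothesis Hphi : forall n, (0 <= phi n)%Z.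
Hypothesis HK : forall n k, phi n = Z.of_nat k -> (Z.abs n <= Z.of_nat (K k))%Z.

(** Shaped so that [theta2_coef] and, in the alternating version, [theta4_q2_coef] are instances by
    mere conversion. *)
Definition zcoef (k : nat) : R :=
  zsum (K k) (fun n => if Z.eqb (phi n) (Z.of_nat k) then 1 else 0).
Definition zcoef_alt (k : nat) : R :=
  zsum (K k) (fun n => if Z.eqb (phi n) (Z.of_nat k) then (-1) ^ Z.abs_nat n else 0).

Lemma zcoef_nonneg k : 0 <= zcoef k.
Proof. apply zsum_nonneg; intros n; destruct (Z.eqb _ _); lra. Qed.

Lemma zcoef_nnsum t S : 0 <= t -> nnsum (fun n => t ^ Z.to_nat (phi n)) S ->
  nnsum (fun k => zcoef k * t ^ k) S.
Proof.
  intros Ht H. apply nnsum_coef; auto; [intros; lra|].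
  revert H; apply nnsum_ext; intros; ring.
Qed.

Lemma pow_m1_abs n : (-1) ^ n = 1 \/ (-1) ^ n = -1.
Proof. induction n as [|n [IH|IH]]; simpl; [left|right|left]; rewrite ?IH; ring. Qed.

Lemma zcoef_alt_le k : Rabs (zcoef_alt k) <= zcoef k.
Proof.
  unfold zcoef, zcoef_alt. rewrite !zsum_lsum.
  induction (map (fun i => Z.of_nat i - Z.of_nat (K k))%Z (seq 0 (S (2 * K k)))) as [|n l IH]; simpl.
  - rewrite Rabs_R0; lra.
  - eapply Rle_trans; [apply Rabs_triang|]. apply Rplus_le_compat; auto.
    destruct (Z.eqb _ _); [|rewrite Rabs_R0; lra].
    destruct (pow_m1_abs (Z.abs_nat n)) as [-> | ->]; [rewrite Rabs_R1|rewrite Rabs_m1]; lra.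
Qed.

(** The signs are removed by writing [(-1)^n = (1 + (-1)^n) - 1], a difference of two nonnegative
    weights, each of which is covered by [nnsum_coef]. *)
Lemma zcoef_alt_series t S0 S1 : 0 <= t ->
  nnsum (fun n => t ^ Z.to_nat (phi (2 * n)%Z)) S0 ->
  nnsum (fun n => t ^ Z.to_nat (phi (2 * n + 1)%Z)) S1 ->
  is_series (fun k => zcoef_alt k * t ^ k) (S0 - S1).
Proof.
  intros Ht H0 H1.
  assert (HS : nnsum (fun n => t ^ Z.to_nat (phi n)) (S0 + S1))
    by (apply (Z_even_odd_nnsum (fun n => t ^ Z.to_nat (phi n))); auto).
  assert (HD : nnsum (fun n => (1 + (-1) ^ Z.abs_nat n) * t ^ Z.to_nat (phi n)) (2 * S0 + 0)).
  { apply (Z_even_odd_nnsum (fun n => (1 + (-1) ^ Z.abs_nat n) * t ^ Z.to_nat (phi n))).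
    - apply (nnsum_ext (fun n => 2 * t ^ Z.to_nat (phi (2 * n)%Z))); [|apply nnsum_scal; auto; lra].
      intros n; rewrite pow_m1_even; ring.
    - apply (nnsum_ext (fun _ => 0)); [|apply nnsum_zero].
      intros n; rewrite pow_m1_odd; ring. }
  assert (HS' := nnsum_is_series _ _ (zcoef_nnsum t _ Ht HS)).
  assert (HD' : nnsum (fun k => zsum (K k) (fun n => if Z.eqb (phi n) (Z.of_nat k)
      then 1 + (-1) ^ Z.abs_nat n else 0) * t ^ k) (2 * S0 + 0)).
  { apply (nnsum_coef phi (fun n => 1 + (-1) ^ Z.abs_nat n)); auto.
    intros n; destruct (pow_m1_abs (Z.abs_nat n)); lra. }
  apply nnsum_is_series in HD'.
  replace (S0 - S1) with (minus (2 * S0 + 0) (S0 + S1)) by (unfold minus, plus, opp; simpl; ring).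
  refine (is_series_ext _ _ _ _ (is_series_minus _ _ _ _ HD' HS')).
  intros k. unfold minus, plus, opp; simpl. unfold zcoef, zcoef_alt.
  rewrite (zsum_lsum _ (fun n => if Z.eqb (phi n) (Z.of_nat k) then 1 + (-1) ^ Z.abs_nat n else 0)).
  rewrite (lsum_ext _ (fun n => (if Z.eqb (phi n) (Z.of_nat k) then 1 else 0) +
    (if Z.eqb (phi n) (Z.of_nat k) then (-1) ^ Z.abs_nat n else 0))).
  - rewrite <- zsum_lsum, zsum_plus. ring.
  - intros n _; destruct (Z.eqb _ _); ring.
Qed.

End Coefficients.

Lemma CV_radius_ge_1 (u : nat -> R) :
  (forall t, 0 < t < 1 -> ex_series (fun k => u k * t ^ k)) ->
  forall q, Rabs q < 1 -> Rbar_lt (Rabs q) (CV_radius u).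
Proof.
  intros H q Hq. apply Rbar_not_le_lt; intros Hle.
  set (t := (Rabs q + 1) / 2). assert (Hp := Rabs_pos q).
  assert (Ht : 0 < t < 1) by (unfold t; lra).
  apply (CV_disk_outside u t).
  - apply Rbar_le_lt_trans with (Rabs q); auto. simpl. rewrite (Rabs_pos_eq t); unfold t; lra.
  - apply (ex_series_lim_0 (fun k => u k * t ^ k)). auto.
Qed.

Lemma is_pseries_R (u : nat -> R) (x l : R) : is_series (fun k => u k * x ^ k) l <-> is_pseries u x l.
Proof.
  unfold is_pseries; split; apply is_series_ext; intros n; rewrite <- (pow_n_pow x n); apply Rmult_comm.
Qed.

Lemma pow_anti t m n : 0 <= t <= 1 -> (n <= m)%nat -> t ^ m <= t ^ n.
Proof.
  intros Ht H; induction H as [|m H IH]; [lra|]. simpl.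
  assert (0 <= t ^ m) by (apply pow_le; lra). nra.
Qed.

(** The hypothesis gives [t^(phi n) <= t^|n| / t]. The slack [+ 1] admits [n * n + n], which
    vanishes at [n = -1]. *)
Lemma nnsum_Z_geom_ex t (phi : Z -> Z) : 0 < t < 1 ->
  (forall n, (0 <= phi n)%Z) -> (forall n, (Z.abs n <= phi n + 1)%Z) ->
  exists S, nnsum (fun n => t ^ Z.to_nat (phi n)) S.
Proof.
  intros Ht H0 Hphi.
  assert (HG := nnsum_scal (/ t) _ _ ltac:(apply Rlt_le, Rinv_0_lt_compat; lra) (nnsum_geom t ltac:(lra))).
  assert (Hb : forall i n, (Z.of_nat n <= Z.abs i)%Z -> 0 <= t ^ Z.to_nat (phi i) <= / t * t ^ n).
  { intros i n Hi. split; [apply pow_le; lra|].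
    apply Rmult_le_reg_l with t; [lra|]. rewrite <- Rmult_assoc, Rinv_r, Rmult_1_l by lra.
    change (t * t ^ Z.to_nat (phi i)) with (t ^ S (Z.to_nat (phi i))).
    apply pow_anti; [lra|]. specialize (Hphi i). specialize (H0 i). lia. }
  destruct (nnsum_le_ex (fun n => t ^ Z.to_nat (phi (Z.of_nat n))) _ _
    (fun n => Hb (Z.of_nat n) n ltac:(lia)) HG) as [S [HS _]].
  destruct (nnsum_le_ex (fun n => t ^ Z.to_nat (phi (- Z.of_nat (Datatypes.S n))%Z)) _ _
    (fun n => Hb (- Z.of_nat (Datatypes.S n))%Z n ltac:(lia)) HG) as [T [HT _]].
  exists (S + T). apply nnsum_Z; auto.
Qed.

(** * Theta functions *)

(** The theta functions are introduced as power series in the nome, so that termwise derivatives and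
    the limit [q -> 0] are available. *)
Definition sq_coef : nat -> R := zcoef (fun n => n * n)%Z (fun k => k).
Definition sq_alt_coef : nat -> R := zcoef_alt (fun n => n * n)%Z (fun k => k).
(** Coefficients of [q^(-1/4) theta2(q)]. The window is [S k] because [n = -1] solves
    [n^2 + n = 0]. *)
Definition pronic_coef : nat -> R := zcoef (fun n => n * n + n)%Z (fun k => S k).

Lemma nome_bounds w : 0 < w -> 0 < exp (- 2 * w) < 1.
Proof. intros Hw. split; [apply exp_pos|]. rewrite <- exp_0; apply exp_increasing; lra. Qed.

Lemma sq_coef_ex t : 0 < t < 1 -> ex_series (fun k => sq_coef k * t ^ k).
Proof.
  intros Ht. destruct (nnsum_Z_geom_ex t (fun n => n * n)%Z Ht) as [S HS]; [intros; nia|intros; nia|].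
  exists S. apply nnsum_is_series. apply zcoef_nnsum; auto; [intros; nia|intros; nia|lra].
Qed.

Lemma pronic_coef_ex t : 0 < t < 1 -> ex_series (fun k => pronic_coef k * t ^ k).
Proof.
  intros Ht. destruct (nnsum_Z_geom_ex t (fun n => n * n + n)%Z Ht) as [S HS]; [intros; nia|intros; nia|].
  exists S. apply nnsum_is_series. apply zcoef_nnsum; auto; [intros; nia|intros; nia|lra].
Qed.

Lemma sq_alt_coef_ex t : 0 < t < 1 -> ex_series (fun k => sq_alt_coef k * t ^ k).
Proof.
  intros Ht. destruct (sq_coef_ex t Ht) as [S HS].
  apply (ex_series_le (V := R_CompleteNormedModule) _ (fun k => sq_coef k * t ^ k)); [|exists S; auto].
  intros n. change (Rabs (sq_alt_coef n * t ^ n) <= sq_coef n * t ^ n).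
  assert (0 <= t ^ n) by (apply pow_le; lra).
  rewrite Rabs_mult, (Rabs_pos_eq (t ^ n)) by auto.
  apply Rmult_le_compat_r; auto. apply zcoef_alt_le.
Qed.

Definition sq_radius := CV_radius_ge_1 _ sq_coef_ex.
Definition pronic_radius := CV_radius_ge_1 _ pronic_coef_ex.
Definition sq_alt_radius := CV_radius_ge_1 _ sq_alt_coef_ex.

(* The nome is [q = exp (- 2 * w)]; in [th2] the factor [exp (- w / 2)] is [q^(1/4)]. *)
Definition th3 (w : R) : R := PSeries sq_coef (exp (- 2 * w)).
Definition th4 (w : R) : R := PSeries sq_alt_coef (exp (- 2 * w)).
Definition th2 (w : R) : R := exp (- w / 2) * PSeries pronic_coef (exp (- 2 * w)).

Lemma PSeries_eq u x l : is_series (fun k => u k * x ^ k) l -> PSeries u x = l.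
Proof. intros H. apply is_pseries_unique, is_pseries_R; auto. Qed.

Lemma pow_nome w (m : Z) : (0 <= m)%Z -> exp (- 2 * w) ^ Z.to_nat m = exp (- (IZR m * (2 * w))).
Proof.
  intros Hm. rewrite pow_exp, INR_IZR_INZ, Z2Nat.id by auto. f_equal; ring.
Qed.

Lemma th3_nnsum w : 0 < w -> nnsum (fun n => exp (- (IZR n ^ 2 * (2 * w)))) (th3 w).
Proof.
  intros Hw. assert (Hq := nome_bounds w Hw).
  destruct (nnsum_Z_geom_ex _ (fun n => n * n)%Z Hq) as [S HS]; [intros; nia|intros; nia|].
  assert (E : th3 w = S).
  { apply PSeries_eq, nnsum_is_series, zcoef_nnsum; auto; [intros; nia|intros; nia|lra]. }
  rewrite E. revert HS; apply nnsum_ext; intros n.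
  rewrite pow_nome by nia. rewrite mult_IZR. do 2 f_equal. ring.
Qed.

Lemma th2_nnsum w : 0 < w -> nnsum (fun n => exp (- ((IZR n + / 2) ^ 2 * (2 * w)))) (th2 w).
Proof.
  intros Hw. assert (Hq := nome_bounds w Hw).
  destruct (nnsum_Z_geom_ex _ (fun n => n * n + n)%Z Hq) as [S HS]; [intros; nia|intros; nia|].
  assert (E : PSeries pronic_coef (exp (- 2 * w)) = S).
  { apply PSeries_eq, nnsum_is_series, zcoef_nnsum; auto; [intros; nia|intros; nia|lra]. }
  unfold th2; rewrite E. apply (nnsum_scal (exp (- w / 2))) in HS; [|apply Rlt_le, exp_pos].
  revert HS; apply nnsum_ext; intros n.
  rewrite pow_nome by nia. rewrite <- exp_plus, plus_IZR, mult_IZR. f_equal. field.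
Qed.

(** The even index [2 n] contributes [q^(4 n^2)], the odd index [2 n + 1] contributes
    [- q^(4 (n + 1/2)^2)], and [q^4] is the nome at [4 w]. *)
Lemma th4_split w : 0 < w -> th4 w = th3 (4 * w) - th2 (4 * w).
Proof.
  intros Hw. assert (Hq := nome_bounds w Hw).
  apply PSeries_eq, zcoef_alt_series; try (intros; nia); try lra.
  - assert (H := th3_nnsum (4 * w) ltac:(lra)). revert H; apply nnsum_ext; intros n.
    rewrite pow_nome by nia. rewrite !mult_IZR. f_equal; ring.
  - assert (H := th2_nnsum (4 * w) ltac:(lra)). revert H; apply nnsum_ext; intros n.
    rewrite pow_nome by nia. rewrite mult_IZR, plus_IZR, mult_IZR. f_equal; field.
Qed.

(* The lattice [Z^2] rotated by 45 degrees splits into two cosets of index 2. *)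
Lemma nnsum_rotate (f : Z -> Z -> R) S T :
  nnsum (fun p : Z * Z => f (fst p + snd p) (fst p - snd p))%Z S ->
  nnsum (fun p : Z * Z => f (fst p + snd p) (snd p - fst p - 1))%Z T ->
  nnsum (fun p : Z * Z => f (fst p) (snd p)) (S + T).
Proof.
  intros HS HT.
  set (h := fun x : Z * Z + Z * Z => match x with
    | inl (u, v) => (u + v, u - v)%Z | inr (u, v) => (u + v, v - u - 1)%Z end).
  set (k := fun p : Z * Z => let (m, n) := p in
    if Z.even (m + n) then inl ((m + n) / 2, (m - n) / 2)%Z
    else inr ((m - n - 1) / 2, (m + n + 1) / 2)%Z : Z * Z + Z * Z).
  assert (H : nnsum (fun x => f (fst (h x)) (snd (h x))) (S + T)).
  { apply nnsum_sumtype.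
    - revert HS; apply nnsum_ext; intros [u v]; reflexivity.
    - revert HT; apply nnsum_ext; intros [u v]; reflexivity. }
  assert (Hhk : forall p, h (k p) = p).
  { intros [m n]; unfold h, k.
    assert (Hn := Zmod_even (m + n)). assert (A := Z.div_mod (m + n) 2 ltac:(lia)).
    destruct (Z.even (m + n)).
    - assert (B := Z.div_mod (m - n) 2 ltac:(lia)).
      assert ((m - n) mod 2 = 0)%Z.
      { replace (m - n)%Z with (m + n + (- n) * 2)%Z by lia. rewrite Z_mod_plus_full; auto. }
      f_equal; lia.
    - assert (B := Z.div_mod (m - n - 1) 2 ltac:(lia)). assert (C := Z.div_mod (m + n + 1) 2 ltac:(lia)).
      assert ((m + n + 1) mod 2 = 0)%Z.
      { rewrite <- Z.add_mod_idemp_l, Hn by lia. reflexivity. }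
      assert ((m - n - 1) mod 2 = 0)%Z.
      { replace (m - n - 1)%Z with (m + n + 1 + (- n - 1) * 2)%Z by lia. rewrite Z_mod_plus_full; auto. }
      f_equal; lia. }
  assert (Hinj : forall x y, h x = h y -> x = y).
  { intros [[u v]|[u v]] [[u' v']|[u' v']]; unfold h; intros E; injection E; intros;
    try (exfalso; lia); f_equal; f_equal; lia. }
  apply (nnsum_bij k h) in H.
  - revert H; apply nnsum_ext; intros p. rewrite Hhk; auto.
  - intros p; auto.
  - intros x; apply Hinj; rewrite Hhk; auto.
Qed.

Lemma th3_sq w : 0 < w -> th3 w ^ 2 = th3 (2 * w) ^ 2 + th2 (2 * w) ^ 2.
Proof.
  intros Hw. assert (H := nnsum_prod _ _ _ _ (th3_nnsum w Hw) (th3_nnsum w Hw)).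
  replace (th3 w ^ 2) with (th3 w * th3 w) by ring.
  apply (nnsum_unique _ _ _ H).
  apply (nnsum_rotate (fun m n => exp (- (IZR m ^ 2 * (2 * w))) * exp (- (IZR n ^ 2 * (2 * w))))).
  - replace (th3 (2 * w) ^ 2) with (th3 (2 * w) * th3 (2 * w)) by ring.
    assert (H' := nnsum_prod _ _ _ _ (th3_nnsum (2 * w) ltac:(lra)) (th3_nnsum (2 * w) ltac:(lra))).
    revert H'; apply nnsum_ext; intros [u v]; simpl fst; simpl snd.
    rewrite <- !exp_plus, minus_IZR, plus_IZR. f_equal; ring.
  - replace (th2 (2 * w) ^ 2) with (th2 (2 * w) * th2 (2 * w)) by ring.
    assert (H1 := th2_nnsum (2 * w) ltac:(lra)).
    (* On the second coset [m^2 + n^2 = 2 ((u + 1/2)^2 + (v - 1/2)^2)], so one of the two factors is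
       the shifted series. *)
    assert (H2 := nnsum_shift _ (-1) _ H1).
    assert (H' := nnsum_prod _ _ _ _ H1 H2).
    revert H'; apply nnsum_ext; intros [u v]; simpl fst; simpl snd.
    rewrite <- !exp_plus, !minus_IZR, !plus_IZR. f_equal; field.
Qed.

Lemma th2_sq w : 0 < w -> th2 w ^ 2 = 2 * (th2 (2 * w) * th3 (2 * w)).
Proof.
  intros Hw. assert (H := nnsum_prod _ _ _ _ (th2_nnsum w Hw) (th2_nnsum w Hw)).
  replace (th2 w ^ 2) with (th2 w * th2 w) by ring.
  replace (2 * (th2 (2 * w) * th3 (2 * w))) with
    (th2 (2 * w) * th3 (2 * w) + th2 (2 * w) * th3 (2 * w)) by ring.
  apply (nnsum_unique _ _ _ H).
  assert (H' := nnsum_prod _ _ _ _ (th2_nnsum (2 * w) ltac:(lra)) (th3_nnsum (2 * w) ltac:(lra))).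
  apply (nnsum_rotate (fun m n => exp (- ((IZR m + / 2) ^ 2 * (2 * w))) * exp (- ((IZR n + / 2) ^ 2 * (2 * w)))));
  revert H'; apply nnsum_ext; intros [u v]; simpl fst; simpl snd;
  rewrite <- !exp_plus, !minus_IZR, plus_IZR; f_equal; field.
Qed.

(** * Landen relations and logarithmic derivatives *)

Definition alpha w := th3 w ^ 2.
Definition beta w := th2 w ^ 2.
Definition gamma w := th4 w ^ 2.

Section ThetaRelations.
Variable w : R.
Hypothesis Hw : 0 < w.

Lemma alpha_double : alpha w = alpha (2 * w) + beta (2 * w).
Proof. exact (th3_sq w Hw). Qed.

Lemma beta_sq_double : beta w ^ 2 = 4 * (alpha (2 * w) * beta (2 * w)).
Proof. unfold alpha, beta. rewrite th2_sq by auto. ring. Qed.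

Lemma gamma_double : gamma w = alpha (2 * w) - beta (2 * w).
Proof.
  unfold gamma, alpha, beta. rewrite th4_split, th3_sq, (th2_sq (2 * w)) by lra.
  replace (2 * (2 * w)) with (4 * w) by ring. ring.
Qed.

(** Jacobi's identity [theta3^4 = theta2^4 + theta4^4], read off from the doubling relations. *)
Lemma gamma_sq : gamma w ^ 2 = alpha w ^ 2 - beta w ^ 2.
Proof. rewrite gamma_double, beta_sq_double, alpha_double; ring. Qed.

End ThetaRelations.

(** Iteration gives [|f w| <= |f (2^n w)|], and the right side tends to 0. This is the uniqueness
    principle: an identity compatible with doubling only has to be checked at infinity. *)
Lemma doubling_zero (f : R -> R) :
  (forall w, 0 < w -> Rabs (f w) <= Rabs (f (2 * w))) -> is_lim f p_infty 0 ->
  forall w, 0 < w -> f w = 0.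
Proof.
  intros Hf Hl w Hw.
  assert (Hn : forall n, Rabs (f w) <= Rabs (f (2 ^ n * w))).
  { induction n as [|n IH]; [rewrite pow_O, Rmult_1_l; lra|].
    eapply Rle_trans; [apply IH|].
    replace (2 ^ S n * w) with (2 * (2 ^ n * w)) by (simpl; ring).
    apply Hf. apply Rmult_lt_0_compat; auto. apply pow_lt; lra. }
  apply NNPP; intros Hne. apply Rabs_pos_lt in Hne.
  apply is_lim_spec in Hl. destruct (Hl (mkposreal _ Hne)) as [M HM]. simpl in HM.
  destruct (Pow_x_infinity 2 ltac:(rewrite Rabs_pos_eq; lra) (Rmax 0 (M / w) + 1)) as [N HN].
  specialize (HN N (le_n _)). rewrite Rabs_pos_eq in HN by (apply pow_le; lra).
  specialize (HM (2 ^ N * w)).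
  assert (M < 2 ^ N * w).
  { apply Rlt_le_trans with ((Rmax 0 (M / w) + 1) * w).
    - assert (A := Rmax_r 0 (M / w)).
      replace M with (M / w * w) at 1 by (field; lra). apply Rmult_lt_compat_r; lra.
    - apply Rmult_le_compat_r; lra. }
  specialize (HM H). rewrite Rminus_0_r in HM. specialize (Hn N). lra.
Qed.

(** As [w] tends to infinity the nome tends to 0, so limits become values of power series at 0. *)
Lemma is_lim_nome (F : R -> R) l : continuous F 0 -> F 0 = l -> is_lim (fun w => F (exp (- 2 * w))) p_infty l.
Proof.
  intros HF <-.
  apply (is_lim_comp_continuous (fun w => exp (- 2 * w)) F p_infty 0).
  - apply is_lim_spec; intros [e He]. exists (- ln e / 2). intros x Hx; simpl.
    rewrite Rminus_0_r, Rabs_pos_eq by apply Rlt_le, exp_pos.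
    rewrite <- (exp_ln e) by auto. apply exp_increasing. lra.
  - exact HF.
Qed.

Section PowerSeries.
Variable u : nat -> R.
Hypothesis Hu : forall q, Rabs q < 1 -> Rbar_lt (Rabs q) (CV_radius u).

Lemma PS_derive_radius q : Rabs q < 1 -> Rbar_lt (Rabs q) (CV_radius (PS_derive u)).
Proof. rewrite CV_radius_derive; auto. Qed.

Lemma PSeries_derive_1 q : Rabs q < 1 -> is_derive (PSeries u) q (PSeries (PS_derive u) q).
Proof. intros; apply is_derive_PSeries; auto. Qed.

Lemma PSeries_cont_1 q : Rabs q < 1 -> continuous (PSeries u) q.
Proof.
  intros H. apply (ex_derive_continuous (V := R_NormedModule)). eexists; apply PSeries_derive_1; auto.
Qed.

End PowerSeries.

Lemma nome_abs w : 0 < w -> Rabs (exp (- 2 * w)) < 1.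
Proof. intros Hw. assert (H := nome_bounds w Hw). rewrite Rabs_pos_eq; lra. Qed.

Lemma is_derive_nome (F : R -> R) w l : is_derive F (exp (- 2 * w)) l ->
  is_derive (fun w => F (exp (- 2 * w))) w (- 2 * exp (- 2 * w) * l).
Proof.
  intros H. apply (is_derive_comp F (fun w => exp (- 2 * w)) w l (- 2 * exp (- 2 * w))); auto.
  auto_derive; auto. ring.
Qed.

Definition sq_series := PSeries sq_coef.
Definition sq_series1 := PSeries (PS_derive sq_coef).
Definition sq_series2 := PSeries (PS_derive (PS_derive sq_coef)).
Definition sq_alt_series := PSeries sq_alt_coef.
Definition sq_alt_series1 := PSeries (PS_derive sq_alt_coef).
Definition pronic_series := PSeries pronic_coef.
Definition pronic_series1 := PSeries (PS_derive pronic_coef).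

Lemma th3_pos w : 0 < w -> 0 < th3 w.
Proof.
  intros Hw. apply Rlt_le_trans with (exp (- (IZR 0 ^ 2 * (2 * w)))); [apply exp_pos|].
  apply (nnsum_ge (fun n => exp (- (IZR n ^ 2 * (2 * w)))) (th3 w)), th3_nnsum; auto.
Qed.

Lemma th2_pos w : 0 < w -> 0 < th2 w.
Proof.
  intros Hw. apply Rlt_le_trans with (exp (- ((IZR 0 + / 2) ^ 2 * (2 * w)))); [apply exp_pos|].
  apply (nnsum_ge (fun n => exp (- ((IZR n + / 2) ^ 2 * (2 * w)))) (th2 w)), th2_nnsum; auto.
Qed.

Lemma alpha_pos w : 0 < w -> 0 < alpha w.
Proof. intros; apply pow_lt, th3_pos; auto. Qed.

Lemma beta_pos w : 0 < w -> 0 < beta w.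
Proof. intros; apply pow_lt, th2_pos; auto. Qed.

Lemma sq_coef_0 : sq_coef 0 = 1. Proof. unfold sq_coef, zcoef, zsum; simpl; auto. Qed.
Lemma sq_coef_1 : sq_coef 1 = 2. Proof. unfold sq_coef, zcoef, zsum; simpl; ring. Qed.
Lemma sq_alt_coef_0 : sq_alt_coef 0 = 1. Proof. unfold sq_alt_coef, zcoef_alt, zsum; simpl; auto. Qed.
Lemma sq_alt_coef_1 : sq_alt_coef 1 = -2. Proof. unfold sq_alt_coef, zcoef_alt, zsum; simpl; ring. Qed.
Lemma pronic_coef_0 : pronic_coef 0 = 2. Proof. unfold pronic_coef, zcoef, zsum; simpl; ring. Qed.

Lemma Rabs_0_lt_1 : Rabs 0 < 1. Proof. rewrite Rabs_R0; lra. Qed.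

Lemma sq_series_0 : sq_series 0 = 1. Proof. unfold sq_series; rewrite PSeries_0; apply sq_coef_0. Qed.
Lemma sq_series1_0 : sq_series1 0 = 2.
Proof. unfold sq_series1; rewrite PSeries_0. unfold PS_derive. rewrite sq_coef_1; simpl; ring. Qed.
Lemma sq_alt_series_0 : sq_alt_series 0 = 1. Proof. unfold sq_alt_series; rewrite PSeries_0; apply sq_alt_coef_0. Qed.
Lemma sq_alt_series1_0 : sq_alt_series1 0 = -2.
Proof. unfold sq_alt_series1; rewrite PSeries_0. unfold PS_derive. rewrite sq_alt_coef_1; simpl; ring. Qed.
Lemma pronic_series_0 : pronic_series 0 = 2. Proof. unfold pronic_series; rewrite PSeries_0; apply pronic_coef_0. Qed.

Lemma gamma_lim : is_lim gamma p_infty 1.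
Proof.
  apply (is_lim_nome (fun q => sq_alt_series q ^ 2)).
  - apply (continuous_comp sq_alt_series (fun x => x ^ 2)).
    + apply PSeries_cont_1; [apply sq_alt_radius|apply Rabs_0_lt_1].
    + apply (ex_derive_continuous (fun x => x ^ 2)). auto_derive; auto.
  - rewrite sq_alt_series_0; ring.
Qed.

Lemma alpha_lim : is_lim alpha p_infty 1.
Proof.
  apply (is_lim_nome (fun q => sq_series q ^ 2)).
  - apply (continuous_comp sq_series (fun x => x ^ 2)).
    + apply PSeries_cont_1; [apply sq_radius|apply Rabs_0_lt_1].
    + apply (ex_derive_continuous (fun x => x ^ 2)). auto_derive; auto.
  - rewrite sq_series_0; ring.
Qed.

(** Together with [alpha (2 w) = (alpha w + gamma w) / 2] this is one step of Gauss's
    arithmetic-geometric mean. *)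
Lemma gamma_sq_double w : 0 < w -> gamma (2 * w) ^ 2 = alpha w * gamma w.
Proof.
  intros Hw. rewrite gamma_sq, (gamma_double w), (alpha_double w) by lra. ring.
Qed.

(* A zero of [gamma] would propagate to all [2^n w], against [gamma -> 1]. *)
Lemma gamma_pos w : 0 < w -> 0 < gamma w.
Proof.
  intros Hw.
  assert (H0 : 0 <= gamma w) by apply pow2_ge_0.
  destruct (Rle_lt_or_eq_dec _ _ H0) as [|E]; auto. exfalso.
  assert (Hn : forall n, gamma (2 ^ n * w) = 0).
  { induction n as [|n IH]; [rewrite pow_O, Rmult_1_l; auto|].
    replace (2 ^ S n * w) with (2 * (2 ^ n * w)) by (simpl; ring).
    assert (H2 : gamma (2 * (2 ^ n * w)) ^ 2 = 0).
    { rewrite gamma_sq_double; [rewrite IH; ring|]. apply Rmult_lt_0_compat; auto. apply pow_lt; lra. }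
    destruct (Req_dec (gamma (2 * (2 ^ n * w))) 0) as [|Hne]; auto.
    assert (A := pow2_gt_0 _ Hne). lra. }
  assert (Hl := gamma_lim). apply is_lim_spec in Hl.
  destruct (Hl (mkposreal 1 Rlt_0_1)) as [M HM]. simpl in HM.
  destruct (Pow_x_infinity 2 ltac:(rewrite Rabs_pos_eq; lra) (Rmax 0 (M / w) + 1)) as [N HN].
  specialize (HN N (le_n _)). rewrite Rabs_pos_eq in HN by (apply pow_le; lra).
  specialize (HM (2 ^ N * w)).
  rewrite Hn, Rminus_0_l, Rabs_Ropp, Rabs_R1 in HM.
  assert (M < 2 ^ N * w); [|specialize (HM H); lra].
  apply Rlt_le_trans with ((Rmax 0 (M / w) + 1) * w).
  - assert (A := Rmax_r 0 (M / w)).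
    replace M with (M / w * w) at 1 by (field; lra). apply Rmult_lt_compat_r; lra.
  - apply Rmult_le_compat_r; lra.
Qed.

(* [dla], [dlc], [dlb] are the logarithmic derivatives of [alpha], [gamma], [beta]; [dla'] is the derivative of [dla]. *)
Definition dla w := - 4 * exp (- 2 * w) * sq_series1 (exp (- 2 * w)) / sq_series (exp (- 2 * w)).
Definition dlc w := - 4 * exp (- 2 * w) * sq_alt_series1 (exp (- 2 * w)) / sq_alt_series (exp (- 2 * w)).
Definition dlb w := - 1 - 4 * exp (- 2 * w) * pronic_series1 (exp (- 2 * w)) / pronic_series (exp (- 2 * w)).
Definition dla' w := 8 * exp (- 2 * w) * ((sq_series1 (exp (- 2 * w)) + exp (- 2 * w) * sq_series2 (exp (- 2 * w))) / sq_series (exp (- 2 * w))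
   - exp (- 2 * w) * (sq_series1 (exp (- 2 * w)) / sq_series (exp (- 2 * w))) ^ 2).

Section LogDerivatives.
Variable w : R.
Hypothesis Hw : 0 < w.

Lemma sq_series_neq_0 : sq_series (exp (- 2 * w)) <> 0.
Proof. apply Rgt_not_eq, (th3_pos w Hw). Qed.

Lemma sq_alt_series_neq_0 : sq_alt_series (exp (- 2 * w)) <> 0.
Proof.
  intros E. assert (H := gamma_pos w Hw). unfold gamma, th4 in H. fold sq_alt_series in H. rewrite E in H. lra.
Qed.

Lemma pronic_series_neq_0 : pronic_series (exp (- 2 * w)) <> 0.
Proof.
  intros E. assert (H := th2_pos w Hw). unfold th2 in H. fold pronic_series in H. rewrite E in H. lra.
Qed.

Lemma is_derive_alpha : is_derive alpha w (alpha w * dla w).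
Proof.
  unfold alpha, th3. fold sq_series.
  replace (sq_series (exp (-2 * w)) ^ 2 * dla w) with
    (- 2 * exp (- 2 * w) * (2 * sq_series (exp (- 2 * w)) * sq_series1 (exp (- 2 * w)))).
  - apply (is_derive_nome (fun q => sq_series q ^ 2)).
    assert (H := PSeries_derive_1 _ sq_radius _ (nome_abs w Hw)).
    fold sq_series sq_series1 in H. evar_last.
    + apply (is_derive_pow sq_series 2); exact H.
    + simpl; ring.
  - unfold dla. field. apply sq_series_neq_0.
Qed.

Lemma is_derive_gamma : is_derive gamma w (gamma w * dlc w).
Proof.
  unfold gamma, th4. fold sq_alt_series.
  replace (sq_alt_series (exp (-2 * w)) ^ 2 * dlc w) with
    (- 2 * exp (- 2 * w) * (2 * sq_alt_series (exp (- 2 * w)) * sq_alt_series1 (exp (- 2 * w)))).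
  - apply (is_derive_nome (fun q => sq_alt_series q ^ 2)).
    assert (H := PSeries_derive_1 _ sq_alt_radius _ (nome_abs w Hw)).
    fold sq_alt_series sq_alt_series1 in H. evar_last.
    + apply (is_derive_pow sq_alt_series 2); exact H.
    + simpl; ring.
  - unfold dlc. field. apply sq_alt_series_neq_0.
Qed.

Lemma is_derive_beta : is_derive beta w (beta w * dlb w).
Proof.
  assert (H := is_derive_nome pronic_series w _ (PSeries_derive_1 _ pronic_radius _ (nome_abs w Hw))).
  fold pronic_series1 in H.
  assert (H1 : is_derive (fun w => exp (- w / 2)) w (- / 2 * exp (- w / 2))).
  { auto_derive; auto. unfold Rdiv; ring. }
  assert (H2 := is_derive_mult _ _ w _ _ H1 H Rmult_comm).
  assert (H3 := is_derive_pow _ 2 _ _ H2). simpl in H3.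
  evar_last; [exact H3|].
  unfold beta, th2, dlb. fold pronic_series. unfold plus, mult; simpl. field. apply pronic_series_neq_0.
Qed.

Lemma is_derive_dla : is_derive dla w (dla' w).
Proof.
  assert (H0 := PSeries_derive_1 _ sq_radius _ (nome_abs w Hw)).
  assert (H1 := PSeries_derive_1 _ (PS_derive_radius _ sq_radius) _ (nome_abs w Hw)).
  fold sq_series sq_series1 in H0. fold sq_series1 sq_series2 in H1.
  assert (H2 : is_derive (fun q : R => q) (exp (-2 * w)) 1) by (auto_derive; auto).
  assert (H3 := is_derive_mult _ _ _ _ _ H2 H1 Rmult_comm).
  assert (H4 := is_derive_div _ _ _ _ _ H3 H0 sq_series_neq_0).
  assert (H5 := is_derive_scal _ _ (-4) _ H4).
  apply is_derive_nome in H5.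
  apply (is_derive_ext (fun w => -4 * (mult (exp (-2 * w)) (sq_series1 (exp (-2 * w))) / sq_series (exp (-2 * w))))).
  - intros t; unfold dla, mult; simpl. unfold Rdiv; ring.
  - evar_last; [exact H5|]. unfold dla', plus, mult; simpl. field. apply sq_series_neq_0.
Qed.

End LogDerivatives.

Lemma is_derive_double (f : R -> R) w l : is_derive f (2 * w) l -> is_derive (fun w => f (2 * w)) w (2 * l).
Proof.
  intros H. apply (is_derive_comp f (fun w => 2 * w) w l 2 H). auto_derive; auto; ring.
Qed.

(** The identities hold only for positive arguments; a neighbourhood of [w] inside the half-line
    suffices to compare derivatives. *)
Lemma is_derive_unique_pos (f g : R -> R) w l m : 0 < w ->
  (forall v, 0 < v -> f v = g v) -> is_derive f w l -> is_derive g w m -> l = m.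
Proof.
  intros Hw E Hf Hg.
  assert (Hf' : is_derive g w l).
  { apply (is_derive_ext_loc f); auto.
    exists (mkposreal w Hw). intros v Hv. apply E.
    unfold ball in Hv; simpl in Hv; unfold AbsRing_ball, abs, minus, plus, opp in Hv; simpl in Hv.
    apply Rabs_def2 in Hv; lra. }
  rewrite <- (is_derive_unique _ _ _ Hf'), <- (is_derive_unique _ _ _ Hg); auto.
Qed.

(** The derivative of the arithmetic-mean relation; [dlc_double] is that of the geometric-mean
    relation [gamma_sq_double]. *)
Lemma dla_double w : 0 < w ->
  4 * (alpha (2 * w) * dla (2 * w)) = alpha w * dla w + gamma w * dlc w.
Proof.
  intros Hw.
  assert (H : 2 * (alpha (2 * w) * dla (2 * w)) = / 2 * (alpha w * dla w + gamma w * dlc w)); [|lra].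
  apply (is_derive_unique_pos (fun w => alpha (2 * w)) (fun w => / 2 * (alpha w + gamma w)) w); auto.
  - intros v Hv. rewrite (alpha_double v), (gamma_double v) by auto. field.
  - apply is_derive_double, is_derive_alpha; lra.
  - apply is_derive_scal. apply (is_derive_plus alpha gamma); [apply is_derive_alpha|apply is_derive_gamma]; auto.
Qed.

Lemma dlc_double w : 0 < w -> 4 * dlc (2 * w) = dla w + dlc w.
Proof.
  intros Hw.
  assert (H : 2 * (2 * (gamma (2 * w) * dlc (2 * w)) * gamma (2 * w)) =
     alpha w * dla w * gamma w + alpha w * (gamma w * dlc w)).
  { apply (is_derive_unique_pos (fun w => gamma (2 * w) ^ 2) (fun w => alpha w * gamma w) w); auto.
    - intros v Hv. apply gamma_sq_double; auto.
    - evar_last.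
      + apply (is_derive_pow (fun w => gamma (2 * w)) 2).
        apply is_derive_double, is_derive_gamma; lra.
      + simpl; ring.
    - apply (is_derive_mult alpha gamma); [apply is_derive_alpha|apply is_derive_gamma|apply Rmult_comm]; auto. }
  assert (A := alpha_pos w Hw). assert (C := gamma_pos w Hw).
  assert (E := gamma_sq_double w Hw).
  apply Rmult_eq_reg_l with (alpha w * gamma w); [|apply Rgt_not_eq, Rmult_lt_0_compat; auto].
  replace (2 * (2 * (gamma (2 * w) * dlc (2 * w)) * gamma (2 * w))) with
    (4 * gamma (2 * w) ^ 2 * dlc (2 * w)) in H by ring.
  rewrite E in H. lra.
Qed.

Lemma gamma_lt_alpha w : 0 < w -> gamma w < alpha w.
Proof.
  intros Hw. rewrite (gamma_double w), (alpha_double w) by auto.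
  assert (H := beta_pos (2 * w) ltac:(lra)). lra.
Qed.

Lemma beta_lt_alpha w : 0 < w -> beta w < alpha w.
Proof.
  intros Hw. assert (A := alpha_pos w Hw). assert (C := gamma_pos w Hw).
  assert (E := gamma_sq w Hw). assert (B := beta_pos w Hw). nra.
Qed.

(** The explicit factor [q] cancels the one in [dla], [dlc] and [dla'], so quotients by [beta^2]
    extend continuously to [q = 0]. *)
Lemma beta_sq_nome w : beta w ^ 2 = exp (- 2 * w) * pronic_series (exp (- 2 * w)) ^ 4.
Proof.
  unfold beta, th2. fold pronic_series.
  replace (exp (-2 * w)) with (exp (- w / 2) * exp (- w / 2) * (exp (- w / 2) * exp (- w / 2))) at 2
    by (rewrite <- !exp_plus; f_equal; field).
  ring.
Qed.

Lemma continuous_pow (f : R -> R) n x : continuous f x -> continuous (fun y => f y ^ n) x.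
Proof.
  intros H. apply (continuous_comp f (fun y => y ^ n)); auto.
  apply (ex_derive_continuous (fun y => y ^ n)). auto_derive; auto.
Qed.

Lemma continuous_div (f g : R -> R) x : g x <> 0 -> continuous f x -> continuous g x ->
  continuous (fun y => f y / g y) x.
Proof.
  intros Hg Hf Hc. apply (continuous_mult f (fun y => / g y)); auto.
  apply continuous_Rinv_comp; auto.
Qed.

Lemma continuous_Rscal (c : R) (f : R -> R) x : continuous f x -> continuous (fun y => c * f y) x.
Proof. apply (continuous_scal_r c f x). Qed.

Lemma continuous_Rmult (f g : R -> R) x : continuous f x -> continuous g x ->
  continuous (fun y => f y * g y) x.
Proof. apply (continuous_mult f g x). Qed.

Lemma cont_sq_series : continuous sq_series 0.
Proof. apply PSeries_cont_1; [apply sq_radius|apply Rabs_0_lt_1]. Qed.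
Lemma cont_sq_series1 : continuous sq_series1 0.
Proof. apply PSeries_cont_1; [apply PS_derive_radius, sq_radius|apply Rabs_0_lt_1]. Qed.
Lemma cont_sq_series2 : continuous sq_series2 0.
Proof. apply PSeries_cont_1; [apply PS_derive_radius, PS_derive_radius, sq_radius|apply Rabs_0_lt_1]. Qed.
Lemma cont_sq_alt_series : continuous sq_alt_series 0.
Proof. apply PSeries_cont_1; [apply sq_alt_radius|apply Rabs_0_lt_1]. Qed.
Lemma cont_sq_alt_series1 : continuous sq_alt_series1 0.
Proof. apply PSeries_cont_1; [apply PS_derive_radius, sq_alt_radius|apply Rabs_0_lt_1]. Qed.
Lemma cont_pronic_series : continuous pronic_series 0.
Proof. apply PSeries_cont_1; [apply pronic_radius|apply Rabs_0_lt_1]. Qed.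

Lemma is_lim_ext_pos (f g : R -> R) l : (forall w, 0 < w -> f w = g w) ->
  is_lim f p_infty l -> is_lim g p_infty l.
Proof. intros E. apply is_lim_ext_loc. exists 0; auto. Qed.

(* [(dla - dlc) / beta^2] is invariant under [w -> 2 w]. *)
Lemma dla_dlc w : 0 < w -> dla w - dlc w = - beta w ^ 2.
Proof.
  set (f := fun w => (dla w - dlc w) / beta w ^ 2 + 1).
  assert (Hf : forall w, 0 < w -> f w = 0).
  { apply doubling_zero.
    - intros v Hv. right; f_equal. unfold f.
      assert (A := dla_double v Hv). assert (C := dlc_double v Hv).
      assert (A1 := alpha_pos v Hv). assert (C1 := gamma_pos v Hv). assert (B1 := beta_pos v Hv).
      assert (L := gamma_lt_alpha v Hv).
      assert (E1 : alpha (2 * v) = (alpha v + gamma v) / 2)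
        by (rewrite (alpha_double v), (gamma_double v) by auto; field).
      assert (E2 : beta (2 * v) = (alpha v - gamma v) / 2)
        by (rewrite (alpha_double v), (gamma_double v) by auto; field).
      assert (E3 : beta v ^ 2 = (alpha v - gamma v) * (alpha v + gamma v))
        by (assert (E := gamma_sq v Hv); nra).
      assert (A' : dla (2 * v) = (alpha v * dla v + gamma v * dlc v) / (2 * (alpha v + gamma v))).
      { rewrite E1 in A. apply Rmult_eq_reg_l with (2 * (alpha v + gamma v)); [|lra].
        field_simplify; [|lra]. lra. }
      assert (C' : dlc (2 * v) = (dla v + dlc v) / 4) by lra.
      rewrite A', C', E2, E3. field. repeat split; lra.
    (* At [q = 0] the limit is [1 - 4 (2 + 2) / 2^4 = 0]. *)
    - apply (is_lim_ext_pos (fun w => (fun q => 1 - 4 * (sq_series1 q / sq_series q - sq_alt_series1 q / sq_alt_series q) / pronic_series q ^ 4) (exp (- 2 * w)))).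
      + intros v Hv. unfold f, dla, dlc. rewrite beta_sq_nome.
        assert (Hq := nome_bounds v Hv).
        field. repeat split;
          solve [apply pronic_series_neq_0; auto|apply sq_alt_series_neq_0; auto|apply sq_series_neq_0; auto|lra].
      + apply (is_lim_nome (fun q => 1 - 4 * (sq_series1 q / sq_series q - sq_alt_series1 q / sq_alt_series q) / pronic_series q ^ 4));
          [|rewrite sq_series1_0, sq_series_0, sq_alt_series1_0, sq_alt_series_0, pronic_series_0; field].
        assert (continuous (fun _ : R => 1) 0) by apply continuous_const.
        apply (continuous_minus (fun _ => 1)); auto.
        apply (continuous_div (fun q => 4 * (sq_series1 q / sq_series q - sq_alt_series1 q / sq_alt_series q)) (fun q => pronic_series q ^ 4)).
        * rewrite pronic_series_0; lra.
        * apply (continuous_Rscal 4). apply (continuous_minus (fun q => sq_series1 q / sq_series q)).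
          -- apply continuous_div; [rewrite sq_series_0; lra|apply cont_sq_series1|apply cont_sq_series].
          -- apply continuous_div; [rewrite sq_alt_series_0; lra|apply cont_sq_alt_series1|apply cont_sq_alt_series].
        * apply continuous_pow, cont_pronic_series. }
  intros Hw. specialize (Hf w Hw). unfold f in Hf. assert (B := beta_pos w Hw).
  assert (Hd : (dla w - dlc w) / beta w ^ 2 = -1) by lra.
  apply Rmult_eq_reg_r with (/ beta w ^ 2); [|apply Rinv_neq_0_compat, Rgt_not_eq, pow_lt; auto].
  change ((dla w - dlc w) / beta w ^ 2 = - beta w ^ 2 / beta w ^ 2). rewrite Hd. field. lra.
Qed.

(** Differentiate [beta^2 = alpha^2 - gamma^2] and eliminate [dlc] by [dla_dlc]. *)
Lemma dlb_dla w : 0 < w -> dlb w - dla w = - gamma w ^ 2.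
Proof.
  intros Hw.
  assert (A := alpha_pos w Hw). assert (C := gamma_pos w Hw). assert (B := beta_pos w Hw).
  assert (H : 2 * (beta w * dlb w) * beta w = 2 * (alpha w * dla w) * alpha w - 2 * (gamma w * dlc w) * gamma w).
  { apply (is_derive_unique_pos (fun w => beta w ^ 2) (fun w => alpha w ^ 2 - gamma w ^ 2) w); auto.
    - intros v Hv; rewrite gamma_sq by auto; ring.
    - evar_last; [apply (is_derive_pow beta 2), is_derive_beta; auto|simpl; ring].
    - apply (is_derive_minus (fun w => alpha w ^ 2) (fun w => gamma w ^ 2)).
      + evar_last; [apply (is_derive_pow alpha 2), is_derive_alpha; auto|simpl; ring].
      + evar_last; [apply (is_derive_pow gamma 2), is_derive_gamma; auto|simpl; ring]. }
  assert (E := gamma_sq w Hw). assert (D := dla_dlc w Hw).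
  apply Rmult_eq_reg_l with (beta w ^ 2); [|apply Rgt_not_eq, pow_lt; auto].
  replace (dlc w) with (dla w + beta w ^ 2) in H by lra.
  replace (beta w ^ 2 * (dlb w - dla w)) with (beta w * dlb w * beta w - beta w ^ 2 * dla w) by ring.
  replace (beta w * dlb w * beta w) with (alpha w * dla w * alpha w - gamma w * (dla w + beta w ^ 2) * gamma w) by lra.
  replace (gamma w * (dla w + beta w ^ 2) * gamma w) with (gamma w ^ 2 * dla w + gamma w ^ 2 * beta w ^ 2) by ring.
  replace (alpha w * dla w * alpha w) with (alpha w ^ 2 * dla w) by ring.
  replace (alpha w ^ 2) with (gamma w ^ 2 + beta w ^ 2) by lra. ring.
Qed.

Lemma is_derive_dlc w : 0 < w ->
  is_derive dlc w (dla' w + 2 * beta w ^ 2 * (dla w - gamma w ^ 2)).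
Proof.
  intros Hw. apply (is_derive_ext_loc (fun w => dla w + beta w ^ 2)).
  - exists (mkposreal w Hw). intros v Hv.
    unfold ball in Hv; simpl in Hv; unfold AbsRing_ball, abs, minus, plus, opp in Hv; simpl in Hv.
    apply Rabs_def2 in Hv. assert (D := dla_dlc v ltac:(lra)). lra.
  - apply (is_derive_plus dla); [apply is_derive_dla; auto|].
    evar_last; [apply (is_derive_pow beta 2), is_derive_beta; auto|].
    replace (dlb w) with (dla w - gamma w ^ 2) by (assert (D := dlb_dla w Hw); lra).
    simpl; ring.
Qed.

(* The defect [E] of the Riccati equation satisfies [E (w) = 4 E (2 w)] and is [o (beta^2)]. *)
Lemma dla_riccati w : 0 < w -> dla' w = dla w ^ 2 + beta w ^ 2 * gamma w ^ 2.
Proof.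
  set (E := fun w => dla' w - dla w ^ 2 - beta w ^ 2 * gamma w ^ 2).
  assert (HE : forall v, 0 < v -> E v = 4 * E (2 * v)).
  { intros v Hv. assert (Hv2 : 0 < 2 * v) by lra.
    (* The derivative of the relation [dlc_double], with the derivative of [dlc] expressed through
       [dla']. *)
    assert (H : 4 * (2 * (dla' (2 * v) + 2 * beta (2 * v) ^ 2 * (dla (2 * v) - gamma (2 * v) ^ 2)))
       = dla' v + (dla' v + 2 * beta v ^ 2 * (dla v - gamma v ^ 2))).
    { apply (is_derive_unique_pos (fun w => 4 * dlc (2 * w)) (fun w => dla w + dlc w) v); auto.
      - intros; apply dlc_double; auto.
      - apply is_derive_scal, is_derive_double, is_derive_dlc; auto.
      - apply (is_derive_plus dla dlc); [apply is_derive_dla|apply is_derive_dlc]; auto. }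
    assert (C := dlc_double v Hv). assert (D := dla_dlc v Hv). assert (D2 := dla_dlc (2 * v) Hv2).
    assert (E1 := gamma_sq v Hv). assert (E2 := gamma_sq (2 * v) Hv2).
    assert (E3 := beta_sq_double v Hv).
    unfold E.
    set (P := dla v) in *. set (P2 := dla (2 * v)) in *. set (Q := dlc v) in *. set (Q2 := dlc (2 * v)) in *.
    set (x := beta v ^ 2) in *. set (x2 := beta (2 * v) ^ 2) in *.
    assert (HQ : Q = P + x) by lra. assert (HQ2 : Q2 = P2 + x2) by lra.
    assert (HP2 : P2 = (2 * P + x) / 4 - x2) by lra.
    assert (E4 : alpha (2 * v) ^ 2 * x2 = x ^ 2 / 16).
    { unfold x2.
      assert (Ex : x = 4 * (alpha (2 * v) * beta (2 * v))) by exact E3. rewrite Ex.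
      change (alpha (2 * v) ^ 2 * beta (2 * v) ^ 2 = (4 * (alpha (2 * v) * beta (2 * v))) ^ 2 / 16). field. }
    rewrite E2 in *. set (y2 := alpha (2 * v) ^ 2) in *.
    rewrite HP2 in *. 
    assert (E5 : dla' (2 * v) = (2 * dla' v + 2 * x * (P - gamma v ^ 2)) / 8 - 2 * x2 * ((2 * P + x) / 4 - x2 - (y2 - x2))) by lra.
    rewrite E5.
    assert (E6 : y2 * x2 = x ^ 2 / 16) by exact E4.
    nra. }
  set (f := fun w => E w / beta w ^ 2).
  assert (Hf : forall w, 0 < w -> f w = 0).
  { apply doubling_zero.
    - intros v Hv. unfold f. rewrite HE by auto.
      assert (B := beta_pos (2 * v) ltac:(lra)). assert (A := alpha_pos (2 * v) ltac:(lra)).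
      assert (L := beta_lt_alpha (2 * v) ltac:(lra)).
      rewrite beta_sq_double by auto.
      (* The extra factor [beta / alpha] is below 1, which is all that [doubling_zero] requires. *)
      replace (4 * E (2 * v) / (4 * (alpha (2 * v) * beta (2 * v)))) with
        (E (2 * v) / beta (2 * v) ^ 2 * (beta (2 * v) / alpha (2 * v))) by (field; lra).
      rewrite Rabs_mult. rewrite <- (Rmult_1_r (Rabs (E (2 * v) / beta (2 * v) ^ 2))) at 2.
      apply Rmult_le_compat_l; [apply Rabs_pos|].
      rewrite Rabs_pos_eq by (apply Rdiv_le_0_compat; lra).
      apply (Rdiv_le_1 (beta (2 * v))); lra.
    (* At [q = 0] the limit is [8 * 2 / 2^4 - 0 - 1 = 0]. *)
    - apply (is_lim_ext_pos (fun w => (fun q => 8 * ((sq_series1 q + q * sq_series2 q) / sq_series q - q * (sq_series1 q / sq_series q) ^ 2) / pronic_series q ^ 4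
          - 16 * q * (sq_series1 q / sq_series q) ^ 2 / pronic_series q ^ 4 - sq_alt_series q ^ 4) (exp (- 2 * w)))).
      + intros v Hv. unfold f, E. rewrite (beta_sq_nome v). unfold dla, dla', gamma, th4. fold sq_alt_series.
        assert (Hq := nome_bounds v Hv).
        field. repeat split; solve [apply pronic_series_neq_0; auto|apply sq_series_neq_0; auto|lra].
      + apply (is_lim_nome (fun q => 8 * ((sq_series1 q + q * sq_series2 q) / sq_series q - q * (sq_series1 q / sq_series q) ^ 2) / pronic_series q ^ 4
          - 16 * q * (sq_series1 q / sq_series q) ^ 2 / pronic_series q ^ 4 - sq_alt_series q ^ 4)); [|rewrite sq_series1_0, sq_series_0, sq_alt_series_0, pronic_series_0; field].
        assert (Hid : continuous (fun q : R => q) 0) by apply continuous_id.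
        assert (Hr : continuous (fun q => sq_series1 q / sq_series q) 0)
          by (apply continuous_div; [rewrite sq_series_0; lra|apply cont_sq_series1|apply cont_sq_series]).
        assert (Hp4 : continuous (fun q => pronic_series q ^ 4) 0) by apply continuous_pow, cont_pronic_series.
        assert (Hp0 : pronic_series 0 ^ 4 <> 0) by (rewrite pronic_series_0; lra).
        apply (continuous_minus (fun q => 8 * ((sq_series1 q + q * sq_series2 q) / sq_series q - q * (sq_series1 q / sq_series q) ^ 2) / pronic_series q ^ 4
          - 16 * q * (sq_series1 q / sq_series q) ^ 2 / pronic_series q ^ 4)); [|apply continuous_pow, cont_sq_alt_series].
        apply (continuous_minus (fun q => 8 * ((sq_series1 q + q * sq_series2 q) / sq_series q - q * (sq_series1 q / sq_series q) ^ 2) / pronic_series q ^ 4)).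
        * apply (continuous_div (fun q => 8 * ((sq_series1 q + q * sq_series2 q) / sq_series q - q * (sq_series1 q / sq_series q) ^ 2))); auto.
          apply (continuous_Rscal 8).
          apply (continuous_minus (fun q => (sq_series1 q + q * sq_series2 q) / sq_series q)).
          -- apply continuous_div; [rewrite sq_series_0; lra| |apply cont_sq_series].
             apply (continuous_plus sq_series1); [apply cont_sq_series1|].
             apply (continuous_Rmult (fun q => q) sq_series2); auto. apply cont_sq_series2.
          -- apply (continuous_Rmult (fun q => q)); auto. apply continuous_pow; auto.
        * apply (continuous_div (fun q => 16 * q * (sq_series1 q / sq_series q) ^ 2)); auto.
          apply (continuous_Rmult (fun q => 16 * q)); [apply (continuous_Rscal 16); auto|].
          apply continuous_pow; auto. }
  intros Hw. specialize (Hf w Hw). unfold f in Hf. assert (B := beta_pos w Hw).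
  assert (E w = 0).
  { replace (E w) with (E w / beta w ^ 2 * beta w ^ 2) by (field; lra). rewrite Hf; ring. }
  unfold E in H. lra.
Qed.

(** * Asymptotics of the [sech] sums and the two squares theorem *)

Lemma sech_ge_exp x : exp (- Rabs x) <= sech x.
Proof.
  assert (H : forall y, 0 <= y -> exp (- y) <= sech y).
  { intros y Hy. unfold sech, cosh. rewrite exp_Ropp. apply Rinv_le_contravar.
    - assert (A := exp_pos y). assert (B := Rinv_0_lt_compat _ A). lra.
    - assert (A := exp_ineq1_le y).
      assert (/ exp y <= 1). { rewrite <- Rinv_1. apply Rinv_le_contravar; lra. } lra. }
  unfold Rabs; destruct (Rcase_abs x); [|apply H; lra].
  rewrite <- sech_even. apply H; lra.
Qed.

(** The weight [i^2 - 1] vanishes at [i = 1] and [i = -1] and is at least 1 at the other odd [i], so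
    one quantity controls the tails of both [sech_sum 1] and [sech_mom 1]. *)
Definition sech_tail (w : R) : R := sech_mom 1 w - sech_sum 1 w.

Lemma sech_tail_nnsum w : 0 < w ->
  nnsum (fun k => (IZR (2 * k + 1) ^ 2 - 1) * sech (IZR (2 * k + 1) * w)) (sech_tail w).
Proof.
  intros Hw. refine (nnsum_minus _ _ _ _ _ _ (sech_sum_correct w 1 Hw ltac:(lia))).
  - intros k. apply Rmult_le_pos; [|apply Rlt_le, sech_pos].
    assert (1 <= IZR (2 * k + 1) ^ 2); [|lra].
    replace (IZR (2 * k + 1) ^ 2) with (IZR ((2 * k + 1) * (2 * k + 1))) by (rewrite mult_IZR; ring).
    apply IZR_le; nia.
  - assert (H := sech_mom_correct w 1 Hw ltac:(lia)). revert H; apply nnsum_ext; intros; ring.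
Qed.

(** Only [|i| >= 3] contributes, so each term decays by [exp (- 3 (w - 1))] relative to [w = 1]. The
    factor 2 is the gap between the upper bound [2 exp (- |x|)] and the lower bound [exp (- |x|)]
    for [sech x]. *)
Lemma sech_tail_le w : 1 <= w -> sech_tail w <= 2 * exp (- (3 * (w - 1))) * sech_tail 1.
Proof.
  intros Hw.
  refine (nnsum_le _ _ _ _ _ (sech_tail_nnsum w ltac:(lra))
    (nnsum_scal (2 * exp (- (3 * (w - 1)))) _ _ ltac:(assert (A := exp_pos (- (3 * (w - 1)))); lra)
      (sech_tail_nnsum 1 ltac:(lra)))).
  intros k; cbv beta.
  set (i := (2 * k + 1)%Z).
  destruct (Z.eq_dec (Z.abs i) 1) as [E|E].
  - assert (IZR i ^ 2 = 1).
    { rewrite <- pow2_abs, <- abs_IZR, E; ring. }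
    rewrite H; right; ring.
  - assert (Hi : (3 <= Z.abs i)%Z) by (unfold i in *; lia).
    apply IZR_le in Hi. rewrite abs_IZR in Hi.
    assert (0 <= IZR i ^ 2 - 1).
    { rewrite <- pow2_abs. nra. }
    replace (2 * exp (- (3 * (w - 1))) * ((IZR i ^ 2 - 1) * sech (IZR i * 1)))
      with ((IZR i ^ 2 - 1) * (2 * exp (- (3 * (w - 1))) * sech (IZR i * 1))) by ring.
    apply Rmult_le_compat_l; auto.
    eapply Rle_trans; [apply sech_le_exp|].
    rewrite Rmult_assoc. apply Rmult_le_compat_l; [lra|].
    apply Rle_trans with (exp (- (3 * (w - 1))) * exp (- Rabs (IZR i * 1))).
    + rewrite <- exp_plus. apply exp_mono. rewrite !Rabs_mult, Rabs_R1, (Rabs_pos_eq w) by lra. nra.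
    + apply Rmult_le_compat_l; [apply Rlt_le, exp_pos|]. apply sech_ge_exp.
Qed.

Lemma sech_tail_nonneg w : 0 < w -> 0 <= sech_tail w.
Proof. intros; eapply nnsum_nonneg, sech_tail_nnsum; auto. Qed.

Lemma odd_sym_sech w k : sech (IZR (2 * (- k - 1) + 1) * w) = sech (IZR (2 * k + 1) * w).
Proof.
  replace (2 * (- k - 1) + 1)%Z with (- (2 * k + 1))%Z by lia.
  rewrite opp_IZR, <- Ropp_mult_distr_l, sech_even; auto.
Qed.

Lemma sech_sum_odd_half w : 0 < w -> nnsum (fun n => sech ((2 * INR n + 1) * w)) (sech_sum 1 w / 2).
Proof.
  intros Hw. assert (H := nnsum_Z_odd_sym _ _ (odd_sym_sech w) (sech_sum_correct w 1 Hw ltac:(lia))).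
  revert H; apply nnsum_ext; intros n. rewrite plus_IZR, mult_IZR, INR_IZR_INZ; auto.
Qed.

Lemma sech_sum_odd_bounds w : 0 < w ->
  2 * sech w <= sech_sum 1 w <= 2 * sech w + sech_tail w.
Proof.
  intros Hw. assert (H1 := sech_sum_odd_half w Hw).
  split.
  - assert (A := nnsum_ge _ _ 0%nat H1). simpl in A.
    replace ((2 * 0 + 1) * w) with w in A by ring. lra.
  - assert (H2 : nnsum (fun n => ((2 * INR n + 1) ^ 2 - 1) * sech ((2 * INR n + 1) * w)) (sech_tail w / 2)).
    { assert (H := nnsum_Z_odd_sym (fun k => (IZR (2 * k + 1) ^ 2 - 1) * sech (IZR (2 * k + 1) * w)) _
        ltac:(intros k; cbv beta; rewrite odd_sym_sech; replace (2 * (- k - 1) + 1)%Z with (- (2 * k + 1))%Z by lia;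
          rewrite opp_IZR; ring) (sech_tail_nnsum w Hw)).
      revert H; apply nnsum_ext; intros n. rewrite plus_IZR, mult_IZR, INR_IZR_INZ; auto. }
    assert (H3 := proj2 (nnsum_split1 (fun n => sech ((2 * INR n + 1) * w)) 0%nat (sech_sum 1 w / 2 - sech w)
      (proj1 H1))).
    cbv beta in H3. simpl INR in H3. replace ((2 * 0 + 1) * w) with w in H3 by ring.
    replace (sech w + (sech_sum 1 w / 2 - sech w)) with (sech_sum 1 w / 2) in H3 by ring.
    specialize (H3 H1).
    assert (sech_sum 1 w / 2 - sech w <= sech_tail w / 2); [|lra].
    refine (nnsum_le _ _ _ _ _ H3 H2). intros n; cbv beta.
    destruct (eqc 0%nat n) as [<-|Hn].
    + simpl; right; ring.
    + assert (1 <= INR n) by (apply (le_INR 1); lia).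
      assert (A := sech_pos ((2 * INR n + 1) * w)).
      rewrite <- (Rmult_1_l (sech _)) at 1. apply Rmult_le_compat_r; nra.
Qed.

Lemma sech_sum_ge_1 w : 0 < w -> 1 <= sech_sum 0 w.
Proof.
  intros Hw. assert (A := nnsum_ge _ _ 0%Z (sech_sum_correct w 0 Hw ltac:(lia))).
  simpl in A. rewrite Rmult_0_l in A. unfold sech in A. rewrite cosh_0, Rinv_1 in A. auto.
Qed.

Lemma sech_sum_even_le w : 0 < w -> sech_sum 0 w <= 1 + sech_mom 0 w.
Proof.
  intros Hw. assert (H1 := sech_sum_correct w 0 Hw ltac:(lia)).
  assert (H3 := proj2 (nnsum_split1 _ 0%Z (sech_sum 0 w - 1) (proj1 H1))).
  cbv beta in H3. simpl Z.mul in H3. simpl Z.add in H3.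
  rewrite Rmult_0_l in H3. unfold sech at 2 in H3. rewrite cosh_0, Rinv_1 in H3.
  replace (1 + (sech_sum 0 w - 1)) with (sech_sum 0 w) in H3 by ring. specialize (H3 H1).
  assert (sech_sum 0 w - 1 <= sech_mom 0 w); [|lra].
  refine (nnsum_le _ _ _ _ _ H3 (sech_mom_correct w 0 Hw ltac:(lia))).
  intros n; cbv beta. assert (A := sech_pos (IZR (2 * n + 0) * w)).
  destruct (eqc 0%Z n) as [E|Hn].
  - apply Rmult_le_pos; [apply pow2_ge_0|lra].
  - rewrite <- (Rmult_1_l (sech _)) at 1. apply Rmult_le_compat_r; [lra|].
    replace (IZR (2 * n + 0) ^ 2) with (IZR ((2 * n + 0) * (2 * n + 0))) by (rewrite mult_IZR; ring).
    apply IZR_le; nia.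
Qed.

Lemma is_lim_squeeze_pos (f g h : R -> R) l : (forall w, 1 <= w -> f w <= g w <= h w) ->
  is_lim f p_infty l -> is_lim h p_infty l -> is_lim g p_infty l.
Proof.
  intros H Hf Hh. apply (is_lim_le_le_loc f h); auto. exists 1. intros w Hw; apply H; lra.
Qed.

Lemma is_lim_mult_fin (f g : R -> R) x (l m : R) : is_lim f x l -> is_lim g x m ->
  is_lim (fun y => f y * g y) x (l * m).
Proof. intros Hf Hg. exact (is_lim_mult f g x l m Hf Hg Logic.I). Qed.

Lemma is_lim_div_fin (f g : R -> R) x (l m : R) : is_lim f x l -> is_lim g x m -> m <> 0 ->
  is_lim (fun y => f y / g y) x (l / m).
Proof.
  intros Hf Hg Hm. apply is_lim_mult_fin; auto.
  apply (is_lim_inv g x m Hg). intros E; injection E; auto.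
Qed.

Lemma sech_sum_odd_lim : is_lim (fun w => sech_sum 1 w * exp w) p_infty 4.
Proof.
  assert (HE : forall w, 2 * sech w * exp w = 4 / (1 + exp (- 2 * w))).
  { intros w. unfold sech, cosh. replace (-2 * w) with (- w + - w) by ring.
    rewrite exp_plus, exp_Ropp. assert (A := exp_pos w). field. split; nra. }
  assert (Hid : continuous (fun q : R => q) 0) by apply continuous_id.
  assert (H1c : continuous (fun _ : R => 1) 0) by apply continuous_const.
  assert (H4c : continuous (fun _ : R => 4) 0) by apply continuous_const.
  assert (HF : continuous (fun q => 4 / (1 + q)) 0).
  { apply (continuous_div (fun _ => 4)); auto; [lra|]. apply (continuous_plus (fun _ => 1)); auto. }
  set (C := 2 * exp 3 * sech_tail 1).
  apply (is_lim_squeeze_pos (fun w => 4 / (1 + exp (- 2 * w))) _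
     (fun w => 4 / (1 + exp (- 2 * w)) + C * exp (- 2 * w))).
  - intros w Hw. assert (B := sech_sum_odd_bounds w ltac:(lra)). assert (T := sech_tail_le w Hw).
    rewrite <- HE. assert (A := exp_pos w). split; [nra|].
    apply Rle_trans with ((2 * sech w + 2 * exp (- (3 * (w - 1))) * sech_tail 1) * exp w); [nra|].
    right. unfold C. replace (exp (- 2 * w)) with (exp (- (3 * (w - 1))) * exp w * / exp 3).
    + field. apply Rgt_not_eq, exp_pos.
    + rewrite <- exp_Ropp, <- !exp_plus. f_equal; ring.
  - apply (is_lim_nome (fun q => 4 / (1 + q))); auto. field.
  - apply (is_lim_nome (fun q => 4 / (1 + q) + C * q)); [|field].
    apply (continuous_plus (fun q => 4 / (1 + q))); auto. apply continuous_Rscal; auto.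
Qed.

Lemma sech_mom_odd_lim : is_lim (fun w => sech_mom 1 w * exp w) p_infty 4.
Proof.
  set (C := 2 * exp 3 * sech_tail 1).
  apply (is_lim_squeeze_pos (fun w => sech_sum 1 w * exp w) _
     (fun w => sech_sum 1 w * exp w + C * exp (- 2 * w))).
  - intros w Hw. assert (B := sech_tail_nonneg w ltac:(lra)). assert (T := sech_tail_le w Hw).
    unfold sech_tail in B, T at 1. assert (A := exp_pos w). split; [nra|].
    apply Rle_trans with ((sech_sum 1 w + 2 * exp (- (3 * (w - 1))) * sech_tail 1) * exp w); [nra|].
    right. unfold C. replace (exp (- 2 * w)) with (exp (- (3 * (w - 1))) * exp w * / exp 3).
    + field. apply Rgt_not_eq, exp_pos.
    + rewrite <- exp_Ropp, <- !exp_plus. f_equal; ring.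
  - apply sech_sum_odd_lim.
  - replace (Finite 4) with (Finite (4 + 0)) by (f_equal; ring).
    apply (is_lim_plus' _ _ p_infty); [apply sech_sum_odd_lim|].
    apply (is_lim_nome (fun q => C * q)); [|ring].
    apply continuous_Rscal, continuous_id.
Qed.

(** The even class needs no tail estimate of its own: [sech_sum 0 - 1] is at most [sech_mom 0],
    which is at most [sech_sum 0 * sech_mom 0 = sech_sum 1 * sech_mom 1], of order [exp (- 2 w)]. *)
Lemma sech_sum_even_lim : is_lim (sech_sum 0) p_infty 1.
Proof.
  apply (is_lim_squeeze_pos (fun _ => 1) _
    (fun w => 1 + (sech_sum 1 w * exp w) * (sech_mom 1 w * exp w) * exp (- 2 * w))).
  - intros w Hw. assert (A := sech_sum_ge_1 w ltac:(lra)). assert (B := sech_sum_even_le w ltac:(lra)).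
    assert (C := sech_mom_even_odd w ltac:(lra)). split; auto.
    assert (M : 0 <= sech_mom 0 w) by (eapply nnsum_nonneg, (sech_mom_correct w 0); [lra|lia]).
    replace (exp (- 2 * w)) with (/ exp w * / exp w)
      by (rewrite <- !exp_Ropp, <- exp_plus; f_equal; ring).
    assert (E := exp_pos w).
    replace (sech_sum 1 w * exp w * (sech_mom 1 w * exp w) * (/ exp w * / exp w))
      with (sech_sum 1 w * sech_mom 1 w) by (field; lra). nra.
  - apply is_lim_const.
  - replace (Finite 1) with (Finite (1 + 4 * 4 * 0)) by (f_equal; ring).
    apply (is_lim_plus' _ _ p_infty); [apply is_lim_const|].
    apply (is_lim_mult_fin _ _ p_infty).
    + apply (is_lim_mult_fin _ _ p_infty); [apply sech_sum_odd_lim|apply sech_mom_odd_lim].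
    + apply (is_lim_nome (fun q => q)); auto. apply continuous_id.
Qed.

Lemma beta_lim : is_lim (fun w => beta w * exp w) p_infty 4.
Proof.
  apply (is_lim_ext_pos (fun w => pronic_series (exp (- 2 * w)) ^ 2)).
  - intros w Hw. unfold beta, th2. fold pronic_series.
    replace (exp w) with (/ exp (- w / 2) ^ 2).
    + field. apply Rgt_not_eq, exp_pos.
    + rewrite pow_exp, <- exp_Ropp. f_equal. simpl; field.
  - apply (is_lim_nome (fun q => pronic_series q ^ 2)); [apply continuous_pow, cont_pronic_series|]. rewrite pronic_series_0; ring.
Qed.

Lemma sech_sum_odd_pos w : 0 < w -> 0 < sech_sum 1 w.
Proof.
  intros Hw. assert (H := sech_sum_odd_bounds w Hw). assert (A := sech_pos w). lra.
Qed.

(** The logarithms on the left differ by [D - 2 D'], where [D] and [D'] are the increments of [ln t]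
    and [ln (1 + t)] between the two points; for [y <= x] monotonicity gives [0 <= D' <= D]. *)
Lemma landen_contraction x y : 0 < x -> 0 < y ->
  Rabs (ln (4 * x / (1 + x) ^ 2) - ln (4 * y / (1 + y) ^ 2)) <= Rabs (ln x - ln y).
Proof.
  assert (H : forall x y, 0 < y -> y <= x ->
    Rabs (ln (4 * x / (1 + x) ^ 2) - ln (4 * y / (1 + y) ^ 2)) <= ln x - ln y).
  { clear. intros x y Hy Hyx.
    assert (E : forall t, 0 < t -> ln (4 * t / (1 + t) ^ 2) = ln 4 + ln t - 2 * ln (1 + t)).
    { intros t Ht. unfold Rdiv. rewrite ln_mult, ln_mult, ln_Rinv, <- Rpower_pow, ln_Rpower; try lra.
      - simpl; ring.
      - apply pow_lt; lra.
      - apply Rinv_0_lt_compat, pow_lt; lra. }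
    rewrite !E by lra.
    assert (A : ln y <= ln x) by (apply ln_le; lra).
    assert (B : ln (1 + y) <= ln (1 + x)) by (apply ln_le; lra).
    assert (C : ln (1 + x) - ln (1 + y) <= ln x - ln y).
    { assert (D : ln ((1 + x) * y) <= ln (x * (1 + y))) by (apply ln_le; nra).
      rewrite !ln_mult in D by lra. lra. }
    apply Rabs_le; lra. }
  intros Hx Hy. destruct (Rle_dec y x) as [Hyx|Hyx].
  - rewrite (Rabs_pos_eq (ln x - ln y)); [apply H; auto|]. assert (A : ln y <= ln x) by (apply ln_le; lra). lra.
  - rewrite Rabs_minus_sym, (Rabs_minus_sym (ln x)).
    rewrite (Rabs_pos_eq (ln y - ln x)); [apply H; lra|]. assert (A : ln x <= ln y) by (apply ln_le; lra). lra.
Qed.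

(* Both moduli satisfy Landen's recursion [r (w)^2 = 4 r (2w) / (1 + r (2w))^2] and are asymptotic to [4 exp (- w)]. *)
Lemma theta_sech_modulus w : 0 < w -> beta w / alpha w = sech_sum 1 w / sech_sum 0 w.
Proof.
  set (f := fun w => ln (beta w / alpha w) - ln (sech_sum 1 w / sech_sum 0 w)).
  assert (Hpos : forall w, 0 < w -> 0 < alpha w /\ 0 < beta w /\ 0 < sech_sum 0 w /\ 0 < sech_sum 1 w).
  { intros v Hv. assert (A := sech_sum_ge_1 v Hv).
    repeat split; [apply alpha_pos|apply beta_pos|lra|apply sech_sum_odd_pos]; auto. }
  assert (Hf : forall w, 0 < w -> f w = 0).
  { apply doubling_zero.
    - intros v Hv. assert (Hv2 : 0 < 2 * v) by lra.
      destruct (Hpos v Hv) as [A1 [A2 [A3 A4]]]. destruct (Hpos _ Hv2) as [B1 [B2 [B3 B4]]].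
      set (x := beta (2 * v) / alpha (2 * v)). set (y := sech_sum 1 (2 * v) / sech_sum 0 (2 * v)).
      assert (Hx : 0 < x) by (apply Rdiv_lt_0_compat; auto).
      assert (Hy : 0 < y) by (apply Rdiv_lt_0_compat; auto).
      assert (E1 : (beta v / alpha v) ^ 2 = 4 * x / (1 + x) ^ 2).
      { unfold Rdiv at 1. rewrite Rpow_mult_distr, beta_sq_double, (alpha_double v) by auto.
        unfold x. field. split; lra. }
      assert (E2 : (sech_sum 1 v / sech_sum 0 v) ^ 2 = 4 * y / (1 + y) ^ 2).
      { unfold Rdiv at 1. rewrite Rpow_mult_distr, sech_sum_odd_sq, (sech_sum_even_split v) by auto.
        unfold y. field. split; lra. }
      assert (HL := landen_contraction x y Hx Hy).
      (* Landen's recursion yields the square of the modulus at [v], so the difference of logarithms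
         at [v] is at most half of that at [2 v]. *)
      rewrite <- E1, <- E2 in HL.
      rewrite <- !Rpower_pow, !ln_Rpower in HL; try (apply Rdiv_lt_0_compat; auto).
      unfold f. fold x y. set (u := ln (beta v / alpha v)) in *.
      set (z := ln (sech_sum 1 v / sech_sum 0 v)) in *.
      replace (INR 2 * u - INR 2 * z) with (2 * (u - z)) in HL by (simpl; ring).
      rewrite Rabs_mult, (Rabs_pos_eq 2) in HL by lra.
      assert (C := Rabs_pos (u - z)). lra.
    - apply (is_lim_ext_pos (fun w => ln (beta w * exp w / alpha w) - ln (sech_sum 1 w * exp w / sech_sum 0 w))).
      + intros v Hv. destruct (Hpos v Hv) as [A1 [A2 [A3 A4]]]. assert (E := exp_pos v). unfold f.
        replace (beta v * exp v / alpha v) with (beta v / alpha v * exp v) by (field; lra).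
        replace (sech_sum 1 v * exp v / sech_sum 0 v) with (sech_sum 1 v / sech_sum 0 v * exp v) by (field; lra).
        rewrite !ln_mult by (auto; apply Rdiv_lt_0_compat; auto). ring.
      + replace (Finite 0) with (Finite (ln (4 / 1) - ln (4 / 1))) by (f_equal; ring).
        apply (is_lim_minus' _ _ p_infty).
        * apply (is_lim_comp_continuous (fun w => beta w * exp w / alpha w) ln).
          -- apply (is_lim_div_fin _ _ p_infty); [apply beta_lim|apply alpha_lim|lra].
          -- apply continuity_pt_filterlim, derivable_continuous_pt. eexists; apply derivable_pt_lim_ln; lra.
        * apply (is_lim_comp_continuous (fun w => sech_sum 1 w * exp w / sech_sum 0 w) ln).
          -- apply (is_lim_div_fin _ _ p_infty); [apply sech_sum_odd_lim|apply sech_sum_even_lim|lra].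
          -- apply continuity_pt_filterlim, derivable_continuous_pt. eexists; apply derivable_pt_lim_ln; lra. }
  intros Hw. specialize (Hf w Hw). unfold f in Hf. destruct (Hpos w Hw) as [A1 [A2 [A3 A4]]].
  apply ln_inv; try (apply Rdiv_lt_0_compat; auto). lra.
Qed.

(** With equal moduli, both sides are multiplied by [1 + beta (2 w) / alpha (2 w)] in passing from
    [2 w] to [w], so their quotient is constant along doubling and tends to 1. In terms of [q] this
    is Jacobi's two squares theorem. *)
Lemma sech_sum_even_eq w : 0 < w -> sech_sum 0 w = alpha w.
Proof.
  set (f := fun w => alpha w / sech_sum 0 w - 1).
  assert (Hpos : forall w, 0 < w -> 0 < alpha w /\ 0 < sech_sum 0 w).
  { intros v Hv. assert (A := sech_sum_ge_1 v Hv). split; [apply alpha_pos; auto|lra]. }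
  assert (Hf : forall w, 0 < w -> f w = 0).
  { apply doubling_zero.
    - intros v Hv. assert (Hv2 : 0 < 2 * v) by lra. right; f_equal. unfold f.
      destruct (Hpos _ Hv) as [A1 A2]. destruct (Hpos _ Hv2) as [B1 B2].
      assert (M := theta_sech_modulus (2 * v) Hv2).
      assert (Eb : beta (2 * v) = alpha (2 * v) * (sech_sum 1 (2 * v) / sech_sum 0 (2 * v)))
        by (rewrite <- M; field; lra).
      assert (S1 := sech_sum_odd_pos _ Hv2).
      rewrite (alpha_double v), (sech_sum_even_split v), Eb by auto. field. split; lra.
    - replace (Finite 0) with (Finite (1 / 1 - 1)) by (f_equal; field).
      apply (is_lim_minus' _ _ p_infty); [|apply is_lim_const].
      apply (is_lim_div_fin _ _ p_infty); [apply alpha_lim|apply sech_sum_even_lim|lra]. }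
  intros Hw. specialize (Hf w Hw). unfold f in Hf. destruct (Hpos w Hw) as [A1 A2].
  assert (E : alpha w / sech_sum 0 w = 1) by lra.
  apply (f_equal (fun x => x * sech_sum 0 w)) in E. field_simplify in E; lra.
Qed.

Lemma sech_sum_odd_eq w : 0 < w -> sech_sum 1 w = beta w.
Proof.
  intros Hw. assert (M := theta_sech_modulus w Hw). rewrite sech_sum_even_eq in M by auto.
  assert (A := alpha_pos w Hw).
  apply (f_equal (fun x => x * alpha w)) in M. field_simplify in M; lra.
Qed.

Lemma sech_alt_eq w : 0 < w -> sech_alt w = gamma w.
Proof.
  intros Hw. unfold sech_alt. rewrite sech_sum_even_eq, sech_sum_odd_eq, gamma_double by lra. auto.
Qed.

(** Doubling invariance of the quotient follows from [sech_mom_double] once the even moments are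
    eliminated by [sech_mom_even_odd]; numerator and denominator both behave like [4 exp (- w)] at
    infinity. *)
Lemma sech_mom_odd_eq w : 0 < w -> sech_mom 1 w = beta w * alpha w ^ 2.
Proof.
  set (f := fun w => sech_mom 1 w / (beta w * alpha w ^ 2) - 1).
  assert (Hf : forall w, 0 < w -> f w = 0).
  { apply doubling_zero.
    - intros v Hv. assert (Hv2 : 0 < 2 * v) by lra. right; f_equal. unfold f.
      assert (A := sech_mom_even_odd v Hv). assert (B := sech_mom_double v Hv).
      assert (C := sech_mom_even_odd (2 * v) Hv2).
      rewrite !sech_sum_even_eq, !sech_sum_odd_eq in * by lra.
      assert (P1 := alpha_pos v Hv). assert (P2 := beta_pos v Hv).
      assert (P3 := alpha_pos _ Hv2). assert (P4 := beta_pos _ Hv2).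
      assert (D := alpha_double v Hv). assert (E := beta_sq_double v Hv).
      set (M := sech_mom 1 (2 * v)) in *. set (M0 := sech_mom 0 (2 * v)) in *.
      assert (F : M0 = beta (2 * v) * M / alpha (2 * v)).
      { apply Rmult_eq_reg_l with (alpha (2 * v)); [|lra]. rewrite C. field; lra. }
      assert (G : beta v * sech_mom 1 v = 4 * M * alpha v ^ 2 / alpha (2 * v)).
      { rewrite <- A, B, F, D. field; lra. }
      f_equal.
      replace (sech_mom 1 v / (beta v * alpha v ^ 2)) with (beta v * sech_mom 1 v / (beta v ^ 2 * alpha v ^ 2))
        by (field; lra).
      rewrite G, E. field. repeat split; lra.
    - apply (is_lim_ext_pos (fun w => sech_mom 1 w * exp w / (beta w * exp w * (alpha w * alpha w)) - 1)).
      + intros v Hv. unfold f. assert (A := alpha_pos v Hv). assert (B := beta_pos v Hv).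
        assert (E := exp_pos v). field. repeat split; lra.
      + replace (Finite 0) with (Finite (4 / (4 * (1 * 1)) - 1)) by (f_equal; field).
        apply (is_lim_minus' _ _ p_infty); [|apply is_lim_const].
        apply (is_lim_div_fin _ _ p_infty); [apply sech_mom_odd_lim| |lra].
        apply (is_lim_mult_fin _ _ p_infty); [apply beta_lim|].
        apply (is_lim_mult_fin _ _ p_infty); apply alpha_lim. }
  intros Hw. specialize (Hf w Hw). unfold f in Hf.
  assert (A := alpha_pos w Hw). assert (B := beta_pos w Hw).
  replace (sech_mom 1 w) with (sech_mom 1 w / (beta w * alpha w ^ 2) * (beta w * alpha w ^ 2))
    by (field; lra).
  replace (sech_mom 1 w / (beta w * alpha w ^ 2)) with 1 by lra. ring.
Qed.

Lemma sech_mom_even_eq w : 0 < w -> sech_mom 0 w = alpha w * beta w ^ 2.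
Proof.
  intros Hw. assert (A := sech_mom_even_odd w Hw).
  rewrite sech_mom_odd_eq, sech_sum_even_eq, sech_sum_odd_eq in A by auto.
  assert (P := alpha_pos w Hw). apply Rmult_eq_reg_l with (alpha w); [|lra]. rewrite A. ring.
Qed.

Lemma Xodd_theta w : 0 < w -> Xodd w (alpha w * beta w).
Proof.
  intros Hw. assert (H := Xodd_eq w Hw). rewrite sech_sum_even_eq, sech_sum_odd_eq, Rmult_comm in H by auto. auto.
Qed.

Lemma Vodd_theta w : 0 < w -> Vodd w (alpha w * beta w * (alpha w ^ 2 + beta w ^ 2)).
Proof.
  intros Hw. assert (H := Vodd_eq w Hw).
  rewrite sech_mom_odd_eq, sech_mom_even_eq, sech_sum_even_eq, sech_sum_odd_eq in H by auto.
  replace (alpha w * beta w * (alpha w ^ 2 + beta w ^ 2)) with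
    (beta w * alpha w ^ 2 * alpha w + beta w * (alpha w * beta w ^ 2)) by ring. auto.
Qed.

(** * The sum of [sech (m w) / m^2] over odd [m] *)

(** Two applications of the mean value theorem bound the error of the linear approximation of [f n]
    by [(y - x)^2 * M n]. A summable majorant of the second derivatives near [x] therefore replaces
    uniform convergence. *)
Lemma is_derive_Series (f g h : nat -> R -> R) (M : nat -> R) x r : 0 < r ->
  (forall n y, Rabs (y - x) < r -> is_derive (f n) y (g n y)) ->
  (forall n y, Rabs (y - x) < r -> is_derive (g n) y (h n y)) ->
  (forall n y, Rabs (y - x) < r -> Rabs (h n y) <= M n) -> ex_series M ->
  (forall y, Rabs (y - x) < r -> ex_series (fun n => f n y)) -> ex_series (fun n => g n x) ->
  is_derive (fun y => Series (fun n => f n y)) x (Series (fun n => g n x)).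
Proof.
  intros Hr Hf Hg Hh HM Hsf Hsg.
  assert (Hx : Rabs (x - x) < r) by (rewrite Rminus_diag, Rabs_R0; auto).
  assert (HT : forall n y, Rabs (y - x) < r ->
    Rabs (f n y - f n x - (y - x) * g n x) <= (y - x) ^ 2 * M n).
  { intros n y Hy.
    assert (Hin : forall z, Rmin x y <= z <= Rmax x y -> Rabs (z - x) <= Rabs (y - x)).
    { intros z Hz. unfold Rmin, Rmax in Hz. destruct (Rle_dec x y).
      - rewrite !Rabs_pos_eq; lra.
      - rewrite !Rabs_left1; lra. }
    destruct (MVT_gen (f n) x y (g n)) as [c [Hc E]].
    - intros z Hz; apply Hf. specialize (Hin z ltac:(lra)). lra.
    - intros z Hz. apply continuity_pt_filterlim, (ex_derive_continuous (V := R_NormedModule)).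
      eexists; apply Hf. specialize (Hin z Hz). lra.
    - destruct (MVT_gen (g n) x c (h n)) as [d [Hd E']].
      + intros z Hz; apply Hg. assert (Hz' : Rmin x y <= z <= Rmax x y).
        { unfold Rmin, Rmax in *. destruct (Rle_dec x y), (Rle_dec x c); lra. }
        specialize (Hin z Hz'). lra.
      + intros z Hz. apply continuity_pt_filterlim, (ex_derive_continuous (V := R_NormedModule)).
        eexists; apply Hg. assert (Hz' : Rmin x y <= z <= Rmax x y).
        { unfold Rmin, Rmax in *. destruct (Rle_dec x y), (Rle_dec x c); lra. }
        specialize (Hin z Hz'). lra.
      + assert (Hd' : Rmin x y <= d <= Rmax x y).
        { unfold Rmin, Rmax in *. destruct (Rle_dec x y), (Rle_dec x c); lra. }
        rewrite E. replace (g n c * (y - x) - (y - x) * g n x) with ((y - x) * (g n c - g n x)) by ring.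
        rewrite E', !Rabs_mult.
        rewrite <- (pow2_abs (y - x)). simpl. rewrite Rmult_1_r, Rmult_assoc.
        apply Rmult_le_compat_l; [apply Rabs_pos|].
        rewrite Rmult_comm. apply Rmult_le_compat; try apply Rabs_pos; [apply Hin; auto|].
        apply Hh. specialize (Hin d Hd'). lra. }
  assert (HM0 : forall n, 0 <= M n).
  { intros n. apply Rle_trans with (Rabs (h n x)); [apply Rabs_pos|auto]. }
  set (S := Series M).
  assert (HS : 0 <= S).
  { unfold S. apply (is_series_nnsum M (Series M)) in HM0; [|apply Series_correct; auto].
    apply (nnsum_nonneg M); auto. }
  assert (Hmain : forall y, Rabs (y - x) < r ->
    Rabs (Series (fun n => f n y) - Series (fun n => f n x) - (y - x) * Series (fun n => g n x)) <= (y - x) ^ 2 * S).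
  { intros y Hy.
    rewrite <- Series_minus, <- Series_scal_l, <- Series_minus; auto.
    - unfold S. rewrite <- Series_scal_l.
      assert (Hex : ex_series (fun n => (y - x) ^ 2 * M n)) by (apply (ex_series_scal_l _ M); auto).
      assert (Hab : ex_series (fun n => Rabs (f n y - f n x - (y - x) * g n x))).
      { apply (ex_series_le (V := R_CompleteNormedModule) _ (fun n => (y - x) ^ 2 * M n)); auto.
        intros n. change (Rabs (Rabs (f n y - f n x - (y - x) * g n x)) <= (y - x) ^ 2 * M n).
        rewrite Rabs_Rabsolu; auto. }
      eapply Rle_trans; [apply Series_Rabs; auto|].
      apply Series_le; auto. intros n; split; [apply Rabs_pos|auto].
    - apply (ex_series_minus (V := R_NormedModule)); auto.
    - apply (ex_series_scal_l _ (fun n => g n x)); auto. }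
  apply is_derive_Reals. intros e He.
  assert (Hdel : 0 < Rmin r (e / (S + 1))).
  { apply Rmin_pos; auto. apply Rdiv_lt_0_compat; lra. }
  exists (mkposreal _ Hdel). intros k Hk0 Hk. simpl in Hk.
  assert (Hk1 := Rlt_le_trans _ _ _ Hk (Rmin_l _ _)). assert (Hk2 := Rlt_le_trans _ _ _ Hk (Rmin_r _ _)).
  specialize (Hmain (x + k)). replace (x + k - x) with k in Hmain by ring. specialize (Hmain Hk1).
  set (D := Series (fun n => f n (x + k)) - Series (fun n => f n x)) in *. set (G := Series (fun n => g n x)) in *.
  replace (D / k - G) with ((D - k * G) / k) by (field; auto).
  unfold Rdiv; rewrite Rabs_mult, Rabs_inv.
  assert (Hka := Rabs_pos_lt k Hk0).
  apply Rle_lt_trans with (k ^ 2 * S * / Rabs k).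
  - apply Rmult_le_compat_r; auto. apply Rlt_le, Rinv_0_lt_compat; auto.
  - rewrite <- (pow2_abs k). replace (Rabs k ^ 2 * S * / Rabs k) with (Rabs k * S) by (field; lra).
    apply Rle_lt_trans with (Rabs k * (S + 1)); [nra|].
    apply Rlt_le_trans with (e / (S + 1) * (S + 1)); [apply Rmult_lt_compat_r; lra|].
    right; field; lra.
Qed.

Definition oddn (n : nat) : R := 2 * INR n + 1.

Lemma oddn_ge_1 n : 1 <= oddn n.
Proof. unfold oddn. assert (H := pos_INR n). lra. Qed.

(** This is [U] of the overview; its weight is the factor that the termwise rescaling in
    [chain_swap] leaves behind. *)
Definition odd_sech (w : R) : R := Series (fun n => sech (oddn n * w) / oddn n ^ 2).
Definition odd_sech1 (w : R) : R := Series (fun n => - (sech (oddn n * w) * tanh (oddn n * w)) / oddn n).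

Lemma is_derive_sech x : is_derive sech x (- (sech x * tanh x)).
Proof.
  unfold sech, tanh. unfold cosh, sinh.
  assert (A := exp_pos x). assert (B := exp_pos (- x)).
  auto_derive; [lra|]. field. lra.
Qed.

Lemma is_derive_sech_tanh x : is_derive (fun x => - (sech x * tanh x)) x (sech x - 2 * sech x ^ 3).
Proof.
  unfold sech, tanh. unfold cosh, sinh.
  assert (A := exp_pos x). assert (B := exp_pos (- x)).
  auto_derive; [lra|]. rewrite exp_Ropp. field. split; [lra|]. nra.
Qed.

Lemma is_derive_sech_2 x : is_derive (fun x => sech x - 2 * sech x ^ 3) x
  (- (sech x * tanh x) + 6 * sech x ^ 3 * tanh x).
Proof.
  assert (H := is_derive_sech x).
  evar_last.
  - apply (is_derive_minus sech (fun x => 2 * sech x ^ 3)); [exact H|].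
    apply is_derive_scal, (is_derive_pow sech 3). exact H.
  - unfold minus, plus, opp; simpl. ring.
Qed.

Lemma Rabs_tanh_le x : Rabs (tanh x) <= 1.
Proof.
  unfold tanh. assert (Hc := cosh_pos x).
  assert (Hep := exp_pos x). assert (Hem := exp_pos (- x)).
  apply Rabs_le; split; apply Rmult_le_reg_r with (cosh x); auto;
  unfold Rdiv; rewrite Rmult_assoc, Rinv_l by lra; unfold sinh, cosh; lra.
Qed.

Lemma ex_series_nnsum (f g : nat -> R) T : (forall n, Rabs (f n) <= g n) -> nnsum g T -> ex_series f.
Proof.
  intros H HT. apply (ex_series_le (V := R_CompleteNormedModule) _ g); [exact H|].
  exists T; apply nnsum_is_series; auto.
Qed.

Lemma odd_mom_nnsum w : 0 < w -> exists T, nnsum (fun n => oddn n ^ 2 * sech (oddn n * w)) T.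
Proof.
  intros Hw. eexists.
  assert (H := nnsum_Z_odd_sym (fun k => IZR (2 * k + 1) ^ 2 * sech (IZR (2 * k + 1) * w)) _
    ltac:(intros k; cbv beta; rewrite odd_sym_sech;
     replace (2 * (- k - 1) + 1)%Z with (- (2 * k + 1))%Z by lia; rewrite opp_IZR; ring)
    (sech_mom_correct w 1 Hw ltac:(lia))).
  revert H; apply nnsum_ext; intros n. unfold oddn. rewrite plus_IZR, mult_IZR, INR_IZR_INZ; auto.
Qed.

(** Differentiating termwise twice leaves half the sum of [sech''] over all odd multiples of [w],
    which [sech_second_deriv_sum] evaluates. *)
Lemma odd_sech_facts w : 0 < w ->
  nnsum (fun n => sech (oddn n * w) / oddn n ^ 2) (odd_sech w) /\ odd_sech w <= beta w / 2 /\
  is_derive odd_sech w (odd_sech1 w) /\ is_derive odd_sech1 w (beta w * gamma w ^ 2 / 2).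
Proof.
  intros Hw.
  assert (Hsum : forall v, 0 < v -> nnsum (fun n => sech (oddn n * v)) (beta v / 2)).
  { intros v Hv. rewrite <- sech_sum_odd_eq by auto. apply sech_sum_odd_half; auto. }
  assert (Hf : forall v n, 0 <= sech (oddn n * v) / oddn n ^ 2 <= sech (oddn n * v)).
  { intros v n. assert (A := sech_pos (oddn n * v)). assert (B := oddn_ge_1 n).
    assert (C : 1 <= oddn n ^ 2) by nra.
    split; [apply Rdiv_le_0_compat; lra|].
    apply Rmult_le_reg_r with (oddn n ^ 2); [lra|].
    unfold Rdiv; rewrite Rmult_assoc, Rinv_l by lra. nra. }
  assert (Hodd_sech : forall v, 0 < v -> exists T, nnsum (fun n => sech (oddn n * v) / oddn n ^ 2) T /\ T <= beta v / 2).
  { intros v Hv. apply (nnsum_le_ex _ _ _ (Hf v) (Hsum v Hv)). }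
  destruct (Hodd_sech w Hw) as [T [HT HTle]].
  assert (ET : odd_sech w = T) by (apply is_series_unique, nnsum_is_series; auto).
  split; [rewrite ET; auto|]. split; [rewrite ET; auto|].
  destruct (odd_mom_nnsum (w / 2) ltac:(lra)) as [S HS].
  (* One majorant serves both differentiations on [|y - w| < w / 2]. The third derivative of a term
     is at most [7 m sech (m y)], and [sech (m y) <= 2 sech (m w / 2)] gives the 14. *)
  assert (HM : ex_series (fun n => 14 * (oddn n ^ 2 * sech (oddn n * (w / 2))))).
  { exists (14 * S). apply nnsum_is_series, nnsum_scal; auto; lra. }
  assert (Hbound : forall n y, Rabs (y - w) < w / 2 -> sech (oddn n * y) <= 2 * sech (oddn n * (w / 2))).
  { intros n y Hy. apply Rabs_def2 in Hy. assert (B := oddn_ge_1 n).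
    eapply Rle_trans; [apply sech_le_exp|]. apply Rmult_le_compat_l; [lra|].
    eapply Rle_trans; [|apply sech_ge_exp]. apply exp_mono.
    rewrite !Rabs_pos_eq by nra. nra. }
  assert (Hcube : forall x, 0 <= sech x ^ 3 <= sech x).
  { intros x. assert (A := sech_pos x). assert (B := sech_le_1 x).
    split; [apply pow_le; lra|]. replace (sech x ^ 3) with (sech x * sech x ^ 2) by ring.
    assert (0 <= sech x ^ 2 <= 1) by (split; [apply pow2_ge_0|nra]). nra. }
  assert (Hlin : forall n y, is_derive (fun y => oddn n * y) y (oddn n)).
  { intros n y; auto_derive; auto; ring. }
  assert (D1 : forall n y, is_derive (fun w => sech (oddn n * w) / oddn n ^ 2) y
     (- (sech (oddn n * y) * tanh (oddn n * y)) / oddn n)).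
  { intros n y. assert (B := oddn_ge_1 n).
    assert (H := is_derive_comp sech (fun y => oddn n * y) y _ _ (is_derive_sech (oddn n * y)) (Hlin n y)).
    apply (is_derive_scal_l (fun y => sech (oddn n * y)) _ _ (/ oddn n ^ 2)) in H.
    evar_last; [exact H|]. unfold scal; simpl; unfold mult; simpl. field; lra. }
  assert (D2 : forall n y, is_derive (fun y => - (sech (oddn n * y) * tanh (oddn n * y)) / oddn n) y
     (sech (oddn n * y) - 2 * sech (oddn n * y) ^ 3)).
  { intros n y. assert (B := oddn_ge_1 n).
    assert (H := is_derive_comp _ (fun y => oddn n * y) y _ _ (is_derive_sech_tanh (oddn n * y)) (Hlin n y)).
    apply (is_derive_scal_l (fun y => - (sech (oddn n * y) * tanh (oddn n * y))) _ _ (/ oddn n)) in H.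
    evar_last; [exact H|]. unfold scal; simpl; unfold mult; simpl. field; lra. }
  assert (D3 : forall n y, is_derive (fun y => sech (oddn n * y) - 2 * sech (oddn n * y) ^ 3) y
     (oddn n * (- (sech (oddn n * y) * tanh (oddn n * y)) + 6 * sech (oddn n * y) ^ 3 * tanh (oddn n * y)))).
  { intros n y.
    exact (is_derive_comp _ (fun y => oddn n * y) y _ _ (is_derive_sech_2 (oddn n * y)) (Hlin n y)). }
  assert (Hg : forall v, 0 < v -> ex_series (fun n => - (sech (oddn n * v) * tanh (oddn n * v)) / oddn n)).
  { intros v Hv. refine (ex_series_nnsum _ _ _ _ (Hsum v Hv)).
    intros n; cbv beta. assert (A := sech_pos (oddn n * v)). assert (B := oddn_ge_1 n).
    assert (C := Rabs_tanh_le (oddn n * v)).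
    unfold Rdiv; rewrite Rabs_mult, Rabs_Ropp, Rabs_mult, (Rabs_pos_eq (sech _)), Rabs_inv, (Rabs_pos_eq (oddn n)) by lra.
    assert (/ oddn n <= 1) by (rewrite <- Rinv_1; apply Rinv_le_contravar; lra).
    assert (0 < / oddn n) by (apply Rinv_0_lt_compat; lra).
    assert (0 <= Rabs (tanh (oddn n * v)) * / oddn n <= 1) by (assert (E := Rabs_pos (tanh (oddn n * v))); nra).
    rewrite Rmult_assoc. nra. }
  assert (Hh : ex_series (fun n => sech (oddn n * w) - 2 * sech (oddn n * w) ^ 3)).
  { refine (ex_series_nnsum _ _ _ _ (nnsum_scal 3 _ _ ltac:(lra) (Hsum w Hw))).
    intros n; cbv beta. specialize (Hcube (oddn n * w)). apply Rabs_le; lra. }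
  split.
  - apply (is_derive_Series (fun n w => sech (oddn n * w) / oddn n ^ 2)
       (fun n w => - (sech (oddn n * w) * tanh (oddn n * w)) / oddn n)
       (fun n w => sech (oddn n * w) - 2 * sech (oddn n * w) ^ 3) _ w (w / 2)) with (5 := HM); auto; [lra| |].
    + intros n y Hy. specialize (Hcube (oddn n * y)). specialize (Hbound n y Hy).
      assert (A := sech_pos (oddn n * (w / 2))). assert (B := oddn_ge_1 n).
      assert (1 <= oddn n ^ 2) by nra.
      assert (1 * sech (oddn n * (w / 2)) <= oddn n ^ 2 * sech (oddn n * (w / 2))) by (apply Rmult_le_compat_r; lra).
      apply Rabs_le. lra.
    + intros y Hy. apply Rabs_def2 in Hy. destruct (Hodd_sech y ltac:(lra)) as [T' [HT' _]].
      exists T'; apply nnsum_is_series; auto.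
  - replace (beta w * gamma w ^ 2 / 2) with (Series (fun n => sech (oddn n * w) - 2 * sech (oddn n * w) ^ 3)).
    + apply (is_derive_Series (fun n w => - (sech (oddn n * w) * tanh (oddn n * w)) / oddn n)
       (fun n w => sech (oddn n * w) - 2 * sech (oddn n * w) ^ 3)
       (fun n y => oddn n * (- (sech (oddn n * y) * tanh (oddn n * y)) + 6 * sech (oddn n * y) ^ 3 * tanh (oddn n * y)))
       _ w (w / 2)) with (5 := HM); auto; [lra| |].
      * intros n y Hy. specialize (Hcube (oddn n * y)). specialize (Hbound n y Hy).
        assert (A := sech_pos (oddn n * (w / 2))). assert (B := oddn_ge_1 n).
        assert (A' := sech_pos (oddn n * y)).
        assert (C := Rabs_tanh_le (oddn n * y)).
        rewrite Rabs_mult, (Rabs_pos_eq (oddn n)) by lra.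
        apply Rle_trans with (oddn n * (7 * sech (oddn n * y))).
        -- apply Rmult_le_compat_l; [lra|]. eapply Rle_trans; [apply Rabs_triang|].
           rewrite Rabs_Ropp, !Rabs_mult, (Rabs_pos_eq (sech (oddn n * y))), (Rabs_pos_eq 6), (Rabs_pos_eq (_ ^ 3)) by lra.
           assert (E := Rabs_pos (tanh (oddn n * y))). nra.
        -- assert (oddn n * (7 * sech (oddn n * y)) <= oddn n * (14 * sech (oddn n * (w / 2)))) by (apply Rmult_le_compat_l; lra).
           assert (oddn n * (14 * sech (oddn n * (w / 2))) <= oddn n * (oddn n * (14 * sech (oddn n * (w / 2))))).
           { rewrite <- (Rmult_1_l (oddn n * (14 * _))) at 1. apply Rmult_le_compat_r; [nra|lra]. }
           nra.
      * intros y Hy. apply Hg. apply Rabs_def2 in Hy; lra.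
    + destruct (sech_second_deriv_sum w Hw) as [C [HC E]].
      rewrite sech_sum_odd_eq, sech_alt_eq in E by auto.
      assert (HC2 : nnsum (fun n => sech (oddn n * w) ^ 3) (C / 2)).
      { assert (H := nnsum_Z_odd_sym (fun k => sech (IZR (2 * k + 1) * w) ^ 3) _
          ltac:(intros k; cbv beta; rewrite odd_sym_sech; reflexivity) HC).
        revert H; apply nnsum_ext; intros n. unfold oddn. rewrite plus_IZR, mult_IZR, INR_IZR_INZ; auto. }
      rewrite <- E. apply is_series_unique.
      replace ((beta w - 2 * C) / 2) with (minus (beta w / 2) (2 * (C / 2)))
        by (unfold minus, plus, opp; simpl; field).
      exact (is_series_minus _ _ _ _ (nnsum_is_series _ _ (Hsum w Hw))
        (is_series_scal 2 _ _ (nnsum_is_series _ _ HC2))).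
Qed.

(** * The hypergeometric equation in the theta coordinate *)

(** The operator [x d/dx] on coefficients; it turns the two-term recurrences of hypergeometric
    coefficients into differential equations. *)
Definition euler_op (u : nat -> R) (n : nat) : R := INR n * u n.

Section Euler.
Variable u : nat -> R.
Hypothesis Hu : forall q, Rabs q < 1 -> Rbar_lt (Rabs q) (CV_radius u).

Lemma euler_op_incr n : PS_incr_1 (PS_derive u) n = euler_op u n.
Proof. destruct n; unfold euler_op; simpl; [rewrite Rmult_0_l|]; reflexivity. Qed.

Lemma euler_op_radius q : Rabs q < 1 -> Rbar_lt (Rabs q) (CV_radius (euler_op u)).
Proof.
  intros Hq. rewrite <- (CV_radius_ext _ _ euler_op_incr), CV_radius_incr_1, CV_radius_derive. auto.
Qed.

Lemma euler_op_derive x : 0 < x < 1 -> is_derive (PSeries u) x (PSeries (euler_op u) x / x).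
Proof.
  intros Hx. rewrite <- (PSeries_ext _ _ x euler_op_incr), PSeries_incr_1.
  replace (x * PSeries (PS_derive u) x / x) with (PSeries (PS_derive u) x) by (field; lra).
  apply is_derive_PSeries, Hu. rewrite Rabs_pos_eq; lra.
Qed.

Lemma euler_op_shift s x : Rabs x < 1 ->
  PSeries (fun n => (INR n + s) ^ 2 * u n) x =
  PSeries (euler_op (euler_op u)) x + 2 * s * PSeries (euler_op u) x + s ^ 2 * PSeries u x.
Proof.
  intros Hx.
  assert (E0 : ex_pseries u x) by (apply CV_radius_inside; auto).
  assert (E1 : ex_pseries (euler_op u) x) by (apply CV_radius_inside, euler_op_radius; auto).
  assert (E2 : ex_pseries (euler_op (euler_op u)) x).
  { apply CV_radius_inside.
    rewrite <- (CV_radius_ext (PS_incr_1 (PS_derive (euler_op u)))).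
    - rewrite CV_radius_incr_1, CV_radius_derive. apply euler_op_radius; auto.
    - intros [|n]; unfold euler_op; simpl; [rewrite Rmult_0_l|]; reflexivity. }
  rewrite <- (PSeries_scal (2 * s)), <- (PSeries_scal (s ^ 2)), <- !PSeries_plus.
  - apply PSeries_ext; intros n. unfold PS_plus, PS_scal, euler_op, plus, scal; simpl; unfold mult; simpl. ring.
  - apply ex_pseries_plus; auto. apply ex_pseries_scal; auto. apply Rmult_comm.
  - apply ex_pseries_scal; auto. apply Rmult_comm.
  - auto.
  - apply ex_pseries_scal; auto. apply Rmult_comm.
Qed.
End Euler.

Lemma bounded_radius (u : nat -> R) : (forall n, 0 <= u n <= 1) ->
  forall q, Rabs q < 1 -> Rbar_lt (Rabs q) (CV_radius u).
Proof.
  intros Hu. apply CV_radius_ge_1. intros t Ht.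
  apply (ex_series_nnsum _ (fun n => t ^ n) (/ (1 - t))); [|apply nnsum_geom; lra].
  intros n. assert (0 <= t ^ n) by (apply pow_le; lra). specialize (Hu n).
  rewrite Rabs_pos_eq by nra. nra.
Qed.

Lemma poch_pos a n : 0 < a -> 0 < poch a n.
Proof.
  intros Ha; induction n as [|n IH]; simpl; [lra|]. assert (H := pos_INR n). nra.
Qed.

Lemma poch_le a c n : 0 < a <= c -> poch a n <= poch c n.
Proof.
  intros Ha; induction n as [|n IH]; simpl; [lra|]. assert (H := pos_INR n).
  assert (P := poch_pos a n ltac:(lra)). nra.
Qed.

Lemma poch_ratio_bounds a c n : 0 < a <= c -> 0 <= (poch a n / poch c n) ^ 2 <= 1.
Proof.
  intros H. assert (A := poch_pos a n ltac:(lra)). assert (C := poch_pos c n ltac:(lra)).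
  assert (L := poch_le a c n H).
  assert (0 <= poch a n / poch c n <= 1).
  { split; [apply Rdiv_le_0_compat; lra|]. apply (Rdiv_le_1 (poch a n)); lra. }
  nra.
Qed.

(** Coefficients of [2F1(1/2,1/2;1;x)] and, below, of [3F2(1,1,1;3/2,3/2;x)]: with [n! = (1)_n] both
    are squares of one Pochhammer ratio. *)
Definition coefK (n : nat) : R := (poch (1/2) n / poch 1 n) ^ 2.
Definition coefY (n : nat) : R := (poch 1 n / poch (3/2) n) ^ 2.

Lemma coefK_bounds n : 0 <= coefK n <= 1.
Proof. apply poch_ratio_bounds; lra. Qed.
Lemma coefY_bounds n : 0 <= coefY n <= 1.
Proof. apply poch_ratio_bounds; lra. Qed.

Definition coefK_radius := bounded_radius coefK coefK_bounds.
Definition coefY_radius := bounded_radius coefY coefY_bounds.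

Lemma coefK_rec n : (INR n + 1) ^ 2 * coefK (S n) = (INR n + / 2) ^ 2 * coefK n.
Proof.
  unfold coefK; simpl poch. assert (A := poch_pos 1 n Rlt_0_1). assert (H := pos_INR n). field. lra.
Qed.

Lemma coefY_rec n : (INR (S n) + / 2) ^ 2 * coefY (S n) = (INR n + 1) ^ 2 * coefY n.
Proof.
  unfold coefY; simpl poch. rewrite S_INR.
  assert (A := poch_pos (3/2) n ltac:(lra)). assert (H := pos_INR n). field. lra.
Qed.

Definition K0 := PSeries coefK.
Definition K1 := PSeries (euler_op coefK).
Definition K2 := PSeries (euler_op (euler_op coefK)).
Definition Y0 := PSeries coefY.
Definition Y1 := PSeries (euler_op coefY).
Definition Y2 := PSeries (euler_op (euler_op coefY)).

(** With [theta = x d/dx], the recurrence [coefK_rec] reads [theta^2 K = x (theta + 1/2)^2 K]. *)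
Lemma K_ode x : Rabs x < 1 -> K2 x = x * (K2 x + K1 x + K0 x / 4).
Proof.
  intros Hx.
  assert (H := euler_op_shift coefK coefK_radius (/ 2) x Hx).
  fold K0 K1 K2 in H.
  assert (H0 := euler_op_shift coefK coefK_radius 0 x Hx). fold K0 K1 K2 in H0.
  rewrite PSeries_decr_1 in H0.
  2:{ apply CV_radius_inside.
      rewrite (CV_radius_ext _ (euler_op (euler_op coefK))).
      - apply euler_op_radius; auto. intros; apply euler_op_radius; auto. apply coefK_radius.
      - intros n; unfold euler_op; simpl; ring. }
  simpl (INR 0) in H0.
  rewrite (PSeries_ext _ (fun n => (INR n + / 2) ^ 2 * coefK n)), H in H0.
  - nra.
  - intros n. unfold PS_decr_1. rewrite <- coefK_rec, S_INR. ring.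
Qed.

Lemma coefY_0 : coefY 0 = 1.
Proof. unfold coefY; simpl; field. Qed.

(** Here [(theta + 1/2)^2 Y = 1/4 + x (theta + 1)^2 Y], the inhomogeneous term being the [n = 0]
    coefficient that [coefY_rec] does not reach. Multiplication by [sqrt x] shifts [theta] by [1/2],
    so [sqrt x * Y] solves the equation of [K] with right side [sqrt x / 4]. *)
Lemma Y_ode x : Rabs x < 1 ->
  Y2 x + Y1 x + Y0 x / 4 = / 4 + x * (Y2 x + 2 * Y1 x + Y0 x).
Proof.
  intros Hx.
  assert (H := euler_op_shift coefY coefY_radius (/ 2) x Hx). fold Y0 Y1 Y2 in H.
  assert (H0 := euler_op_shift coefY coefY_radius 1 x Hx). fold Y0 Y1 Y2 in H0.
  rewrite PSeries_decr_1 in H.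
  2:{ apply CV_radius_inside.
      rewrite (CV_radius_ext _ (PS_plus (euler_op (euler_op coefY)) (PS_plus (euler_op coefY) (PS_scal (/4) coefY)))).
      - eapply Rbar_lt_le_trans; [|apply CV_radius_plus].
        apply Rbar_min_case; [|eapply Rbar_lt_le_trans; [|apply CV_radius_plus]; apply Rbar_min_case].
        + apply euler_op_radius; auto. intros; apply euler_op_radius; auto. apply coefY_radius.
        + apply euler_op_radius; auto. apply coefY_radius.
        + rewrite CV_radius_scal by lra. apply coefY_radius; auto.
      - intros n; unfold euler_op, PS_plus, PS_scal, plus, scal; simpl; unfold mult; simpl; field. }
  rewrite (PSeries_ext (PS_decr_1 _) (fun n => (INR n + 1) ^ 2 * coefY n)), H0 in H.
  - simpl (INR 0) in H. rewrite coefY_0 in H. nra.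
  - intros n. unfold PS_decr_1. apply coefY_rec.
Qed.

(** The modular lambda function, that is the squared elliptic modulus, which serves as the
    coordinate [x] on the unit interval. *)
Definition lambda (w : R) : R := beta w ^ 2 / alpha w ^ 2.

Section Modulus.
Variable w : R.
Hypothesis Hw : 0 < w.

Lemma lambda_bounds : 0 < lambda w < 1.
Proof.
  assert (A := alpha_pos w Hw). assert (B := beta_pos w Hw). assert (L := beta_lt_alpha w Hw).
  unfold lambda. split; [apply Rdiv_lt_0_compat; apply pow_lt; auto|].
  apply (Rdiv_lt_1 (beta w ^ 2)); nra.
Qed.

Lemma lambda_compl : 1 - lambda w = gamma w ^ 2 / alpha w ^ 2.
Proof.
  assert (A := alpha_pos w Hw). unfold lambda. rewrite gamma_sq by auto. field. lra.
Qed.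

Lemma is_derive_lambda : is_derive lambda w (- 2 * lambda w * gamma w ^ 2).
Proof.
  assert (A := alpha_pos w Hw). unfold lambda.
  evar_last.
  - apply (is_derive_div (fun w => beta w ^ 2) (fun w => alpha w ^ 2)).
    + apply (is_derive_pow beta 2), is_derive_beta; auto.
    + apply (is_derive_pow alpha 2), is_derive_alpha; auto.
    + apply Rgt_not_eq, pow_lt; auto.
  - replace (dlb w) with (dla w - gamma w ^ 2) by (assert (D := dlb_dla w Hw); lra).
    simpl. field. lra.
Qed.

End Modulus.

(* With [theta = x d/dx], the operator is [L = (1 - x) theta^2 - x theta - x/4]. *)
Lemma pullback_second_derive (y0 y1 y2 f : R -> R) :
  (forall x, 0 < x < 1 -> is_derive y0 x (y1 x / x)) ->
  (forall x, 0 < x < 1 -> is_derive y1 x (y2 x / x)) ->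
  (forall x, 0 < x < 1 -> (1 - x) * y2 x - x * y1 x - x / 4 * y0 x = f x) ->
  exists h1 : R -> R, forall w, 0 < w ->
    is_derive (fun w => y0 (lambda w) / alpha w) w (h1 w) /\
    is_derive h1 w (4 * f (lambda w) * alpha w * gamma w ^ 2).
Proof.
  intros H0 H1 HL.
  exists (fun w => (- 2 * gamma w ^ 2 * y1 (lambda w) - y0 (lambda w) * dla w) / alpha w).
  intros w Hw.
  assert (A := alpha_pos w Hw). assert (Hx := lambda_bounds w Hw).
  assert (C := lambda_compl w Hw). assert (Dx := is_derive_lambda w Hw).
  assert (D0 : is_derive (fun w => y0 (lambda w)) w (- 2 * gamma w ^ 2 * y1 (lambda w))).
  { evar_last; [apply (is_derive_comp y0 lambda); [apply H0; auto|exact Dx]|].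
    unfold scal; simpl; unfold mult; simpl. field. lra. }
  assert (D1 : is_derive (fun w => y1 (lambda w)) w (- 2 * gamma w ^ 2 * y2 (lambda w))).
  { evar_last; [apply (is_derive_comp y1 lambda); [apply H1; auto|exact Dx]|].
    unfold scal; simpl; unfold mult; simpl. field. lra. }
  split.
  - evar_last.
    + apply (is_derive_div (fun w => y0 (lambda w)) alpha); [exact D0|apply is_derive_alpha; auto|lra].
    + field. lra.
  - assert (Dg : is_derive (fun w => - 2 * gamma w ^ 2) w (- 4 * gamma w ^ 2 * dlc w)).
    { evar_last.
      - apply is_derive_scal, (is_derive_pow gamma 2), is_derive_gamma; auto.
      - simpl; ring. }
    evar_last.
    + apply (is_derive_div (fun w => - 2 * gamma w ^ 2 * y1 (lambda w) - y0 (lambda w) * dla w) alpha).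
      * apply (is_derive_minus (fun w => - 2 * gamma w ^ 2 * y1 (lambda w)) (fun w => y0 (lambda w) * dla w)).
        -- apply (is_derive_mult (fun w => - 2 * gamma w ^ 2) (fun w => y1 (lambda w))); [exact Dg|exact D1|apply Rmult_comm].
        -- apply (is_derive_mult (fun w => y0 (lambda w)) dla); [exact D0|apply is_derive_dla; auto|apply Rmult_comm].
      * apply is_derive_alpha; auto.
      * lra.
    + unfold minus, plus, opp, mult; simpl.
      (* The Riccati equation turns the coefficient of [y0] into [- beta^2 gamma^2 / alpha], and
         [dla - dlc = - beta^2] turns that of [y1] into [- 4 beta^2 gamma^2 / alpha], exactly as the
         operator demands. *)
      rewrite dla_riccati by auto.
      replace (dlc w) with (dla w + beta w ^ 2) by (assert (D := dla_dlc w Hw); lra).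
      rewrite <- HL by auto.
      assert (EB : beta w ^ 2 = lambda w * alpha w ^ 2) by (unfold lambda; field; lra).
      assert (EC : gamma w ^ 2 = (1 - lambda w) * alpha w ^ 2) by (rewrite C; field; lra).
      replace (gamma w * (gamma w * 1)) with (gamma w ^ 2) by ring.
      replace (beta w * (beta w * 1)) with (beta w ^ 2) by ring.
      replace (dla w * (dla w * 1)) with (dla w ^ 2) by ring.
      rewrite EB, EC. field. lra.
Qed.

Lemma second_derive_zero (h h1 : R -> R) :
  (forall w, 0 < w -> is_derive h w (h1 w)) -> (forall w, 0 < w -> is_derive h1 w 0) ->
  exists A B, forall w, 0 < w -> h w = A + B * w.
Proof.
  intros H H1.
  assert (Hconst : forall (f : R -> R), (forall w, 0 < w -> is_derive f w 0) -> forall w, 0 < w -> f w = f 1).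
  { intros f Hf w Hw.
    destruct (MVT_gen f 1 w (fun _ => 0)) as [c [_ E]].
    - intros z Hz. apply Hf. unfold Rmin in Hz; destruct (Rle_dec 1 w); lra.
    - intros z Hz. apply continuity_pt_filterlim, (ex_derive_continuous (V := R_NormedModule)).
      eexists; apply Hf. unfold Rmin in Hz; destruct (Rle_dec 1 w); lra.
    - lra. }
  assert (E1 := Hconst h1 H1).
  assert (E2 : forall w, 0 < w -> h w - h1 1 * w = h 1 - h1 1 * 1).
  { apply (Hconst (fun w => h w - h1 1 * w)). intros v Hv. evar_last.
    - apply (is_derive_minus h (fun w => h1 1 * w)); [apply H; auto|].
      apply (is_derive_scal (fun w => w)), is_derive_id.
    - rewrite E1 by auto. unfold minus, plus, opp, one; simpl. ring. }
  exists (h 1 - h1 1 * 1), (h1 1). intros w Hw. rewrite <- (E2 w Hw). ring.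
Qed.

Lemma affine_lim A B (l : R) : is_lim (fun w => A + B * w) p_infty l -> l = A /\ B = 0.
Proof.
  intros H. apply is_lim_spec in H.
  assert (HB : B = 0).
  { apply NNPP; intros HB. assert (HB' := Rabs_pos_lt B HB).
    destruct (H (mkposreal 1 Rlt_0_1)) as [M HM]. simpl in HM.
    set (v := Rmax M 0 + 1). assert (M < v) by (unfold v; assert (A' := Rmax_l M 0); lra).
    assert (H1 := HM v H0). assert (H2 := HM (v + 2 / Rabs B)).
    assert (0 < 2 / Rabs B) by (apply Rdiv_lt_0_compat; lra).
    specialize (H2 ltac:(lra)).
    assert (Rabs (B * (2 / Rabs B)) < 2).
    { replace (B * (2 / Rabs B)) with ((A + B * (v + 2 / Rabs B) - l) - (A + B * v - l)) by ring.
      unfold Rminus at 1. eapply Rle_lt_trans; [apply Rabs_triang|]. rewrite Rabs_Ropp. lra. }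
    rewrite Rabs_mult, (Rabs_pos_eq (2 / Rabs B)) in H4 by lra.
    replace (Rabs B * (2 / Rabs B)) with 2 in H4 by (field; lra). lra. }
  split; auto. subst B.
  apply NNPP; intros Hne.
  assert (Hp : 0 < Rabs (A - l)) by (apply Rabs_pos_lt; lra).
  destruct (H (mkposreal _ Hp)) as [M HM]. simpl in HM. specialize (HM (M + 1) ltac:(lra)).
  rewrite Rmult_0_l, Rplus_0_r in HM. lra.
Qed.

Lemma lambda_lim : is_lim lambda p_infty 0.
Proof.
  apply (is_lim_ext_pos (fun w => (beta w * exp w) * (beta w * exp w) * exp (- 2 * w) / (alpha w * alpha w))).
  - intros w Hw. unfold lambda. replace (exp (- 2 * w)) with (/ (exp w * exp w)).
    + assert (A := alpha_pos w Hw). field. split; [lra|apply Rgt_not_eq, exp_pos].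
    + rewrite <- exp_plus, <- exp_Ropp. f_equal; ring.
  - replace (Finite 0) with (Finite (4 * 4 * 0 / (1 * 1))) by (f_equal; field).
    apply is_lim_div_fin; [| |lra].
    + apply is_lim_mult_fin; [apply is_lim_mult_fin; apply beta_lim|].
      apply (is_lim_nome (fun q => q)); auto. apply continuous_id.
    + apply is_lim_mult_fin; apply alpha_lim.
Qed.

Lemma K_op_zero x : 0 < x < 1 -> (1 - x) * K2 x - x * K1 x - x / 4 * K0 x = 0.
Proof. intros Hx. assert (H := K_ode x ltac:(rewrite Rabs_pos_eq; lra)). lra. Qed.

Lemma K0_derive x : 0 < x < 1 -> is_derive K0 x (K1 x / x).
Proof. apply euler_op_derive, coefK_radius. Qed.

Lemma K1_derive x : 0 < x < 1 -> is_derive K1 x (K2 x / x).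
Proof. apply euler_op_derive. apply euler_op_radius, coefK_radius. Qed.

Lemma Y0_derive x : 0 < x < 1 -> is_derive Y0 x (Y1 x / x).
Proof. apply euler_op_derive, coefY_radius. Qed.

Lemma Y1_derive x : 0 < x < 1 -> is_derive Y1 x (Y2 x / x).
Proof. apply euler_op_derive. apply euler_op_radius, coefY_radius. Qed.

Lemma K0_cont_0 : continuous K0 0.
Proof. apply PSeries_cont_1; [apply coefK_radius|apply Rabs_0_lt_1]. Qed.

Lemma Y0_cont_0 : continuous Y0 0.
Proof. apply PSeries_cont_1; [apply coefY_radius|apply Rabs_0_lt_1]. Qed.

(** The quotient by [alpha] has vanishing second derivative, hence is affine in [w]; its finite
    limit 1 at infinity forces it to be the constant 1. *)
Lemma K0_lambda w : 0 < w -> K0 (lambda w) = alpha w.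
Proof.
  destruct (pullback_second_derive K0 K1 K2 (fun _ => 0) K0_derive K1_derive K_op_zero) as [h1 Hh].
  destruct (second_derive_zero (fun w => K0 (lambda w) / alpha w) h1) as [A [B HAB]].
  - intros v Hv; apply Hh; auto.
  - intros v Hv; evar_last; [apply Hh; auto|ring].
  - assert (HL : is_lim (fun w => A + B * w) p_infty 1).
    { apply (is_lim_ext_pos (fun w => K0 (lambda w) / alpha w)); auto.
      replace (Finite 1) with (Finite (K0 0 / 1)).
      - apply is_lim_div_fin; [|apply alpha_lim|lra].
        apply (is_lim_comp_continuous lambda K0 p_infty 0); [apply lambda_lim|apply K0_cont_0].
      - f_equal. unfold K0; rewrite PSeries_0. unfold coefK; simpl; field. }
    apply affine_lim in HL. destruct HL as [<- ->].
    intros Hw. specialize (HAB w Hw). assert (Ap := alpha_pos w Hw).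
    apply (f_equal (fun x => x * alpha w)) in HAB. field_simplify in HAB; lra.
Qed.

Lemma is_derive_sqrt_mult (f g : R -> R) x : 0 < x -> is_derive f x (g x / x) ->
  is_derive (fun x => sqrt x * f x) x (sqrt x * (f x / 2 + g x) / x).
Proof.
  intros Hx Hf.
  assert (Hs := sqrt_lt_R0 x Hx).
  evar_last.
  - apply (is_derive_mult sqrt f); [apply is_derive_sqrt; [apply is_derive_id|exact Hx]|exact Hf|apply Rmult_comm].
  - unfold plus, mult, one; simpl. set (s := sqrt x) in *.
    replace x with (s * s) by (apply sqrt_sqrt; lra). field. lra.
Qed.

(** Both [sqrt (lambda w) * Y0 (lambda w) / alpha w] and [2 * odd_sech w] have second derivative
    [beta w * gamma w ^ 2] and tend to 0; an affine function with limit 0 vanishes. *)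
Lemma Y0_lambda w : 0 < w -> sqrt (lambda w) * Y0 (lambda w) = 2 * alpha w * odd_sech w.
Proof.
  destruct (pullback_second_derive (fun x => sqrt x * Y0 x) (fun x => sqrt x * (Y0 x / 2 + Y1 x))
    (fun x => sqrt x * ((Y0 x / 2 + Y1 x) / 2 + (Y1 x / 2 + Y2 x))) (fun x => sqrt x / 4)) as [h1 Hh].
  - intros x Hx. apply is_derive_sqrt_mult; [lra|apply Y0_derive; auto].
  - intros x Hx. apply (is_derive_sqrt_mult (fun x => Y0 x / 2 + Y1 x) (fun x => Y1 x / 2 + Y2 x)); [lra|].
    evar_last.
    + apply (is_derive_plus (fun x => Y0 x / 2) Y1); [|apply Y1_derive; auto].
      apply (is_derive_scal_l Y0 x (Y1 x / x) (/ 2)), Y0_derive; auto.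
    + unfold plus, scal; simpl; unfold mult; simpl. field; lra.
  - intros x Hx. assert (H := Y_ode x ltac:(rewrite Rabs_pos_eq; lra)). set (s := sqrt x).
    transitivity (s * ((Y2 x + Y1 x + Y0 x / 4) - x * (Y2 x + 2 * Y1 x + Y0 x))); [field|rewrite H; field].
  - destruct (second_derive_zero (fun w => sqrt (lambda w) * Y0 (lambda w) / alpha w - 2 * odd_sech w)
      (fun w => h1 w - 2 * odd_sech1 w)) as [A [B HAB]].
    + intros v Hv. apply (is_derive_minus (fun w => sqrt (lambda w) * Y0 (lambda w) / alpha w) (fun w => 2 * odd_sech w)).
      * apply Hh; auto.
      * apply is_derive_scal, odd_sech_facts; auto.
    + intros v Hv. evar_last.
      * apply (is_derive_minus h1 (fun w => 2 * odd_sech1 w)); [apply Hh; auto|].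
        apply is_derive_scal, odd_sech_facts; auto.
      * unfold minus, plus, opp; simpl.
        assert (Ap := alpha_pos v Hv). assert (Bp := beta_pos v Hv).
        replace (sqrt (lambda v)) with (beta v / alpha v); [field; lra|].
        unfold lambda. replace (beta v ^ 2 / alpha v ^ 2) with ((beta v / alpha v) ^ 2) by (field; lra).
        rewrite sqrt_pow2; auto. apply Rdiv_le_0_compat; lra.
    + assert (Hbeta : is_lim beta p_infty 0).
      { apply (is_lim_ext_pos (fun w => (beta w * exp w) * exp (- w))).
        - intros v Hv. rewrite Rmult_assoc, <- exp_plus, Rplus_opp_r, exp_0; ring.
        - replace (Finite 0) with (Finite (4 * 0)) by (f_equal; ring).
          apply is_lim_mult_fin; [apply beta_lim|].
          apply (is_lim_comp exp Ropp p_infty 0 m_infty); [apply is_lim_exp_m| |].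
          + apply (is_lim_opp (fun x => x) p_infty p_infty), is_lim_id.
          + exists 0; intros; discriminate. }
      assert (Hodd_sech : is_lim odd_sech p_infty 0).
      { apply (is_lim_squeeze_pos (fun _ => 0) _ (fun w => beta w * / 2)).
        - intros v Hv. destruct (odd_sech_facts v ltac:(lra)) as [H1 [H2 _]]. split; [|lra].
          eapply nnsum_nonneg, H1.
        - apply is_lim_const.
        - replace (Finite 0) with (Finite (0 * / 2)) by (f_equal; ring).
          apply is_lim_mult_fin; [apply Hbeta|apply is_lim_const]. }
      assert (HL : is_lim (fun w => A + B * w) p_infty 0).
      { apply (is_lim_ext_pos (fun w => sqrt (lambda w) * Y0 (lambda w) / alpha w - 2 * odd_sech w)); auto.
        replace (Finite 0) with (Finite (sqrt 0 * Y0 0 / 1 - 2 * 0)) by (f_equal; rewrite sqrt_0; field).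
        apply (is_lim_minus' _ _ p_infty).
        - apply is_lim_div_fin; [|apply alpha_lim|lra].
          apply is_lim_mult_fin.
          + apply (is_lim_comp_continuous lambda sqrt p_infty 0); [apply lambda_lim|apply continuous_sqrt].
          + apply (is_lim_comp_continuous lambda Y0 p_infty 0); [apply lambda_lim|apply Y0_cont_0].
        - apply is_lim_mult_fin; [apply is_lim_const|apply Hodd_sech]. }
      apply affine_lim in HL. destruct HL as [<- ->].
      intros Hw. specialize (HAB w Hw). assert (Ap := alpha_pos w Hw).
      replace (sqrt (lambda w) * Y0 (lambda w)) with (sqrt (lambda w) * Y0 (lambda w) / alpha w * alpha w) by (field; lra).
      replace (sqrt (lambda w) * Y0 (lambda w) / alpha w) with (2 * odd_sech w) by lra. ring.
Qed.

(** * Modular transformation *)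

Lemma sech_anti x y : 0 <= x <= y -> sech y <= sech x.
Proof.
  intros H. unfold sech. apply Rinv_le_contravar; [apply cosh_pos|].
  unfold cosh. rewrite !exp_Ropp.
  assert (A : 1 <= exp x) by (rewrite <- exp_0; apply exp_mono; lra).
  assert (B := exp_mono x y ltac:(lra)).
  set (p := exp x) in *. set (q := exp y) in *.
  assert (0 <= (q - p) * (1 - / p * / q)).
  { apply Rmult_le_pos; [lra|]. assert (/ p <= 1) by (rewrite <- Rinv_1; apply Rinv_le_contravar; lra).
    assert (/ q <= 1) by (rewrite <- Rinv_1; apply Rinv_le_contravar; lra).
    assert (0 < / p) by (apply Rinv_0_lt_compat; lra). assert (0 < / q) by (apply Rinv_0_lt_compat; lra). nra. }
  replace ((q - p) * (1 - / p * / q)) with (q + / q - (p + / p)) in H0 by (field; lra). lra.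
Qed.

(** The Gudermannian function minus [PI / 2], normalised to vanish at plus infinity. *)
Definition gd (x : R) : R := - 2 * atan (exp (- x)).

Lemma is_derive_gd x : is_derive gd x (sech x).
Proof.
  unfold gd.
  assert (H : is_derive atan (exp (- x)) (/ (1 + exp (- x) ^ 2))).
  { apply is_derive_Reals, derivable_pt_lim_atan. }
  assert (He : is_derive (fun x => exp (- x)) x (- exp (- x))) by (auto_derive; auto; ring).
  evar_last; [apply is_derive_scal, (is_derive_comp atan _ x _ _ H He)|].
  unfold scal; simpl; unfold mult; simpl. unfold sech, cosh. rewrite exp_Ropp.
  assert (A := exp_pos x). field. split; nra.
Qed.

Lemma gd_0 : gd 0 = - (PI / 2).
Proof. unfold gd. rewrite Ropp_0, exp_0, atan_1. field. Qed.

Lemma gd_lim w : 0 < w -> is_lim_seq (fun n => gd (2 * INR n * w)) 0.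
Proof.
  intros Hw. unfold gd.
  replace (Finite 0) with (Finite (- 2 * atan 0)) by (rewrite atan_0; f_equal; ring).
  apply is_lim_seq_mult'; [apply is_lim_seq_const|].
  apply (is_lim_seq_continuous atan).
  - apply derivable_continuous_pt, derivable_pt_atan.
  - apply (is_lim_seq_ext (fun n => exp (- 2 * w) ^ n)).
    + intros n; rewrite pow_exp; f_equal; ring.
    + assert (H := nome_bounds w Hw). apply is_lim_seq_geom. rewrite Rabs_pos_eq; lra.
Qed.

Lemma gd_step w n : 0 < w ->
  2 * w * sech (2 * INR (S n) * w) <= gd (2 * INR (S n) * w) - gd (2 * INR n * w) <= 2 * w * sech (2 * INR n * w).
Proof.
  intros Hw. assert (Hn := pos_INR n).
  assert (Hlt : 2 * INR n * w <= 2 * INR (S n) * w) by (rewrite S_INR; nra).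
  destruct (MVT_gen gd (2 * INR n * w) (2 * INR (S n) * w) sech) as [c [Hc E]].
  - intros; apply is_derive_gd.
  - intros; apply continuity_pt_filterlim, (ex_derive_continuous (V := R_NormedModule)).
    eexists; apply is_derive_gd.
  - rewrite Rmin_left, Rmax_right in Hc by auto. rewrite E, S_INR in *.
    replace (2 * (INR n + 1) * w - 2 * INR n * w) with (2 * w) by ring.
    assert (0 <= 2 * INR n * w) by nra.
    assert (A := sech_anti (2 * INR n * w) c ltac:(lra)).
    assert (B := sech_anti c (2 * (INR n + 1) * w) ltac:(lra)). split; nra.
Qed.

(* [alpha] is the sum of [sech (2 k w)], compared here with the integral of [sech] over the half-line, [PI / 2]. *)
Lemma alpha_bounds w : 0 < w -> PI / (2 * w) - 1 <= alpha w <= PI / (2 * w) + 1.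
Proof.
  intros Hw.
  assert (H0 := sech_sum_correct w 0 Hw ltac:(lia)). rewrite sech_sum_even_eq in H0 by auto.
  apply nnsum_Z_even_sym in H0.
  2:{ intros k. replace (2 * - k + 0)%Z with (- (2 * k + 0))%Z by lia.
      rewrite opp_IZR, <- Ropp_mult_distr_l, sech_even; auto. }
  assert (E0 : sech (IZR (2 * 0 + 0) * w) = 1).
  { simpl. rewrite Rmult_0_l. unfold sech. rewrite cosh_0; field. }
  rewrite E0 in H0. set (T := (alpha w - 1) / 2) in *.
  assert (HT : nnsum (fun n => sech (2 * INR (S n) * w)) T).
  { revert H0; apply nnsum_ext; intros n. rewrite Z.add_0_r, mult_IZR, INR_IZR_INZ; auto. }
  assert (HT1 : nnsum (fun n => sech (2 * INR n * w)) (1 + T)).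
  { assert (H : nnsum (fun n => if eqc 0%nat n then 0 else sech (2 * INR n * w)) T).
    { apply (nnsum_inj S (fun n => if eqc 0%nat n then 0 else sech (2 * INR n * w))).
      - intros; lia.
      - intros n; destruct (eqc 0%nat n); [lra|apply Rlt_le, sech_pos].
      - intros [|n]; [right; destruct (eqc 0%nat 0%nat); congruence|eauto].
      - revert HT; apply nnsum_ext; intros n. destruct (eqc 0%nat (S n)); congruence. }
    apply (nnsum_split1 (fun n => sech (2 * INR n * w)) 0%nat) in H.
    - simpl INR in H. rewrite Rmult_0_r, Rmult_0_l in H.
      unfold sech in H at 2. rewrite cosh_0, Rinv_1 in H. auto.
    - intros; apply Rlt_le, sech_pos. }
  assert (HG : nnsum (fun n => gd (2 * INR (S n) * w) - gd (2 * INR n * w)) (PI / 2)).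
  { apply is_series_nnsum.
    - intros n. assert (A := gd_step w n Hw). assert (B := sech_pos (2 * INR (S n) * w)). nra.
    - change (is_lim_seq (sum_n (fun n => gd (2 * INR (S n) * w) - gd (2 * INR n * w))) (PI / 2)).
      apply (is_lim_seq_ext (fun n => gd (2 * INR (S n) * w) - gd 0)).
      + induction n as [|n IH].
        * rewrite sum_O. simpl INR. do 2 f_equal. ring.
        * rewrite sum_Sn, <- IH. unfold plus; simpl. ring.
      + replace (Finite (PI / 2)) with (Finite (0 - gd 0)) by (rewrite gd_0; f_equal; ring).
        apply is_lim_seq_minus'; [|apply is_lim_seq_const].
        apply (is_lim_seq_incr_1 (fun n => gd (2 * INR n * w))), gd_lim; auto. }
  assert (L1 : 2 * w * T <= PI / 2).
  { refine (nnsum_le _ _ _ _ _ (nnsum_scal (2 * w) _ _ ltac:(lra) HT) HG). intros n; apply gd_step; auto. }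
  assert (L2 : PI / 2 <= 2 * w * (1 + T)).
  { refine (nnsum_le _ _ _ _ _ HG (nnsum_scal (2 * w) _ _ ltac:(lra) HT1)). intros n; apply gd_step; auto. }
  unfold T in *.
  assert (E : PI / (2 * w) * w = PI / 2) by (field; lra).
  split; apply Rmult_le_reg_r with w; auto; nra.
Qed.

Lemma K0_mono x y : 0 <= x <= y -> y < 1 -> K0 x <= K0 y.
Proof.
  intros Hxy Hy. unfold K0, PSeries. apply Series_le.
  - intros n. destruct (coefK_bounds n) as [A _]. assert (0 <= x ^ n) by (apply pow_le; lra).
    split; [apply Rmult_le_pos; auto|]. apply Rmult_le_compat_l; auto. apply pow_incr; lra.
  - refine (ex_series_nnsum _ _ _ _ (nnsum_geom y ltac:(lra))).
    intros n. destruct (coefK_bounds n) as [A B]. assert (0 <= y ^ n) by (apply pow_le; lra).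
    rewrite Rabs_pos_eq; nra.
Qed.

Lemma lambda_continuity w : 0 < w -> continuity_pt lambda w.
Proof.
  intros Hw. apply continuity_pt_filterlim, (ex_derive_continuous (V := R_NormedModule)).
  eexists; apply is_derive_lambda; auto.
Qed.

Lemma lambda_decr v w : 0 < v < w -> lambda w < lambda v.
Proof.
  intros H. destruct (MVT_gen lambda v w (fun w => - 2 * lambda w * gamma w ^ 2)) as [c [Hc E]].
  - intros z Hz. rewrite Rmin_left in Hz by lra. apply is_derive_lambda; lra.
  - intros z Hz. rewrite Rmin_left in Hz by lra. apply lambda_continuity; lra.
  - rewrite Rmin_left in Hc by lra.
    assert (A := lambda_bounds c ltac:(lra)). assert (B := pow_lt _ 2 (gamma_pos c ltac:(lra))).
    assert (0 < lambda c * gamma c ^ 2) by (apply Rmult_lt_0_compat; lra). nra.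
Qed.

(** If [lambda] stayed below [y] near 0, then [alpha = K0 (lambda)] would stay below [K0 y], against
    its growth like [PI / (2 w)]. At infinity [lambda] tends to 0, and the intermediate value
    theorem applies. *)
Lemma lambda_surj y : 0 < y < 1 -> exists w, 0 < w /\ lambda w = y.
Proof.
  intros Hy.
  assert (HK : 0 <= K0 y).
  { apply Rle_trans with (K0 0); [|apply K0_mono; lra]. unfold K0; rewrite PSeries_0. apply coefK_bounds. }
  (* Chosen so that [alpha_bounds] gives [alpha w1 >= K0 y + 1]. *)
  set (w1 := PI / (2 * (K0 y + 2))). assert (Hpi := PI_RGT_0).
  assert (Hw1 : 0 < w1) by (apply Rdiv_lt_0_compat; lra).
  assert (H1 : y < lambda w1).
  { apply Rnot_le_lt; intros Hle. assert (M := lambda_bounds w1 Hw1).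
    assert (A := K0_mono (lambda w1) y ltac:(lra) ltac:(lra)). rewrite K0_lambda in A by auto.
    assert (B := alpha_bounds w1 Hw1).
    replace (PI / (2 * w1)) with (K0 y + 2) in B by (unfold w1; field; lra). lra. }
  assert (HL := lambda_lim). apply is_lim_spec in HL. destruct (HL (mkposreal y (proj1 Hy))) as [M HM]. simpl in HM.
  set (w2 := Rmax M w1 + 1). assert (B1 := Rmax_l M w1). assert (B2 := Rmax_r M w1).
  specialize (HM w2 ltac:(unfold w2; lra)). rewrite Rminus_0_r in HM.
  assert (Hw2 : 0 < w2) by (unfold w2; lra).
  rewrite Rabs_pos_eq in HM by (assert (A := lambda_bounds w2 Hw2); lra).
  destruct (IVT_interv (fun w => y - lambda w) w1 w2) as [z [Hz E]].
  - intros z Hz. apply (continuity_pt_minus (fun _ => y) lambda).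
    + apply continuity_pt_const; intros u v; reflexivity.
    + apply lambda_continuity; lra.
  - unfold w2; lra.
  - lra.
  - lra.
  - exists z; split; lra.
Qed.

Lemma K0_compl_derive x : 0 < x < 1 -> is_derive (fun x => K0 (1 - x)) x (- (x / (1 - x)) * K1 (1 - x) / x).
Proof.
  intros Hx. assert (Hm : is_derive (fun x => 1 - x) x (-1)) by (auto_derive; auto; ring).
  evar_last; [apply (is_derive_comp K0 _ x _ _ (K0_derive (1 - x) ltac:(lra)) Hm)|].
  unfold scal; simpl; unfold mult; simpl. field; lra.
Qed.

Lemma K1_compl_derive x : 0 < x < 1 -> is_derive (fun x => - (x / (1 - x)) * K1 (1 - x)) x
  (x * (x * K2 (1 - x) - K1 (1 - x)) / (1 - x) ^ 2 / x).
Proof.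
  intros Hx. assert (Hm : is_derive (fun x => 1 - x) x (-1)) by (auto_derive; auto; ring).
  assert (Hq : is_derive (fun x => - (x / (1 - x))) x (- / (1 - x) ^ 2)).
  { auto_derive; [lra|]. field; lra. }
  evar_last.
  - apply (is_derive_mult (fun x => - (x / (1 - x))) (fun x => K1 (1 - x))); [exact Hq| |apply Rmult_comm].
    apply (is_derive_comp K1 _ x _ _ (K1_derive (1 - x) ltac:(lra)) Hm).
  - unfold plus, mult, scal; simpl; unfold mult; simpl. field; lra.
Qed.

(** [K0 (1 - x)] solves the same equation as [K0], so [K0 (1 - lambda w) = (A + B w) alpha w]. The
    symmetry [x -> 1 - x], the size [PI / (2 w)] of [alpha w] for small [w] and its limit 1 for
    large [w] determine [A = 0] and [B = 2 / PI]. *)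
Lemma theta_inversion w : 0 < w -> let v := PI ^ 2 / (4 * w) in
  lambda v = 1 - lambda w /\ alpha v = 2 * w / PI * alpha w.
Proof.
  assert (Hpi := PI_RGT_0).
  destruct (pullback_second_derive (fun x => K0 (1 - x)) (fun x => - (x / (1 - x)) * K1 (1 - x))
     (fun x => x * (x * K2 (1 - x) - K1 (1 - x)) / (1 - x) ^ 2) (fun _ => 0)
     K0_compl_derive K1_compl_derive) as [h1 Hh].
  { intros x Hx. assert (H := K_op_zero (1 - x) ltac:(lra)).
    replace (1 - (1 - x)) with x in H by ring.
    replace ((1 - x) * (x * (x * K2 (1 - x) - K1 (1 - x)) / (1 - x) ^ 2) -
      x * (- (x / (1 - x)) * K1 (1 - x)) - x / 4 * K0 (1 - x))
      with (x / (1 - x) * (x * K2 (1 - x) - (1 - x) * K1 (1 - x) - (1 - x) / 4 * K0 (1 - x))) by (field; lra).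
    rewrite H; ring. }
  destruct (second_derive_zero (fun w => K0 (1 - lambda w) / alpha w) h1) as [A [B HAB]].
  { intros v Hv; apply Hh; auto. }
  { intros v Hv; evar_last; [apply Hh; auto|ring]. }
  clear h1 Hh.
  (* Surjectivity of [lambda] provides the partner [v]; applying the affine relation at both points
     gives the product 1. *)
  assert (Hsym : forall w, 0 < w -> exists v, 0 < v /\ lambda v = 1 - lambda w /\
      alpha v = (A + B * w) * alpha w /\ (A + B * w) * (A + B * v) = 1).
  { intros u Hu. assert (Mu := lambda_bounds u Hu).
    destruct (lambda_surj (1 - lambda u) ltac:(lra)) as [v [Hv E]].
    assert (Au := alpha_pos u Hu). assert (Av := alpha_pos v Hv).
    assert (E1 : alpha v = (A + B * u) * alpha u).
    { rewrite <- HAB, <- E, K0_lambda by auto. field; lra. }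
    assert (E2 : alpha u = (A + B * v) * alpha v).
    { rewrite <- HAB by auto. rewrite E. replace (1 - (1 - lambda u)) with (lambda u) by ring.
      rewrite K0_lambda by auto. field; lra. }
    exists v; repeat (split; auto).
    rewrite E1 in E2. apply Rmult_eq_reg_r with (alpha u); [|lra]. rewrite E2 at 2. ring. }
  assert (Hpos : forall u, 0 < u -> 0 < A + B * u).
  { intros u Hu. destruct (Hsym u Hu) as [v [Hv [_ [E _]]]].
    assert (Au := alpha_pos u Hu). assert (Av := alpha_pos v Hv).
    apply Rmult_lt_reg_r with (alpha u); lra. }
  (* For small [u] the argument [1 - lambda u] is at most 1/2, so [K0] stays bounded there while
     [alpha u >= PI / (4 u)]; hence [A + B u] is at most a constant times [u], and it is
     positive. *)
  assert (HA : A = 0).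
  { destruct (lambda_surj (1/2) ltac:(lra)) as [w0 [Hw0 E0]].
    set (c := K0 (1/2) * 4 / PI).
    assert (HK : 0 <= K0 (1/2)).
    { apply Rle_trans with (K0 0); [|apply K0_mono; lra]. unfold K0; rewrite PSeries_0. apply coefK_bounds. }
    assert (Hc : 0 <= c) by (apply Rdiv_le_0_compat; lra).
    assert (Hle : forall u, 0 < u -> u < w0 -> u <= PI / 4 -> A + B * u <= c * u).
    { intros u Hu Hu0 Hu4. rewrite <- HAB by auto.
      assert (D := lambda_decr u w0 ltac:(lra)). assert (M := lambda_bounds u Hu).
      assert (K := K0_mono (1 - lambda u) (1/2) ltac:(lra) ltac:(lra)).
      assert (Ab := alpha_bounds u Hu).
      assert (L : PI / (4 * u) <= alpha u).
      { replace (PI / (4 * u)) with (PI / (2 * u) - PI / (4 * u)) by (field; lra).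
        assert (1 <= PI / (4 * u)); [|lra].
        apply Rmult_le_reg_r with (4 * u); [lra|].
        replace (PI / (4 * u) * (4 * u)) with PI by (field; lra). lra. }
      assert (P0 : 0 < PI / (4 * u)) by (apply Rdiv_lt_0_compat; lra).
      apply Rle_trans with (K0 (1/2) * / (PI / (4 * u))).
      - apply Rmult_le_compat; auto.
        + apply Rle_trans with (K0 0); [|apply K0_mono; lra]. unfold K0; rewrite PSeries_0. apply coefK_bounds.
        + apply Rlt_le, Rinv_0_lt_compat; lra.
        + apply Rinv_le_contravar; auto.
      - right; unfold c. field; lra. }
    apply NNPP; intros HA. assert (HA' := Rabs_pos_lt A HA).
    set (u := Rmin (Rmin (w0 / 2) (PI / 4)) (Rabs A / (2 * (Rabs B + c + 1)))).
    assert (HB := Rabs_pos B).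
    assert (Hu : 0 < u).
    { repeat apply Rmin_pos; try lra. apply Rdiv_lt_0_compat; lra. }
    assert (U1 : u <= w0 / 2) by (eapply Rle_trans; [apply Rmin_l|apply Rmin_l]).
    assert (U2 : u <= PI / 4) by (eapply Rle_trans; [apply Rmin_l|apply Rmin_r]).
    assert (U3 : u * (Rabs B + c + 1) <= Rabs A / 2).
    { apply Rle_trans with (Rabs A / (2 * (Rabs B + c + 1)) * (Rabs B + c + 1)).
      - apply Rmult_le_compat_r; [lra|apply Rmin_r].
      - right; field; lra. }
    specialize (Hle u Hu ltac:(lra) U2). specialize (Hpos u Hu).
    assert (Rabs (B * u) <= Rabs B * u) by (rewrite Rabs_mult, (Rabs_pos_eq u); lra).
    apply Rabs_le_between in H.
    assert (0 <= u * c) by (apply Rmult_le_pos; lra).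
    assert (0 <= u * Rabs B) by (apply Rmult_le_pos; lra).
    rewrite !Rmult_plus_distr_l in U3.
    destruct (Rle_dec 0 A) as [HA0|HA0]; [rewrite (Rabs_pos_eq A) in * by lra|rewrite (Rabs_left1 A) in * by lra]; lra. }
  subst A.
  assert (HB : 0 < B) by (specialize (Hpos 1 Rlt_0_1); lra).
  assert (Hv : forall u, 0 < u -> lambda (/ (B ^ 2 * u)) = 1 - lambda u /\ alpha (/ (B ^ 2 * u)) = B * u * alpha u).
  { intros u Hu. destruct (Hsym u Hu) as [v [Hv [E1 [E2 E3]]]].
    assert (Ev : v = / (B ^ 2 * u)).
    { apply Rmult_eq_reg_l with (B ^ 2 * u); [|nra]. rewrite Rinv_r by nra. rewrite <- E3. ring. }
    rewrite <- Ev. split; auto. rewrite E2; ring. }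
  (* Large [v] correspond to small [u = 1 / (B^2 v)], where [alpha u] is [PI / (2 u)] up to an error
     of 1. Comparison with the limit 1 of [alpha] then fixes [B]. *)
  assert (HL : is_lim alpha p_infty (B * (PI / 2))).
  { apply (is_lim_squeeze_pos (fun v => B * (PI / 2) - / B * / v) _ (fun v => B * (PI / 2) + / B * / v)).
    - intros v Hv1. set (u := / (B ^ 2 * v)).
      assert (Hu : 0 < u) by (apply Rinv_0_lt_compat; nra).
      destruct (Hv u Hu) as [_ E].
      replace (/ (B ^ 2 * u)) with v in E by (unfold u; field; lra).
      rewrite E. assert (Ab := alpha_bounds u Hu).
      assert (E1 : PI / (2 * u) * u = PI / 2) by (field; lra).
      assert (E2 : / B * / v = B * u) by (unfold u; field; lra).
      assert (E3 : PI / 2 - u <= u * alpha u <= PI / 2 + u) by (split; nra).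
      rewrite E2, Rmult_assoc. replace (B * (PI / 2) - B * u) with (B * (PI / 2 - u)) by ring.
      replace (B * (PI / 2) + B * u) with (B * (PI / 2 + u)) by ring.
      split; apply Rmult_le_compat_l; lra.
    - replace (Finite (B * (PI / 2))) with (Finite (B * (PI / 2) - / B * 0)) by (f_equal; ring).
      apply (is_lim_minus' _ _ p_infty); [apply is_lim_const|].
      apply is_lim_mult_fin; [apply is_lim_const|].
      apply (is_lim_inv (fun v => v) p_infty p_infty); [apply is_lim_id|discriminate].
    - replace (Finite (B * (PI / 2))) with (Finite (B * (PI / 2) + / B * 0)) by (f_equal; ring).
      apply (is_lim_plus' _ _ p_infty); [apply is_lim_const|].
      apply is_lim_mult_fin; [apply is_lim_const|].
      apply (is_lim_inv (fun v => v) p_infty p_infty); [apply is_lim_id|discriminate]. }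
  assert (EB : B = 2 / PI).
  { assert (E1 := is_lim_unique _ _ _ HL). rewrite (is_lim_unique _ _ _ alpha_lim) in E1.
    injection E1; intros E2. apply Rmult_eq_reg_r with (PI / 2); [|lra].
    rewrite <- E2. field; lra. }
  intros Hw v. destruct (Hv w Hw) as [E1 E2].
  replace (/ (B ^ 2 * w)) with v in * by (unfold v; rewrite EB; field; lra).
  split; auto. rewrite E2, EB. field; lra.
Qed.

Lemma beta_eq_sqrt w : 0 < w -> beta w = sqrt (lambda w) * alpha w.
Proof.
  intros Hw. assert (A := alpha_pos w Hw). assert (B := beta_pos w Hw).
  unfold lambda. replace (beta w ^ 2 / alpha w ^ 2) with ((beta w / alpha w) ^ 2) by (field; lra).
  rewrite sqrt_pow2; [field; lra|]. apply Rdiv_le_0_compat; lra.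
Qed.

Lemma gamma_eq_sqrt w : 0 < w -> gamma w = sqrt (1 - lambda w) * alpha w.
Proof.
  intros Hw. assert (A := alpha_pos w Hw). assert (B := gamma_pos w Hw).
  rewrite lambda_compl by auto.
  replace (gamma w ^ 2 / alpha w ^ 2) with ((gamma w / alpha w) ^ 2) by (field; lra).
  rewrite sqrt_pow2; [field; lra|]. apply Rdiv_le_0_compat; lra.
Qed.

Lemma theta_inversion_all w : 0 < w -> let v := PI ^ 2 / (4 * w) in
  alpha v = 2 * w / PI * alpha w /\ beta v = 2 * w / PI * gamma w /\ gamma v = 2 * w / PI * beta w.
Proof.
  intros Hw v. destruct (theta_inversion w Hw) as [E1 E2]. fold v in E1, E2.
  assert (Hpi := PI_RGT_0).
  assert (Hv : 0 < v) by (apply Rdiv_lt_0_compat; [apply pow_lt; auto|lra]).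
  split; auto. split.
  - rewrite beta_eq_sqrt, E1, E2, (gamma_eq_sqrt w) by auto. ring.
  - rewrite gamma_eq_sqrt, E1, E2, (beta_eq_sqrt w) by auto.
    replace (1 - (1 - lambda w)) with (lambda w) by ring. ring.
Qed.

(** * The Rogers-Zudilin chain of integrals *)

(** The integrals [g i] exist by comparison with [F] and need no closed form: the rescaling in
    [chain_swap] only has to preserve them. *)
Lemma nnint_nnsum_ex {I} p q (f : I -> R -> R) F S : Rbar_lt p q ->
  (forall i z, oint p q z -> continuous (f i) z) ->
  (forall z, oint p q z -> nnsum (fun i => f i z) (F z)) ->
  nnint p q F S ->
  exists g, (forall i, nnint p q (f i) (g i)) /\ nnsum g S.
Proof.
  intros Hpq Hf HF HS.
  assert (H : forall i, exists g, nnint p q (f i) g).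
  { intros i. destruct (nnint_le_ex p q (f i) F S Hpq) as [g [Hg _]]; eauto.
    intros z Hz. split; auto. split; [apply (HF z Hz)|apply (nnsum_ge (fun i => f i z)); auto]. }
  exists (fun i => proj1_sig (constructive_indefinite_description _ (H i))).
  assert (Hg : forall i, nnint p q (f i) (proj1_sig (constructive_indefinite_description _ (H i)))).
  { intros i; apply (proj2_sig (constructive_indefinite_description _ (H i))). }
  split; auto. apply (nnint_nnsum p q f F); auto. intros z Hz; apply (nnint_cont p q F S); auto.
Qed.

Lemma pos_line_iff x : oint 0 p_infty x <-> 0 < x.
Proof. unfold oint; simpl; tauto. Qed.

Lemma continuous_of_derive (f : R -> R) x l : is_derive f x l -> continuous f x.
Proof. intros H. apply (ex_derive_continuous (V := R_NormedModule)); exists l; exact H. Qed.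

Lemma alpha_cont w : 0 < w -> continuous alpha w.
Proof. intros Hw; apply (continuous_of_derive _ _ _ (is_derive_alpha w Hw)). Qed.
Lemma beta_cont w : 0 < w -> continuous beta w.
Proof. intros Hw; apply (continuous_of_derive _ _ _ (is_derive_beta w Hw)). Qed.
Lemma gamma_cont w : 0 < w -> continuous gamma w.
Proof. intros Hw; apply (continuous_of_derive _ _ _ (is_derive_gamma w Hw)). Qed.
Lemma odd_sech_cont w : 0 < w -> continuous odd_sech w.
Proof. intros Hw. destruct (odd_sech_facts w Hw) as [_ [_ [H _]]]. apply (continuous_of_derive _ _ _ H). Qed.
Lemma continuous_Rid x : continuous (fun y : R => y) x.
Proof. apply continuous_id. Qed.
Lemma continuous_Rplus (f g : R -> R) x : continuous f x -> continuous g x -> continuous (fun y => f y + g y) x.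
Proof. apply (continuous_plus f g). Qed.

(** A geometric bound is combined with [1 / (1 - exp (- 2 s)) <= (1 + 2 s) / (2 s)], so a single
    estimate covers both ends of the half-line. *)
Lemma beta_upper s : 0 < s -> beta s <= 2 * (1 + 2 * s) * exp (- s) / s.
Proof.
  intros Hs. assert (H := sech_sum_odd_half s Hs). rewrite sech_sum_odd_eq in H by auto.
  assert (Hq := nome_bounds s Hs).
  assert (HG := nnsum_scal (2 * exp (- s)) _ _ ltac:(assert (A := exp_pos (- s)); lra)
     (nnsum_geom (exp (- 2 * s)) ltac:(lra))).
  assert (HB : beta s / 2 <= 2 * exp (- s) * / (1 - exp (- 2 * s))).
  { refine (nnsum_le _ _ _ _ _ H HG). intros n. cbv beta.
    eapply Rle_trans; [apply sech_le_exp|]. rewrite Rmult_assoc. apply Rmult_le_compat_l; [lra|].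
    rewrite pow_exp, <- exp_plus. apply exp_mono. assert (Hn := pos_INR n).
    rewrite Rabs_pos_eq by nra. nra. }
  assert (HI : / (1 - exp (- 2 * s)) <= (1 + 2 * s) / (2 * s)).
  { replace ((1 + 2 * s) / (2 * s)) with (/ (1 - / (1 + 2 * s))) by (field; lra).
    apply Rinv_le_contravar.
    - assert (/ (1 + 2 * s) < 1); [|lra]. rewrite <- Rinv_1. apply Rinv_lt_contravar; lra.
    - assert (exp (- 2 * s) <= / (1 + 2 * s)); [|lra].
      replace (- 2 * s) with (- (2 * s)) by ring. rewrite exp_Ropp. apply Rinv_le_contravar; [lra|].
      apply exp_ineq1_le. }
  assert (A := exp_pos (- s)).
  apply Rle_trans with (2 * (2 * exp (- s) * ((1 + 2 * s) / (2 * s)))).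
  - assert (2 * exp (- s) * / (1 - exp (- 2 * s)) <= 2 * exp (- s) * ((1 + 2 * s) / (2 * s)))
      by (apply Rmult_le_compat_l; lra). lra.
  - right; field; lra.
Qed.

Lemma cube_le_exp y : 0 <= y -> y ^ 3 <= 6 * exp y.
Proof.
  intros Hy. assert (H := exp_ge_taylor y 3 Hy). simpl in H. simpl.
  assert (0 <= y * y) by nra. lra.
Qed.

Lemma nnint_exp C a : 0 <= C -> 0 < a -> nnint 0 p_infty (fun s => C * exp (- (a * s))) (C / a).
Proof.
  intros HC Ha.
  apply (nnint_antideriv _ _ _ (fun s => - (C / a) * exp (- (a * s)))).
  - intros x Hx. split; [apply Rmult_le_pos; auto; apply Rlt_le, exp_pos|].
    apply (continuous_of_derive _ _ (- a * C * exp (- (a * x)))). auto_derive; auto; ring.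
  - intros x Hx. auto_derive; auto. field; lra.
  - intros x y Hx Hy Hxy. apply (proj1 (pos_line_iff _)) in Hx.
    assert (A := exp_pos (- (a * y))). assert (B : exp (- (a * x)) <= 1).
    { rewrite <- exp_0. apply exp_mono. nra. }
    assert (0 <= C / a) by (apply Rdiv_le_0_compat; lra). nra.
  - intros e He. set (D := C / a + 1).
    assert (HD : 0 < D) by (unfold D; assert (0 <= C / a) by (apply Rdiv_le_0_compat; lra); lra).
    set (d := Rmin (e / (2 * D)) 1).
    assert (Hd : 0 < d) by (apply Rmin_pos; [apply Rdiv_lt_0_compat; lra|lra]).
    assert (Hd1 : d <= 1) by apply Rmin_r.
    assert (Hd2 : d * D <= e / 2).
    { apply Rle_trans with (e / (2 * D) * D); [apply Rmult_le_compat_r; [lra|apply Rmin_l]|]. right; field; lra. }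
    exists (d / a), (/ (d * a)). rewrite !pos_line_iff.
    assert (Hda : 0 < d / a) by (apply Rdiv_lt_0_compat; auto).
    repeat split; auto.
    + apply Rinv_0_lt_compat, Rmult_lt_0_compat; auto.
    + unfold Rdiv. rewrite Rinv_mult. apply Rmult_le_compat_r; [apply Rlt_le, Rinv_0_lt_compat; auto|].
      apply Rle_trans with 1; auto. rewrite <- Rinv_1. apply Rinv_le_contravar; auto.
    + replace (a * (d / a)) with d by (field; lra). replace (a * / (d * a)) with (/ d) by (field; lra).
      assert (E1 : 1 - d <= exp (- d)) by (assert (H := exp_ineq1_le (- d)); lra).
      assert (E2 : exp (- / d) <= d).
      { rewrite exp_Ropp. rewrite <- (Rinv_inv d) at 2. apply Rinv_le_contravar.
        - apply Rinv_0_lt_compat; auto.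
        - assert (H := exp_ineq1_le (/ d)). lra. }
      assert (0 <= C / a) by (apply Rdiv_le_0_compat; lra). unfold D in Hd2. nra.
Qed.

(** With [alpha] in place of [gamma] the integrand belongs to the coefficients [abs_coef], freed of
    signs. Its integrability gives absolute convergence and dominates the integral with [gamma]. *)
Lemma abs_integral_ex : exists T, nnint 0 p_infty (fun s => s ^ 3 * (alpha s * beta s * alpha s)) T.
Proof.
  (* The constants come from [cube_le_exp] at [(s + 2) / 2], that is
     [4 (s + 2)^3 <= 192 exp ((s + 2) / 2)], and from [exp ((s + 2) / 2) exp (- s) = exp 1 exp (- s
     / 2)]. *)
  assert (Hexp := nnint_exp (192 * exp 1) (1/2) ltac:(assert (A := exp_pos 1); lra) ltac:(lra)).
  destruct (fun H => nnint_le_ex 0 p_infty (fun s => s ^ 3 * (alpha s * beta s * alpha s)) _ _ Logic.I H Hexp)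
    as [T [HT _]]; eauto.
  intros s Hs. apply (proj1 (pos_line_iff _)) in Hs.
  assert (A := alpha_pos s Hs). assert (B := beta_pos s Hs). assert (Bu := beta_upper s Hs).
  assert (Au : alpha s <= (s + 2) / s).
  { assert (H := proj2 (alpha_bounds s Hs)).
    replace ((s + 2) / s) with (4 / (2 * s) + 1) by (field; lra).
    assert (PI / (2 * s) <= 4 / (2 * s)); [|lra].
    apply Rmult_le_compat_r; [apply Rlt_le, Rinv_0_lt_compat; lra|]. apply PI_4. }
  split; [split|].
  - apply Rmult_le_pos; [apply pow_le; lra|]. apply Rmult_le_pos; [apply Rmult_le_pos|]; lra.
  - apply Rle_trans with (s ^ 3 * ((s + 2) / s * (2 * (1 + 2 * s) * exp (- s) / s) * ((s + 2) / s))).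
    + apply Rmult_le_compat_l; [apply pow_le; lra|].
      apply Rmult_le_compat; try lra; [apply Rmult_le_pos; lra|].
      apply Rmult_le_compat; lra.
    + replace (s ^ 3 * ((s + 2) / s * (2 * (1 + 2 * s) * exp (- s) / s) * ((s + 2) / s)))
        with (2 * (s + 2) ^ 2 * (1 + 2 * s) * exp (- s)) by (field; lra).
      assert (E := exp_pos (- s)).
      assert (Cb := cube_le_exp ((s + 2) / 2) ltac:(lra)).
      replace (192 * exp 1 * exp (- (1 / 2 * s))) with (192 * exp ((s + 2) / 2) * exp (- s)).
      * apply Rmult_le_compat_r; [lra|]. apply Rle_trans with (4 * (s + 2) ^ 3); [|lra].
        replace (4 * (s + 2) ^ 3) with (2 * (s + 2) ^ 2 * (2 * (s + 2))) by ring.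
        apply Rmult_le_compat_l; [|lra]. assert (0 <= (s + 2) ^ 2) by apply pow2_ge_0. lra.
      * rewrite !Rmult_assoc, <- !exp_plus. do 2 f_equal. field.
  - apply continuous_Rmult; [apply continuous_pow, continuous_Rid|].
    apply continuous_Rmult; [apply continuous_Rmult; [apply alpha_cont|apply beta_cont]|apply alpha_cont]; auto.
Qed.

Section Chain.
Variable J : R.
Hypothesis HJ : nnint 0 p_infty (fun s => s ^ 3 * (alpha s * beta s * gamma s)) J.

Let c := PI ^ 2 / 4.

Lemma c_pos : 0 < c.
Proof. unfold c. assert (H := PI_RGT_0). apply Rdiv_lt_0_compat; [apply pow_lt; auto|lra]. Qed.

Lemma odd_sinh_half (k : nat) s S : (k = 1 \/ k = 3)%nat ->
  nnsum (fun m => IZR (2 * m + 1) ^ k / sinh (IZR (2 * m + 1) * s)) S ->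
  nnsum (fun i => oddn i ^ k / sinh (oddn i * s)) (S / 2).
Proof.
  intros Hk H. apply nnsum_Z_odd_sym in H.
  - revert H; apply nnsum_ext; intros n. unfold oddn. rewrite plus_IZR, mult_IZR, INR_IZR_INZ; auto.
  - intros m. replace (2 * (- m - 1) + 1)%Z with (- (2 * m + 1))%Z by lia.
    rewrite opp_IZR, <- Ropp_mult_distr_l, sinh_odd. unfold Rdiv. rewrite Rinv_opp.
    destruct Hk as [-> | ->]; ring.
Qed.

Lemma cont_sq_sinh_sech a b' d s : 0 < a -> 0 < s ->
  continuous (fun s => b' * (s ^ 2 / sinh (a * s)) * sech (d * (c / s))) s.
Proof.
  intros Ha Hs. assert (Hsi : sinh (a * s) <> 0) by (apply Rgt_not_eq, sinh_pos, Rmult_lt_0_compat; auto).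
  apply continuous_Rmult.
  - apply continuous_Rscal. apply continuous_div; auto; [apply continuous_pow, continuous_Rid|].
    unfold sinh. apply (continuous_of_derive _ _ ((exp (a * s) * a + exp (- (a * s)) * a) / 2)).
    auto_derive; auto; field.
  - apply (continuous_comp (fun s => d * (c / s)) sech).
    + apply continuous_Rscal, continuous_div; [lra|apply continuous_const|apply continuous_Rid].
    + apply (continuous_of_derive _ _ _ (is_derive_sech _)).
Qed.

(* Rogers--Zudilin: the substitution [s -> (n / m) s] in the [(m, n)] term exchanges the two Lambert series. *)
Lemma chain_swap : nnint 0 p_infty (fun s => s ^ 2 * (alpha s * beta s * (alpha s ^ 2 + beta s ^ 2) / 2) * odd_sech (c / s)) (J / (2 * PI)).
Proof.
  assert (Hpi := PI_RGT_0). assert (Hc := c_pos).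
  assert (Hlt : Rbar_lt 0 p_infty) by exact Logic.I.
  set (f := fun (ij : nat * nat) s => oddn (fst ij) * (s ^ 2 / sinh (oddn (fst ij) * s)) * sech (oddn (snd ij) * (c / s))).
  set (g := fun (ij : nat * nat) s => oddn (snd ij) ^ 3 / oddn (fst ij) ^ 2 * (s ^ 2 / sinh (oddn (snd ij) * s)) * sech (oddn (fst ij) * (c / s))).
  assert (Hodd : forall i, 0 < oddn i) by (intros i; assert (H := oddn_ge_1 i); lra).
  (* One power of [s] is used up by [beta (c / s) = 2 s / PI * gamma s]; halving the two sums over
     odd integers accounts for the rest of [1 / (2 PI)]. *)
  assert (HF : nnint 0 p_infty (fun s => / (2 * PI) * (s ^ 3 * (alpha s * beta s * gamma s))) (J / (2 * PI))).
  { replace (J / (2 * PI)) with (/ (2 * PI) * J) by (unfold Rdiv; ring).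
    apply nnint_scal; auto. apply Rlt_le, Rinv_0_lt_compat; lra. }
  destruct (fun H1 H2 => nnint_nnsum_ex 0 p_infty f _ _ Hlt H1 H2 HF) as [G [HG HGs]].
  { intros [i j] z Hz. apply cont_sq_sinh_sech; [apply Hodd|exact (proj1 (pos_line_iff z) Hz)]. }
  { intros s Hs. apply (proj1 (pos_line_iff _)) in Hs.
    destruct (theta_inversion_all s Hs) as [_ [Eb _]].
    assert (Hv : 0 < c / s) by (apply Rdiv_lt_0_compat; auto).
    replace (PI ^ 2 / (4 * s)) with (c / s) in Eb by (unfold c; field; lra).
    assert (Hb := sech_sum_odd_half (c / s) Hv). rewrite sech_sum_odd_eq in Hb by auto.
    assert (HX : nnsum (fun i => oddn i ^ 1 / sinh (oddn i * s)) (alpha s * beta s / 2)).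
    { apply odd_sinh_half; auto. assert (H := Xodd_theta s Hs). revert H; apply nnsum_ext.
      intros m; rewrite pow_1; auto. }
    assert (HP := nnsum_scal (s ^ 2) _ _ (pow2_ge_0 s) (nnsum_prod _ _ _ _ HX Hb)).
    replace (/ (2 * PI) * (s ^ 3 * (alpha s * beta s * gamma s)))
      with (s ^ 2 * (alpha s * beta s / 2 * (beta (c / s) / 2))).
    - revert HP; apply nnsum_ext; intros [i j]; unfold f, oddn; simpl fst; simpl snd.
      rewrite pow_1. unfold Rdiv; ring.
    - rewrite Eb. field; lra. }
  assert (HG' : forall ij, nnint 0 p_infty (g ij) (G ij)).
  { intros [i j]. set (r := oddn j / oddn i).
    assert (Hr : 0 < r) by (apply Rdiv_lt_0_compat; auto).
    assert (H := proj1 (nnint_subst 1 0 p_infty 0 p_infty (f (i, j)) (fun s => r * s) (fun _ => r) (G (i, j))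
       ltac:(ring) ltac:(intros; split; [auto_derive; auto; ring|apply continuous_const])
       ltac:(intros; lra) ltac:(intros x Hx; apply (proj1 (pos_line_iff _)) in Hx; apply (proj2 (pos_line_iff _)); apply Rmult_lt_0_compat; auto)
       ltac:(intros y Hy; apply (proj1 (pos_line_iff _)) in Hy; exists (y / r); split;
          [apply (proj2 (pos_line_iff _)), Rdiv_lt_0_compat; auto|field; lra]) (proj1 (HG (i, j)))) (HG (i, j))).
    revert H; apply nnint_ext. intros s Hs. apply (proj1 (pos_line_iff _)) in Hs. unfold f, g, r; simpl fst; simpl snd.
    assert (A := Hodd i). assert (B := Hodd j).
    replace (oddn i * (oddn j / oddn i * s)) with (oddn j * s) by (field; lra).
    replace (oddn j * (c / (oddn j / oddn i * s))) with (oddn i * (c / s)) by (field; lra).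
    assert (Hsi : 0 < sinh (oddn j * s)) by (apply sinh_pos, Rmult_lt_0_compat; auto).
    field. lra. }
  (* The rescaled terms separate again: the sum over [i] is [odd_sech (c / s)], and the sum over [j]
     is half of the [Vodd] series. *)
  apply (nnint_nnsum 0 p_infty g _ G); auto.
  - intros s Hs. apply (proj1 (pos_line_iff _)) in Hs.
    assert (Hv : 0 < c / s) by (apply Rdiv_lt_0_compat; auto).
    destruct (odd_sech_facts (c / s) Hv) as [HL _].
    assert (HV := odd_sinh_half 3 s _ ltac:(auto) (Vodd_theta s Hs)).
    assert (HP := nnsum_scal (s ^ 2) _ _ (pow2_ge_0 s) (nnsum_prod _ _ _ _ HL HV)).
    replace (s ^ 2 * (alpha s * beta s * (alpha s ^ 2 + beta s ^ 2) / 2) * odd_sech (c / s))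
      with (s ^ 2 * (odd_sech (c / s) * (alpha s * beta s * (alpha s ^ 2 + beta s ^ 2) / 2))) by ring.
    revert HP; apply nnsum_ext; intros [i j]; unfold g; simpl fst; simpl snd. unfold Rdiv; ring.
  - intros s Hs. apply (proj1 (pos_line_iff _)) in Hs.
    assert (Hv : 0 < c / s) by (apply Rdiv_lt_0_compat; auto).
    apply continuous_Rmult.
    + apply continuous_Rmult; [apply continuous_pow, continuous_Rid|].
      apply (continuous_Rmult (fun s => alpha s * beta s * (alpha s ^ 2 + beta s ^ 2)) (fun _ => / 2)); [|apply continuous_const].
      apply continuous_Rmult.
      * apply continuous_Rmult; [apply alpha_cont|apply beta_cont]; auto.
      * apply continuous_Rplus; apply continuous_pow; [apply alpha_cont|apply beta_cont]; auto.
    + apply (continuous_comp (fun s => c / s) odd_sech); [|apply odd_sech_cont; auto].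
      apply continuous_div; [lra|apply continuous_const|apply continuous_Rid].
Qed.

Lemma chain_invert : nnint 0 p_infty (fun w => alpha w * gamma w * (alpha w ^ 2 + gamma w ^ 2) * odd_sech w) (4 * J / PI ^ 3).
Proof.
  assert (Hpi := PI_RGT_0). assert (Hc := c_pos).
  assert (H := chain_swap).
  apply (nnint_subst (-1) 0 p_infty 0 p_infty _ (fun w => c / w) (fun w => - (c / w ^ 2)) _) in H.
  (* All powers of [w] cancel: [s^2 ds] gives [c^3 / w^4] and the four theta factors give
     [(2 w / PI)^4]; with the half in front, [PI^2 / 8] remains. *)
  - apply (nnint_scal _ _ (8 / PI ^ 2)) in H; [|apply Rdiv_le_0_compat; [lra|apply pow_lt; auto]].
    replace (4 * J / PI ^ 3) with (8 / PI ^ 2 * (J / (2 * PI))) by (field; lra).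
    revert H; apply nnint_ext. intros w Hw. apply (proj1 (pos_line_iff _)) in Hw.
    destruct (theta_inversion_all w Hw) as [Ea [Eb _]].
    replace (PI ^ 2 / (4 * w)) with (c / w) in Ea, Eb by (unfold c; field; lra).
    rewrite Ea, Eb. replace (c / (c / w)) with w by (field; lra).
    unfold c. field. lra.
  - ring.
  - intros w Hw. apply (proj1 (pos_line_iff _)) in Hw. split; [auto_derive; [lra|field; lra]|].
    apply (continuous_of_derive _ _ (2 * c / w ^ 3)). auto_derive; [nra|field; lra].
  - intros w Hw. apply (proj1 (pos_line_iff _)) in Hw. assert (0 < c / w ^ 2) by (apply Rdiv_lt_0_compat; auto; apply pow_lt; auto). lra.
  - intros w Hw. apply (proj1 (pos_line_iff _)) in Hw. apply (proj2 (pos_line_iff _)), Rdiv_lt_0_compat; auto.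
  - intros y Hy. apply (proj1 (pos_line_iff _)) in Hy. exists (c / y). split; [apply (proj2 (pos_line_iff _)), Rdiv_lt_0_compat; auto|field; lra].
  - apply H.
Qed.

(** * Beta integrals in the modulus *)

Lemma oint_01 x : oint 0 1 x <-> 0 < x < 1.
Proof. unfold oint; simpl; tauto. Qed.

Lemma K0_cont x : Rabs x < 1 -> continuous K0 x.
Proof. apply PSeries_cont_1, coefK_radius. Qed.
Lemma Y0_cont x : Rabs x < 1 -> continuous Y0 x.
Proof. apply PSeries_cont_1, coefY_radius. Qed.

Lemma K0_nnsum x : 0 <= x < 1 -> nnsum (fun n => coefK n * x ^ n) (K0 x).
Proof.
  intros Hx. apply is_series_nnsum.
  - intros n; apply Rmult_le_pos; [apply coefK_bounds|apply pow_le; lra].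
  - apply is_pseries_R, PSeries_correct, CV_radius_inside, coefK_radius. rewrite Rabs_pos_eq; lra.
Qed.
Lemma Y0_nnsum x : 0 <= x < 1 -> nnsum (fun n => coefY n * x ^ n) (Y0 x).
Proof.
  intros Hx. apply is_series_nnsum.
  - intros n; apply Rmult_le_pos; [apply coefY_bounds|apply pow_le; lra].
  - apply is_pseries_R, PSeries_correct, CV_radius_inside, coefY_radius. rewrite Rabs_pos_eq; lra.
Qed.

(** In the coordinate [x = lambda w] one has [alpha^2 + gamma^2 = (2 - x) alpha^2] and
    [gamma = sqrt (1 - x) alpha]; the Jacobian [2 x gamma^2] and the 2 in [Y0_lambda] produce the
    factor 4. *)
Lemma chain_modulus : nnint 0 1 (fun x => (2 - x) * Y0 x * K0 x / (sqrt x * sqrt (1 - x))) (16 * J / PI ^ 3).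
Proof.
  assert (H := nnint_scal _ _ 4 _ _ ltac:(lra) chain_invert).
  replace (16 * J / PI ^ 3) with (4 * (4 * J / PI ^ 3)) by (unfold Rdiv; ring).
  apply (nnint_subst (-1) 0 p_infty 0 1 _ lambda (fun w => - 2 * lambda w * gamma w ^ 2)).
  - ring.
  - intros w Hw. apply (proj1 (pos_line_iff _)) in Hw. split; [apply is_derive_lambda; auto|].
    apply (continuous_Rmult (fun w => - 2 * lambda w)); [|apply continuous_pow, gamma_cont; auto].
    apply continuous_Rscal, (continuous_of_derive _ _ _ (is_derive_lambda w Hw)).
  - intros w Hw. apply (proj1 (pos_line_iff _)) in Hw. assert (A := lambda_bounds w Hw).
    assert (B := pow_lt _ 2 (gamma_pos w Hw)). assert (0 < lambda w * gamma w ^ 2) by (apply Rmult_lt_0_compat; lra). lra.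
  - intros w Hw. apply (proj1 (pos_line_iff _)) in Hw. apply (proj2 (oint_01 _)), lambda_bounds; auto.
  - intros y Hy. apply (proj1 (oint_01 _)) in Hy. destruct (lambda_surj y Hy) as [w [Hw E]]. exists w; split; auto. apply (proj2 (pos_line_iff _)); auto.
  - intros x Hx. apply (proj1 (oint_01 _)) in Hx.
    assert (S1 := sqrt_lt_R0 x ltac:(lra)). assert (S2 := sqrt_lt_R0 (1 - x) ltac:(lra)).
    assert (A := nnsum_nonneg _ _ (K0_nnsum x ltac:(lra))). assert (B := nnsum_nonneg _ _ (Y0_nnsum x ltac:(lra))).
    split.
    + apply Rdiv_le_0_compat; [|apply Rmult_lt_0_compat; auto].
      apply Rmult_le_pos; auto. apply Rmult_le_pos; auto; lra.
    + assert (Rabs x < 1) by (rewrite Rabs_pos_eq; lra).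
      apply continuous_div; [apply Rgt_not_eq, Rmult_lt_0_compat; auto| |].
      * apply continuous_Rmult; [|apply K0_cont; auto].
        apply continuous_Rmult; [|apply Y0_cont; auto].
        apply (continuous_of_derive _ _ (-1)). auto_derive; auto; ring.
      * apply continuous_Rmult; [apply continuous_sqrt|].
        apply (continuous_comp (fun x => 1 - x) sqrt); [|apply continuous_sqrt].
        apply (continuous_of_derive _ _ (-1)). auto_derive; auto; ring.
  - revert H; apply nnint_ext. intros w Hw. apply (proj1 (pos_line_iff _)) in Hw.
    assert (A := alpha_pos w Hw). assert (B := beta_pos w Hw). assert (C := gamma_pos w Hw).
    assert (M := lambda_bounds w Hw).
    assert (EY := Y0_lambda w Hw). assert (EK := K0_lambda w Hw).
    assert (Eb := beta_eq_sqrt w Hw). assert (Ec := gamma_eq_sqrt w Hw).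
    assert (S1 := sqrt_lt_R0 (lambda w) ltac:(lra)). assert (S2 := sqrt_lt_R0 (1 - lambda w) ltac:(lra)).
    rewrite EK.
    assert (EY' : Y0 (lambda w) = 2 * alpha w * odd_sech w / sqrt (lambda w)) by (rewrite <- EY; field; lra).
    rewrite EY', Ec.
    assert (Q1 := sqrt_sqrt (lambda w) ltac:(lra)). assert (Q2 := sqrt_sqrt (1 - lambda w) ltac:(lra)).
    set (s1 := sqrt (lambda w)) in *. set (s2 := sqrt (1 - lambda w)) in *.
    replace (2 - lambda w) with (1 + s2 * s2) by lra.
    rewrite <- Q1. field. lra.
Qed.

(** The substitution [x = sin^2 t] absorbs both square-root singularities and turns the moments into
    Wallis integrals. *)
Lemma chain_angle : nnint 0 (PI / 2) (fun t => 2 * ((2 - sin t ^ 2) * Y0 (sin t ^ 2) * K0 (sin t ^ 2))) (16 * J / PI ^ 3).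
Proof.
  assert (Hpi := PI_RGT_0).
  assert (Hsc : forall t, oint 0 (PI / 2) t -> 0 < sin t /\ 0 < cos t /\ 0 < sin t ^ 2 < 1).
  { intros t [H1 H2]; simpl in H1, H2.
    assert (A : 0 < sin t) by (apply sin_gt_0; lra). assert (B : 0 < cos t) by (apply cos_gt_0; lra).
    assert (C := sin2_cos2 t). unfold Rsqr in C. repeat split; auto; nra. }
  assert (H := chain_modulus).
  apply (nnint_subst 1 0 (PI / 2) 0 1 _ (fun t => sin t ^ 2) (fun t => 2 * sin t * cos t)) in H.
  - revert H; apply nnint_ext. intros t Ht. destruct (Hsc t Ht) as [A [B C]].
    replace (1 - sin t ^ 2) with (cos t ^ 2) by (assert (D := sin2_cos2 t); unfold Rsqr in D; nra).
    rewrite !sqrt_pow2 by lra. field. lra.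
  - ring.
  - intros t Ht. split; [auto_derive; auto; ring|].
    apply (continuous_of_derive _ _ (2 * cos t * cos t - 2 * sin t * sin t)). auto_derive; auto; ring.
  - intros t Ht. destruct (Hsc t Ht) as [A [B C]]. nra.
  - intros t Ht. apply (proj2 (oint_01 _)), Hsc; auto.
  - intros y Hy. apply (proj1 (oint_01 _)) in Hy.
    assert (S1 := sqrt_lt_R0 y ltac:(lra)).
    assert (S2 : sqrt y < 1) by (rewrite <- sqrt_1; apply sqrt_lt_1; lra).
    exists (asin (sqrt y)).
    assert (B := asin_bound_lt (sqrt y) ltac:(lra)). assert (E := sin_asin (sqrt y) ltac:(lra)). split.
    + split; simpl; [|lra].
      apply Rnot_le_lt; intros Hle. assert (D := sin_incr_1 (asin (sqrt y)) 0). rewrite sin_0 in D. lra.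
    + rewrite sin_asin by lra. apply pow2_sqrt; lra.
  - apply H.
Qed.

(** The antiderivative of [sin^(2 N)] vanishing at 0, built by the reduction formula from
    integration by parts so that its value at [PI / 2] follows by induction. *)
Fixpoint wallis (N : nat) (t : R) : R :=
  match N with
  | O => t
  | S n => ((2 * INR n + 1) * wallis n t - sin t ^ (2 * n + 1) * cos t) / (2 * INR n + 2)
  end.

Lemma wallis_derive N t : is_derive (wallis N) t (sin t ^ (2 * N)).
Proof.
  induction N as [|n IH].
  - simpl. apply (is_derive_id (K := R_AbsRing)).
  - assert (Hn := pos_INR n).
    assert (H1 : is_derive (fun t => sin t ^ (2 * n + 1) * cos t) t
      ((2 * INR n + 1) * sin t ^ (2 * n) * cos t * cos t - sin t ^ (2 * n + 1) * sin t)).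
    { evar_last.
      - apply (is_derive_mult (fun t => sin t ^ (2 * n + 1)) cos); [|apply is_derive_cos|apply Rmult_comm].
        apply (is_derive_pow sin (2 * n + 1)), is_derive_sin.
      - replace (INR (2 * n + 1)) with (2 * INR n + 1) by (rewrite plus_INR, mult_INR; simpl; ring).
        replace (pred (2 * n + 1)) with (2 * n)%nat by lia.
        unfold plus, mult, one; cbn -[Rpow_def.pow Nat.mul Nat.add INR]. ring. }
    assert (H2 := is_derive_minus _ _ _ _ _ (is_derive_scal _ _ (2 * INR n + 1) _ IH) H1).
    apply (is_derive_scal_l _ _ _ (/ (2 * INR n + 2))) in H2.
    evar_last; [exact H2|].
    replace (2 * S n)%nat with (2 * n + 2)%nat by lia.
    unfold scal, minus, plus, opp, mult; cbn -[Rpow_def.pow Nat.mul Nat.add INR].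
    unfold mult; cbn -[Rpow_def.pow Nat.mul Nat.add INR].
    rewrite !pow_add, pow_1.
    assert (D := sin2_cos2 t). unfold Rsqr in D.
    replace (cos t * cos t) with (1 - sin t * sin t) by lra.
    replace ((2 * INR n + 1) * sin t ^ (2 * n) * cos t * cos t) with ((2 * INR n + 1) * sin t ^ (2 * n) * (cos t * cos t)) by ring.
    replace (cos t * cos t) with (1 - sin t * sin t) by lra.
    field. lra.
Qed.

Lemma wallis_0 N : wallis N 0 = 0.
Proof.
  induction N as [|n IH]; auto. simpl wallis. rewrite IH, sin_0, pow_i by lia.
  unfold Rdiv; ring.
Qed.

Lemma wallis_PI2 N : wallis N (PI / 2) = PI / 2 * (poch (1/2) N / poch 1 N).
Proof.
  induction N as [|n IH]; [simpl; field|]. simpl wallis. rewrite IH, cos_PI2. simpl poch.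
  assert (A := poch_pos 1 n Rlt_0_1). assert (Hn := pos_INR n). field. lra.
Qed.

Lemma nnint_closed a b' (f G : R -> R) : a < b' ->
  (forall x, is_derive G x (f x)) -> (forall x, continuous f x) -> (forall x, a < x < b' -> 0 <= f x) ->
  nnint a b' f (G b' - G a).
Proof.
  intros Hab HG Hf H0.
  assert (HcG : forall x, continuous G x) by (intros x; apply (continuous_of_derive _ _ _ (HG x))).
  assert (Hmon : forall x y, a <= x <= y -> y <= b' -> G x <= G y).
  { intros x y Hx Hy. destruct (Req_dec x y) as [->|Hne]; [lra|].
    destruct (MVT_cor2 G f x y ltac:(lra)) as [z [E Hz]].
    - intros; apply is_derive_Reals, HG.
    - assert (0 <= f z * (y - x)) by (apply Rmult_le_pos; [apply H0|]; lra). lra. }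
  apply (nnint_antideriv _ _ _ G).
  - intros x Hx. split; [|apply Hf]. destruct Hx as [H1 H2]; simpl in H1, H2. apply H0; split; assumption.
  - auto.
  - intros x y [H1 H2] [H3 H4] Hxy; simpl in *.
    assert (A := Hmon a x ltac:(lra) ltac:(lra)). assert (B := Hmon y b' ltac:(lra) ltac:(lra)). lra.
  - intros e He.
    assert (Hnear : forall x, exists d, 0 < d /\ forall y, Rabs (y - x) < d -> Rabs (G y - G x) < e / 2).
    { intros x. assert (H := HcG x). apply filterlim_locally with (eps := mkposreal (e / 2) ltac:(lra)) in H.
      destruct H as [d Hd]. exists d; split; [apply cond_pos|]. intros y Hy; apply Hd; exact Hy. }
    destruct (Hnear a) as [d1 [Hd1 N1]]. destruct (Hnear b') as [d2 [Hd2 N2]].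
    set (x := a + Rmin (d1 / 2) ((b' - a) / 2)). set (y := b' - Rmin (d2 / 2) ((b' - a) / 2)).
    assert (X1 := Rmin_l (d1 / 2) ((b' - a) / 2)). assert (X2 := Rmin_r (d1 / 2) ((b' - a) / 2)).
    assert (X3 : 0 < Rmin (d1 / 2) ((b' - a) / 2)) by (apply Rmin_pos; lra).
    assert (Y1 := Rmin_l (d2 / 2) ((b' - a) / 2)). assert (Y2 := Rmin_r (d2 / 2) ((b' - a) / 2)).
    assert (Y3 : 0 < Rmin (d2 / 2) ((b' - a) / 2)) by (apply Rmin_pos; lra).
    assert (M1 := N1 x ltac:(unfold x; rewrite Rabs_pos_eq; lra)).
    assert (M2 := N2 y ltac:(unfold y; rewrite Rabs_left1; lra)).
    apply Rabs_def2 in M1. apply Rabs_def2 in M2.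
    exists x, y; unfold oint; simpl; repeat split; unfold x, y in *; lra.
Qed.

(** The moment is [2 (2 W_N - W_(N+1))] with Wallis integrals [W_N], and
    [W_(N+1) = W_N (N + 1/2) / (N + 1)]. Since [(2)_N = (N + 1) (1)_N], it splits into a term with
    denominator [(1)_N] and half a term with denominator [(2)_N]: the source of the two Kampe de
    Feriet functions. *)
Definition beta_int (N : nat) : R := PI * (poch (1/2) N / poch 1 N + / 2 * (poch (1/2) N / poch 2 N)).

Lemma poch_2 N : poch 2 N = INR (S N) * poch 1 N.
Proof.
  induction N as [|n IH]; [simpl; ring|].
  change (poch 2 (S n)) with (poch 2 n * (2 + INR n)). change (poch 1 (S n)) with (poch 1 n * (1 + INR n)).
  rewrite IH, !S_INR. ring.
Qed.

Lemma beta_int_correct N : nnint 0 (PI / 2) (fun t => 2 * ((2 - sin t ^ 2) * sin t ^ (2 * N))) (beta_int N).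
Proof.
  assert (Hpi := PI_RGT_0).
  set (G := fun t => 2 * (2 * wallis N t - wallis (S N) t)).
  replace (beta_int N) with (G (PI / 2) - G 0).
  - apply nnint_closed; [lra| | |].
    + intros t.
      assert (H := is_derive_scal _ _ 2 _ (is_derive_minus _ _ _ _ _ (is_derive_scal _ _ 2 _ (wallis_derive N t)) (wallis_derive (S N) t))).
      evar_last; [exact H|]. replace (2 * S N)%nat with (2 * N + 2)%nat by lia. rewrite pow_add.
      unfold minus, plus, opp; cbn -[Rpow_def.pow Nat.mul Nat.add]. ring.
    + intros t. apply continuous_Rscal, continuous_Rmult.
      * apply (continuous_of_derive _ _ (- (2 * sin t * cos t))). auto_derive; auto; ring.
      * apply continuous_pow, (continuous_of_derive _ _ _ (is_derive_sin t)).
    + intros t Ht. assert (A : 0 < sin t) by (apply sin_gt_0; lra). assert (C := SIN_bound t).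
      apply Rmult_le_pos; [lra|]. apply Rmult_le_pos; [nra|apply pow_le; lra].
  - unfold G. rewrite !wallis_0, !wallis_PI2. unfold beta_int. rewrite poch_2, S_INR. simpl poch.
    assert (A := poch_pos 1 N Rlt_0_1). assert (Hn := pos_INR N). field. lra.
Qed.

(** All coefficients of [Y0] and [K0] are nonnegative, so integrating the product term by term is
    legitimate although [t = PI / 2] corresponds to the boundary of the disc of convergence. *)
Lemma chain_sum : nnsum (fun mn => coefY (fst mn) * coefK (snd mn) * beta_int (fst mn + snd mn)) (16 * J / PI ^ 3).
Proof.
  assert (Hpi := PI_RGT_0).
  assert (Hs2 : forall t, oint 0 (PI / 2) t -> 0 <= sin t ^ 2 < 1).
  { intros t [H1 H2]; simpl in H1, H2. split; [apply pow2_ge_0|].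
    assert (B : 0 < cos t) by (apply cos_gt_0; lra).
    assert (C := sin2_cos2 t). unfold Rsqr in C. nra. }
  apply (nnint_nnsum 0 (PI / 2) (fun mn t => coefY (fst mn) * coefK (snd mn) * (2 * ((2 - sin t ^ 2) * sin t ^ (2 * (fst mn + snd mn)))))
    (fun t => 2 * ((2 - sin t ^ 2) * Y0 (sin t ^ 2) * K0 (sin t ^ 2)))).
  - simpl; lra.
  - intros [m n]. apply nnint_scal; [|apply beta_int_correct].
    apply Rmult_le_pos; [apply coefY_bounds|apply coefK_bounds].
  - intros t Ht. specialize (Hs2 t Ht).
    assert (H := nnsum_scal (2 * (2 - sin t ^ 2)) _ _ ltac:(lra)
      (nnsum_prod _ _ _ _ (Y0_nnsum _ Hs2) (K0_nnsum _ Hs2))).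
    replace (2 * ((2 - sin t ^ 2) * Y0 (sin t ^ 2) * K0 (sin t ^ 2))) with
     (2 * (2 - sin t ^ 2) * (Y0 (sin t ^ 2) * K0 (sin t ^ 2))) by ring.
    revert H; apply nnsum_ext; intros [m n]; simpl fst; simpl snd.
    rewrite <- !pow_mult. replace (2 * (m + n))%nat with (2 * m + 2 * n)%nat by lia. rewrite pow_add. ring.
  - intros t Ht. specialize (Hs2 t Ht).
    assert (Hc : continuous (fun t => sin t ^ 2) t) by apply continuous_pow, (continuous_of_derive _ _ _ (is_derive_sin t)).
    assert (Rabs (sin t ^ 2) < 1) by (rewrite Rabs_pos_eq; lra).
    apply continuous_Rscal, continuous_Rmult; [apply continuous_Rmult|].
    + apply (continuous_of_derive _ _ (- (2 * sin t * cos t))). auto_derive; auto; ring.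
    + apply (continuous_comp (fun t => sin t ^ 2) Y0); auto. apply Y0_cont; auto.
    + apply (continuous_comp (fun t => sin t ^ 2) K0); auto. apply K0_cont; auto.
  - apply chain_angle.
Qed.

End Chain.

(** * The coefficients of [g] *)

Definition radius1 (u : nat -> R) : Prop := forall q, Rabs q < 1 -> Rbar_lt (Rabs q) (CV_radius u).

Lemma is_pseries_conv u v t l m : radius1 u -> radius1 v -> 0 < t < 1 ->
  is_pseries u t l -> is_pseries v t m -> is_pseries (conv u v) t (l * m).
Proof.
  intros Hu Hv Ht Hl Hm. assert (Rabs t < 1) by (rewrite Rabs_pos_eq; lra).
  apply (is_pseries_mult u v); auto.
Qed.

Lemma radius1_conv u v : radius1 u -> radius1 v -> radius1 (conv u v).
Proof.
  intros Hu Hv. unfold radius1. apply CV_radius_ge_1. intros t Ht.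
  assert (Rabs t < 1) by (rewrite Rabs_pos_eq; lra).
  exists (PSeries u t * PSeries v t). apply is_pseries_R, is_pseries_conv; auto;
  apply PSeries_correct, CV_radius_inside; auto.
Qed.

(** The coefficients of [theta3(q^2)] in [t]: those of [theta4(q^2)] with the signs removed, which
    they dominate. *)
Definition theta3_q2_coef : nat -> R := zcoef (fun n => 8 * n * n)%Z (fun k => k).

Lemma theta4_q2_coef_eq : theta4_q2_coef = zcoef_alt (fun n => 8 * n * n)%Z (fun k => k).
Proof. reflexivity. Qed.
Lemma theta2_coef_eq : theta2_coef = zcoef (fun n => (2 * n + 1) * (2 * n + 1))%Z (fun k => k).
Proof. reflexivity. Qed.

Definition abs_coef : nat -> R :=
  conv theta2_coef (conv theta2_coef (conv theta2_coef
    (conv theta2_coef (conv theta3_q2_coef theta3_q2_coef)))).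

Lemma pow_quarter s (m : Z) : (0 <= m)%Z -> exp (- (s / 4)) ^ Z.to_nat m = exp (- (IZR m * (s / 4))).
Proof.
  intros Hm. rewrite pow_exp, INR_IZR_INZ, Z2Nat.id by auto. f_equal; ring.
Qed.

Section Point.
Variable s : R.
Hypothesis Hs : 0 < s.
Let t := exp (- (s / 4)).

Lemma quarter_bounds : 0 < t < 1.
Proof. unfold t; split; [apply exp_pos|]. rewrite <- exp_0; apply exp_increasing; lra. Qed.

(** At [q = exp (- s)] the variable is [t = exp (- (s / 4))]. Under the nome convention
    [exp (- 2 w)], functions of [q] live at [w = s / 2] and functions of [q^2] at [w = s]. *)
Lemma theta2_coef_pseries : is_pseries theta2_coef t (th2 (s / 2)).
Proof.
  apply (proj1 (is_pseries_R _ _ _)), nnsum_is_series. rewrite theta2_coef_eq.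
  apply zcoef_nnsum; [intros; nia|intros; nia|apply Rlt_le, quarter_bounds|].
  assert (H := th2_nnsum (s / 2) ltac:(lra)). revert H; apply nnsum_ext; intros n.
  unfold t; rewrite pow_quarter by nia. rewrite mult_IZR, plus_IZR, mult_IZR. f_equal. field.
Qed.

Lemma theta3_q2_coef_pseries : is_pseries theta3_q2_coef t (th3 s).
Proof.
  apply (proj1 (is_pseries_R _ _ _)), nnsum_is_series.
  apply zcoef_nnsum; [intros; nia|intros; nia|apply Rlt_le, quarter_bounds|].
  assert (H := th3_nnsum s Hs). revert H; apply nnsum_ext; intros n.
  unfold t; rewrite pow_quarter by nia. rewrite !mult_IZR. f_equal. field.
Qed.

Lemma theta4_q2_coef_pseries : is_pseries theta4_q2_coef t (th4 s).
Proof.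
  apply (proj1 (is_pseries_R _ _ _)). rewrite theta4_q2_coef_eq, th4_split by auto.
  apply zcoef_alt_series; [intros; nia|intros; nia|apply Rlt_le, quarter_bounds| |].
  - assert (H := th3_nnsum (4 * s) ltac:(lra)). revert H; apply nnsum_ext; intros n.
    unfold t; rewrite pow_quarter by nia. rewrite !mult_IZR. f_equal. field.
  - assert (H := th2_nnsum (4 * s) ltac:(lra)). revert H; apply nnsum_ext; intros n.
    unfold t; rewrite pow_quarter by nia. rewrite !mult_IZR, plus_IZR, mult_IZR. f_equal. field.
Qed.
End Point.

Lemma radius1_of_pseries u : (forall s, 0 < s -> exists l, is_pseries u (exp (- (s / 4))) l) -> radius1 u.
Proof.
  intros H. unfold radius1. apply CV_radius_ge_1. intros t Ht.
  destruct (H (- 4 * ln t)) as [l Hl].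
  { assert (ln t < 0) by (rewrite <- ln_1; apply ln_increasing; lra). lra. }
  replace (exp (- (- 4 * ln t / 4))) with t in Hl.
  - exists l. apply is_pseries_R; auto.
  - replace (- (- 4 * ln t / 4)) with (ln t) by field. rewrite exp_ln; lra.
Qed.

Lemma radius1_theta2 : radius1 theta2_coef.
Proof. apply radius1_of_pseries. intros s Hs; eexists; apply theta2_coef_pseries; auto. Qed.
Lemma radius1_theta3 : radius1 theta3_q2_coef.
Proof. apply radius1_of_pseries. intros s Hs; eexists; apply theta3_q2_coef_pseries; auto. Qed.
Lemma radius1_theta4 : radius1 theta4_q2_coef.
Proof. apply radius1_of_pseries. intros s Hs; eexists; apply theta4_q2_coef_pseries; auto. Qed.

(** The relation [theta2(q)^4 = beta (s / 2)^2 = 4 alpha s * beta s] moves the whole product to the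
    single argument [s]. *)
Lemma product_pseries s u l : 0 < s -> radius1 u -> is_pseries u (exp (- (s / 4))) l ->
  is_series (fun k => conv theta2_coef (conv theta2_coef (conv theta2_coef
    (conv theta2_coef (conv u u)))) k * exp (- (s / 4)) ^ k) (4 * (alpha s * beta s * l ^ 2)).
Proof.
  intros Hs Hu Hl. apply (proj2 (is_pseries_R _ _ _)).
  assert (Ht := quarter_bounds s Hs). assert (R2 := radius1_theta2).
  assert (H2 := theta2_coef_pseries s Hs).
  replace (4 * (alpha s * beta s * l ^ 2)) with
    (th2 (s / 2) * (th2 (s / 2) * (th2 (s / 2) * (th2 (s / 2) * (l * l))))).
  - assert (Ruu := radius1_conv _ _ Hu Hu). assert (R6 := radius1_conv _ _ R2 Ruu).
    assert (R5 := radius1_conv _ _ R2 R6). assert (R4 := radius1_conv _ _ R2 R5).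
    apply (is_pseries_conv _ _ _ _ _ R2 R4 Ht H2), (is_pseries_conv _ _ _ _ _ R2 R5 Ht H2),
      (is_pseries_conv _ _ _ _ _ R2 R6 Ht H2), (is_pseries_conv _ _ _ _ _ R2 Ruu Ht H2),
      (is_pseries_conv _ _ _ _ _ Hu Hu Ht Hl Hl).
  - assert (E := beta_sq_double (s / 2) ltac:(lra)). unfold beta in E at 1.
    replace (2 * (s / 2)) with s in E by field.
    replace (th2 (s / 2) * (th2 (s / 2) * (th2 (s / 2) * (th2 (s / 2) * (l * l))))) with
      ((th2 (s / 2) ^ 2) ^ 2 * l ^ 2) by ring. rewrite E; ring.
Qed.

Lemma conv_le u u' v v' : (forall n, Rabs (u n) <= u' n) -> (forall n, Rabs (v n) <= v' n) ->
  forall n, Rabs (conv u v n) <= conv u' v' n.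
Proof.
  intros Hu Hv n. unfold conv. eapply Rle_trans; [apply Rabs_triang_gen|].
  apply sum_Rle. intros k Hk. rewrite Rabs_mult. apply Rmult_le_compat; auto; apply Rabs_pos.
Qed.

Lemma Rabs_theta2 n : Rabs (theta2_coef n) <= theta2_coef n.
Proof. rewrite Rabs_pos_eq; [lra|]. rewrite theta2_coef_eq. apply zcoef_nonneg. Qed.

Lemma prod_coef_le n : Rabs (prod_coef n) <= abs_coef n.
Proof.
  unfold prod_coef, abs_coef.
  repeat (apply conv_le; [intros; apply Rabs_theta2|intros]).
  apply conv_le; intros; apply zcoef_alt_le.
Qed.

(** Odd squares are 1 modulo 8 and the exponents of the other factors are 0, so the product lives on
    exponents 4 modulo 8. Hence the coefficients at multiples of 4, the ones [b] reads, include
    every nonzero one, and the constant term vanishes. *)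
Definition supported (r : nat) (u : nat -> R) : Prop := forall n, u n <> 0 -> (n mod 8 = r mod 8)%nat.

Lemma conv_supported r r' u v : supported r u -> supported r' v -> supported (r + r') (conv u v).
Proof.
  intros Hu Hv n Hn. apply NNPP; intros Hmod. apply Hn. unfold conv.
  rewrite (sum_eq _ (fun _ => 0)), sum_cte; [ring|].
  intros i Hi. destruct (Req_dec (u i) 0) as [->|Hui]; [ring|].
  destruct (Req_dec (v (n - i)%nat) 0) as [->|Hvi]; [ring|].
  elim Hmod. apply Hu in Hui. apply Hv in Hvi.
  replace n with (i + (n - i))%nat by lia.
  rewrite Nat.Div0.add_mod, Hui, Hvi, <- Nat.Div0.add_mod. auto.
Qed.

Lemma zcoef_supported phi K r : (forall n k, phi n = Z.of_nat k -> (k mod 8 = r mod 8)%nat) ->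
  supported r (zcoef phi K).
Proof.
  intros H k Hk. apply NNPP; intros Hmod. apply Hk. unfold zcoef. rewrite zsum_lsum.
  rewrite (lsum_ext _ (fun _ => 0 * 0)), lsum_scal; [ring|].
  intros n _. destruct (Z.eqb_spec (phi n) (Z.of_nat k)) as [E|E]; [|ring]. elim Hmod; eauto.
Qed.

Lemma abs_coef_supported : supported 4 abs_coef.
Proof.
  assert (H2 : supported 1 theta2_coef).
  { rewrite theta2_coef_eq. apply zcoef_supported. intros n k E.
    assert (He := Zmod_even n). assert (Hd := Z.div_mod n 2 ltac:(lia)).
    (* [(2 n + 1)^2 = 1 + 4 n (n + 1)], and [n (n + 1)] is even. *)
    assert (exists j, n * (n + 1) = 2 * j)%Z as [j Hj].
    { destruct (Z.even n); [exists (n / 2 * (n + 1))%Z|exists (n * (n / 2 + 1))%Z]; nia. }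
    apply Nat2Z.inj. rewrite !Nat2Z.inj_mod, <- E.
    replace ((2 * n + 1) * (2 * n + 1))%Z with (1 + j * 8)%Z by nia. apply Z_mod_plus_full. }
  assert (H3 : supported 0 theta3_q2_coef).
  { apply zcoef_supported. intros n k E. apply Nat2Z.inj. rewrite !Nat2Z.inj_mod, <- E.
    replace (8 * n * n)%Z with (0 + (n * n) * 8)%Z by lia. apply Z_mod_plus_full. }
  unfold abs_coef. change 4%nat with (1 + (1 + (1 + (1 + (0 + 0)))))%nat.
  repeat (apply conv_supported; auto).
Qed.

Lemma nnint_gamma a : 0 < a -> nnint 0 p_infty (fun s => s ^ 3 * exp (- (a * s))) (6 / a ^ 4).
Proof.
  intros Ha.
  (* [P y * exp (- y)] is the incomplete gamma function [Gamma(4, y)], with value 6 at 0. *)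
  set (P := fun y => y ^ 3 + 3 * y ^ 2 + 6 * y + 6).
  assert (Ha4 : 0 < a ^ 4) by (apply pow_lt; auto).
  assert (HP : forall y, 0 <= y -> 0 <= P y * exp (- y) <= 6).
  { intros y Hy. assert (HE := exp_pos y). rewrite exp_Ropp.
    assert (HT := exp_ge_taylor y 3 Hy). simpl in HT.
    assert (H0 : 0 <= P y).
    { unfold P. assert (0 <= y ^ 3) by (apply pow_le; auto). assert (0 <= y ^ 2) by (apply pow_le; auto). lra. }
    assert (H6 : P y <= 6 * exp y) by (unfold P; simpl; lra).
    split; [apply Rmult_le_pos; auto; apply Rlt_le, Rinv_0_lt_compat; auto|].
    apply Rmult_le_reg_r with (exp y); auto. rewrite Rmult_assoc, Rinv_l by lra. lra. }
  apply (nnint_antideriv _ _ _ (fun s => - (P (a * s) * exp (- (a * s)) / a ^ 4))).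
  - intros x Hx. apply (proj1 (pos_line_iff _)) in Hx. split.
    + apply Rmult_le_pos; [apply pow_le; lra|apply Rlt_le, exp_pos].
    + apply (continuous_of_derive _ _ (3 * x ^ 2 * exp (- (a * x)) + x ^ 3 * (- a * exp (- (a * x))))).
      auto_derive; auto; ring.
  - intros x Hx. unfold P. auto_derive; auto. field; lra.
  - intros x y Hx Hy Hxy. apply (proj1 (pos_line_iff _)) in Hx. apply (proj1 (pos_line_iff _)) in Hy.
    destruct (HP (a * x) ltac:(nra)) as [A1 A2]. destruct (HP (a * y) ltac:(nra)) as [B1 B2].
    assert (0 <= / a ^ 4) by (apply Rlt_le, Rinv_0_lt_compat; auto).
    unfold Rdiv. nra.
  - intros e He.
    assert (Hsmall : forall d, 0 < d -> d <= 1 -> 6 - 6 * d <= P d * exp (- d)).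
    { intros d Hd Hd1. assert (H := exp_ineq1_le (- d)).
      assert (6 <= P d) by (unfold P; assert (0 <= d ^ 3) by (apply pow_le; lra); assert (0 <= d ^ 2) by (apply pow_le; lra); lra).
      assert (A := exp_pos (- d)). nra. }
    assert (Hlarge : forall y, 1 <= y -> P y * exp (- y) <= 384 / y).
    { intros y Hy. assert (HT := exp_ge_taylor y 4 ltac:(lra)). simpl in HT.
      assert (Hy2 : 1 <= y ^ 2) by nra. assert (Hy3 : y ^ 2 <= y ^ 3) by (simpl in *; nra).
      assert (H16 : P y <= 16 * y ^ 3) by (unfold P; nra).
      assert (HE : y ^ 4 / 24 <= exp y) by (simpl; simpl in Hy2, Hy3; lra).
      assert (Hy4 : 0 < y ^ 4) by (apply pow_lt; lra).
      rewrite exp_Ropp.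
      apply Rle_trans with (16 * y ^ 3 * / (y ^ 4 / 24)).
      - apply Rmult_le_compat; auto.
        + unfold P; nra.
        + apply Rlt_le, Rinv_0_lt_compat, exp_pos.
        + apply Rinv_le_contravar; lra.
      - right; field; lra. }
    (* The two ends lose at most [6 d] and [384 d], together below [400 d]. *)
    set (d := Rmin 1 (e * a ^ 4 / 400)).
    assert (Hd : 0 < d) by (apply Rmin_pos; [lra|apply Rdiv_lt_0_compat; nra]).
    assert (Hd1 : d <= 1) by apply Rmin_l. assert (Hd2 : 400 * d <= e * a ^ 4).
    { assert (H := Rmin_r 1 (e * a ^ 4 / 400)). fold d in H. lra. }
    assert (Hdi : 1 <= / d) by (rewrite <- Rinv_1; apply Rinv_le_contravar; auto).
    exists (d / a), (/ d / a). rewrite !pos_line_iff. repeat split.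
    + apply Rdiv_lt_0_compat; auto.
    + apply Rdiv_lt_0_compat; auto; lra.
    + apply Rmult_le_compat_r; [apply Rlt_le, Rinv_0_lt_compat; auto|lra].
    + replace (a * (d / a)) with d by (field; lra). replace (a * (/ d / a)) with (/ d) by (field; lra).
      assert (A := Hsmall d Hd Hd1). assert (B := Hlarge (/ d) Hdi).
      replace (384 / / d) with (384 * d) in B by (field; lra).
      apply Rmult_le_reg_r with (a ^ 4); auto.
      replace ((6 / a ^ 4 - e) * a ^ 4) with (6 - e * a ^ 4) by (field; lra).
      replace ((- (P (/ d) * exp (- / d) / a ^ 4) - - (P d * exp (- d) / a ^ 4)) * a ^ 4)
        with (P d * exp (- d) - P (/ d) * exp (- / d)) by (field; lra). lra.
Qed.

(* [k = 0] is harmless because the coefficient vanishes there. *)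
Lemma mellin_sum (u : nat -> R) (G : R -> R) T : u 0%nat = 0 ->
  (forall s, 0 < s -> continuous G s) ->
  (forall s, 0 < s -> nnsum (fun k => u k * exp (- (s / 4)) ^ k) (G s)) ->
  nnint 0 p_infty (fun s => s ^ 3 * G s) T ->
  nnsum (fun k => u k * (1536 / INR k ^ 4)) T.
Proof.
  intros Hu0 HG Hsum HT.
  assert (Hu : forall k, 0 <= u k).
  { intros k. assert (H := proj1 (Hsum 1 Rlt_0_1) k). simpl in H.
    apply Rmult_le_reg_r with (exp (- (1 / 4)) ^ k); [apply pow_lt, exp_pos|lra]. }
  apply (nnint_nnsum 0 p_infty (fun k s => u k * (s ^ 3 * exp (- (INR k / 4 * s)))) (fun s => s ^ 3 * G s)).
  - exact Logic.I.
  - intros [|k].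
    + rewrite Hu0, Rmult_0_l. apply (nnint_ext _ _ (fun s => 0 * exp (- (1 * s)))); [intros; ring|].
      assert (H0 := nnint_exp 0 1 ltac:(lra) ltac:(lra)). replace (0 / 1) with 0 in H0 by field. exact H0.
    + assert (Hk : 0 < INR (S k)) by (apply lt_0_INR; lia).
      apply nnint_scal; auto.
      (* The exponent is [k / 4], so [Gamma(4) = 6] becomes [6 * 4^4 = 1536]. *)
      replace (1536 / INR (S k) ^ 4) with (6 / (INR (S k) / 4) ^ 4) by (field; lra).
      apply nnint_gamma; lra.
  - intros s Hs. apply (proj1 (pos_line_iff _)) in Hs.
    assert (H := nnsum_scal (s ^ 3) _ _ ltac:(apply pow_le; lra) (Hsum s Hs)).
    revert H; apply nnsum_ext; intros k. rewrite pow_exp.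
    replace (INR k * - (s / 4)) with (- (INR k / 4 * s)) by field. ring.
  - intros s Hs. apply (proj1 (pos_line_iff _)) in Hs.
    apply continuous_Rmult; [apply continuous_pow, continuous_Rid|auto].
  - exact HT.
Qed.

(** The skipped terms are zero, so the value [T] is unchanged; the factor [4^4] cancels from
    1536. *)
Lemma supported_subsum (u : nat -> R) T : (forall k, 0 <= u k) -> supported 4 u ->
  nnsum (fun k => u k * (1536 / INR k ^ 4)) T ->
  nnsum (fun n => u (4 * S n)%nat * (6 / INR (S n) ^ 4)) T.
Proof.
  intros Hu Hs H.
  assert (H' : nnsum (fun n => (fun k => u k * (1536 / INR k ^ 4)) (4 * S n)%nat) T).
  { refine (proj2 (nnsum_inj (fun n => (4 * S n)%nat) (fun k => u k * (1536 / INR k ^ 4)) T _ _ _) H).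
    - intros x y; lia.
    - apply H.
    - intros i. destruct (Req_dec (u i) 0) as [E|E]; [right; rewrite E; ring|left].
      specialize (Hs i E). change (4 mod 8)%nat with 4%nat in Hs.
      assert (D := Nat.div_mod i 8 ltac:(lia)). exists (2 * (i / 8))%nat. lia. }
  revert H'; apply nnsum_ext; intros n. cbv beta.
  replace (INR (4 * S n)) with (4 * INR (S n)) by (rewrite mult_INR; simpl; ring).
  assert (Hk : 0 < INR (S n)) by (apply lt_0_INR; lia). field; lra.
Qed.

(** [prod_coef] is signed, so it is written as [abs_coef] minus the nonnegative
    [abs_coef - prod_coef]; each has its own Mellin transform, with values [4 T] and [4 (T - J)],
    and these are subtracted. The factor [1 / 96] is the [1 / 16] of [b] times [1 / 6]. *)
Lemma L_value : exists J, nnint 0 p_infty (fun s => s ^ 3 * (alpha s * beta s * gamma s)) J /\ is_L_g_4 (J / 24).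
Proof.
  destruct abs_integral_ex as [T HT].
  assert (Hex : exists J, nnint 0 p_infty (fun s => s ^ 3 * (alpha s * beta s * gamma s)) J /\ J <= T).
  { apply nnint_le_ex with (3 := HT); [exact Logic.I|].
    intros s Hs. apply (proj1 (pos_line_iff _)) in Hs.
    assert (A := alpha_pos s Hs). assert (B := beta_pos s Hs). assert (C := gamma_pos s Hs).
    assert (D := gamma_lt_alpha s Hs). assert (0 < s ^ 3) by (apply pow_lt; auto).
    assert (0 < alpha s * beta s) by (apply Rmult_lt_0_compat; auto).
    split; [split|].
    - apply Rmult_le_pos; [lra|]. apply Rmult_le_pos; lra.
    - apply Rmult_le_compat_l; [lra|]. apply Rmult_le_compat_l; lra.
    - apply continuous_Rmult; [apply continuous_pow, continuous_Rid|].
      apply continuous_Rmult; [apply continuous_Rmult|]; [apply alpha_cont|apply beta_cont|apply gamma_cont]; auto. }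
  destruct Hex as [J [HJ _]]. exists J; split; auto.
  assert (Habs0 : forall k, 0 <= abs_coef k).
  { intros k. eapply Rle_trans; [apply Rabs_pos|apply prod_coef_le]. }
  assert (Hdiff0 : forall k, 0 <= abs_coef k - prod_coef k).
  { intros k. assert (H := prod_coef_le k). assert (H' := Rle_abs (prod_coef k)). lra. }
  assert (Hsup := abs_coef_supported).
  assert (Hsup' : supported 4 (fun k => abs_coef k - prod_coef k)).
  { intros k Hk. apply Hsup. intros E. apply Hk. assert (H := prod_coef_le k). rewrite E in H.
    assert (H' := Rabs_pos (prod_coef k)). assert (Rabs (prod_coef k) = 0) by lra.
    apply Rabs_eq_0 in H0. lra. }
  assert (Hz : forall u, supported 4 u -> u 0%nat = 0).
  { intros u Hu. apply NNPP; intros Hn. apply Hu in Hn. discriminate. }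
  assert (HA : forall s, 0 < s -> nnsum (fun k => abs_coef k * exp (- (s / 4)) ^ k) (4 * (alpha s * beta s * alpha s))).
  { intros s Hs. apply is_series_nnsum.
    - intros k; apply Rmult_le_pos; auto. apply pow_le, Rlt_le, exp_pos.
    - apply (product_pseries s theta3_q2_coef (th3 s)); auto; [apply radius1_theta3|apply theta3_q2_coef_pseries; auto]. }
  assert (HP : forall s, 0 < s -> is_series (fun k => prod_coef k * exp (- (s / 4)) ^ k) (4 * (alpha s * beta s * gamma s))).
  { intros s Hs. apply (product_pseries s theta4_q2_coef (th4 s)); auto; [apply radius1_theta4|apply theta4_q2_coef_pseries; auto]. }
  assert (HD : forall s, 0 < s -> nnsum (fun k => (abs_coef k - prod_coef k) * exp (- (s / 4)) ^ k)
      (4 * (alpha s * beta s * (alpha s - gamma s)))).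
  { intros s Hs. apply is_series_nnsum.
    - intros k; apply Rmult_le_pos; auto. apply pow_le, Rlt_le, exp_pos.
    - assert (H := is_series_minus _ _ _ _ (nnsum_is_series _ _ (HA s Hs)) (HP s Hs)).
      replace (4 * (alpha s * beta s * (alpha s - gamma s))) with
        (minus (4 * (alpha s * beta s * alpha s)) (4 * (alpha s * beta s * gamma s)))
        by (unfold minus, plus, opp; simpl; ring).
      revert H; apply is_series_ext; intros k. unfold minus, plus, opp; simpl; ring. }
  assert (HTJ : nnint 0 p_infty (fun s => s ^ 3 * (4 * (alpha s * beta s * (alpha s - gamma s)))) (4 * (T - J))).
  { assert (Hx : exists D, nnint 0 p_infty (fun s => s ^ 3 * (4 * (alpha s * beta s * (alpha s - gamma s)))) D /\ D <= 4 * T).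
    { apply nnint_le_ex with (3 := nnint_scal _ _ 4 _ _ ltac:(lra) HT); [exact Logic.I|].
      intros s Hs. apply (proj1 (pos_line_iff _)) in Hs.
      assert (A := alpha_pos s Hs). assert (B := beta_pos s Hs). assert (C := gamma_pos s Hs).
      assert (D := gamma_lt_alpha s Hs). assert (0 < s ^ 3) by (apply pow_lt; auto).
      assert (0 < alpha s * beta s) by (apply Rmult_lt_0_compat; auto).
      split; [split|].
      - apply Rmult_le_pos; [lra|]. apply Rmult_le_pos; [lra|]. apply Rmult_le_pos; lra.
      - replace (4 * (s ^ 3 * (alpha s * beta s * alpha s))) with (s ^ 3 * (4 * (alpha s * beta s * alpha s))) by ring.
        apply Rmult_le_compat_l; [lra|]. apply Rmult_le_compat_l; [lra|]. apply Rmult_le_compat_l; lra.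
      - apply continuous_Rmult; [apply continuous_pow, continuous_Rid|]. apply continuous_Rscal.
        apply continuous_Rmult; [apply continuous_Rmult|]; [apply alpha_cont|apply beta_cont|]; auto.
        apply (continuous_minus alpha gamma); [apply alpha_cont|apply gamma_cont]; auto. }
    destruct Hx as [D [HDi _]]. replace (4 * (T - J)) with D; auto.
    assert (H := nnint_plus _ _ _ _ _ _ HDi (nnint_scal _ _ 4 _ _ ltac:(lra) HJ)).
    assert (H' : nnint 0 p_infty (fun s => 4 * (s ^ 3 * (alpha s * beta s * alpha s))) (D + 4 * J)).
    { revert H; apply nnint_ext; intros; ring. }
    assert (E := nnint_unique _ _ _ _ _ H' (nnint_scal _ _ 4 _ _ ltac:(lra) HT)). lra. }
  assert (HTT : nnint 0 p_infty (fun s => s ^ 3 * (4 * (alpha s * beta s * alpha s))) (4 * T)).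
  { apply (nnint_ext _ _ (fun s => 4 * (s ^ 3 * (alpha s * beta s * alpha s)))); [intros; ring|].
    apply nnint_scal; auto; lra. }
  assert (M1 := mellin_sum _ _ _ (Hz _ Hsup) ltac:(intros s Hs; apply continuous_Rscal, continuous_Rmult;
     [apply continuous_Rmult; [apply alpha_cont|apply beta_cont]; auto|apply alpha_cont; auto]) HA HTT).
  assert (M2 := mellin_sum _ _ _ (Hz _ Hsup') ltac:(intros s Hs; apply continuous_Rscal, continuous_Rmult;
     [apply continuous_Rmult; [apply alpha_cont|apply beta_cont]; auto|
      apply (continuous_minus alpha gamma); [apply alpha_cont|apply gamma_cont]; auto]) HD HTJ).
  apply supported_subsum in M1; auto. apply supported_subsum in M2; auto.
  unfold is_L_g_4. apply is_series_Reals.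
  assert (H := is_series_scal (/ 96) _ _ (is_series_minus _ _ _ _ (nnsum_is_series _ _ M1) (nnsum_is_series _ _ M2))).
  replace (J / 24) with (scal (/ 96) (minus (4 * T) (4 * (T - J)))).
  - revert H; apply is_series_ext; intros n. unfold b.
    assert (Hk : 0 < INR (S n)) by (apply lt_0_INR; lia).
    unfold scal, minus, plus, opp; cbn -[INR Nat.mul Rpow_def.pow prod_coef abs_coef].
    unfold mult; cbn -[INR Nat.mul Rpow_def.pow prod_coef abs_coef]. field; lra.
  - unfold scal, minus, plus, opp; simpl; unfold mult; simpl; field.
Qed.

(** * Assembling the Kampe de Feriet functions *)

Lemma fact_poch n : INR (fact n) = poch 1 n.
Proof.
  induction n as [|n IH]; [reflexivity|].
  rewrite fact_simpl, mult_INR, IH, S_INR. simpl; ring.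
Qed.

(** The factorials are [(1)_m] and [(1)_n]: the first cancels one of the three numerator parameters
    1, the second completes the square in the denominator of [coefK]. *)
Lemma kdf_term_eq d m n : 0 < d ->
  kdf_term [1/2] [d] [1; 1; 1] [3/2; 3/2] [1/2; 1/2] [1] 1 1 m n =
  coefY m * coefK n * (poch (1/2) (m + n) / poch d (m + n)).
Proof.
  intros Hd. unfold kdf_term, poch_prod; simpl fold_right.
  rewrite !pow1, !fact_poch. unfold coefY, coefK.
  assert (A1 := poch_pos 1 m Rlt_0_1). assert (A2 := poch_pos 1 n Rlt_0_1).
  assert (A3 := poch_pos (3/2) m ltac:(lra)). assert (A4 := poch_pos d (m + n) Hd).
  field. lra.
Qed.

Lemma is_kdf_intro d F : 0 < d ->
  nnsum (fun mn => coefY (fst mn) * coefK (snd mn) * (poch (1/2) (fst mn + snd mn) / poch d (fst mn + snd mn))) F ->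
  is_kdf [1/2] [d] [1; 1; 1] [3/2; 3/2] [1/2; 1/2] [1] 1 1 F.
Proof.
  intros Hd H.
  set (t := fun m n => coefY m * coefK n * (poch (1/2) (m + n) / poch d (m + n))).
  assert (Ht : forall m n, 0 <= t m n).
  { intros m n. apply Rmult_le_pos.
    - apply Rmult_le_pos; [apply coefY_bounds|apply coefK_bounds].
    - apply Rdiv_le_0_compat; [apply Rlt_le|]; apply poch_pos; lra. }
  assert (HD := proj1 (nnsum_diag t F Ht) H).
  split.
  - exists F. intros N. rewrite sum_f_R0_lsum.
    rewrite (lsum_ext _ (fun k => sum_f_R0 (fun m => t m (k - m)%nat) k)).
    + apply nnsum_ge_lsum; auto. apply seq_NoDup.
    + intros k _. apply sum_eq. intros m _. rewrite kdf_term_eq by auto. apply Rabs_pos_eq, Ht.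
  - apply is_series_Reals. apply nnsum_is_series in HD. revert HD; apply is_series_ext.
    intros k. apply sum_eq. intros m _. rewrite kdf_term_eq by auto. reflexivity.
Qed.

Theorem theorem2 :
  exists F1 F2 : R,
    is_kdf [1/2] [1] [1; 1; 1] [3/2; 3/2] [1/2; 1/2] [1] 1 1 F1 /\
    is_kdf [1/2] [2] [1; 1; 1] [3/2; 3/2] [1/2; 1/2] [1] 1 1 F2 /\
    is_L_g_4 (PI ^ 4 / 768 * (2 * F1 + F2)).
Proof.
  assert (Hpi := PI_RGT_0).
  destruct L_value as [J [HJ HL]].
  assert (H := chain_sum J HJ).
  set (t := fun d (mn : nat * nat) => coefY (fst mn) * coefK (snd mn) * (poch (1/2) (fst mn + snd mn) / poch d (fst mn + snd mn))).
  assert (Ht : forall d mn, 0 < d -> 0 <= t d mn).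
  { intros d [m n] Hd. apply Rmult_le_pos.
    - apply Rmult_le_pos; [apply coefY_bounds|apply coefK_bounds].
    - apply Rdiv_le_0_compat; [apply Rlt_le|]; apply poch_pos; lra. }
  (* Division by [PI] leaves of [beta_int] the two Pochhammer ratios with weights 1 and 1/2. *)
  assert (H' : nnsum (fun mn => t 1 mn + / 2 * t 2 mn) (/ PI * (16 * J / PI ^ 3))).
  { apply (nnsum_scal (/ PI)) in H; [|apply Rlt_le, Rinv_0_lt_compat; auto].
    revert H; apply nnsum_ext; intros [m n]; unfold t, beta_int; simpl fst; simpl snd.
    assert (A := poch_pos 1 (m + n) Rlt_0_1). assert (B := poch_pos 2 (m + n) ltac:(lra)). field; lra. }
  (* Only the combination [F1 + F2 / 2] is evaluated: [F1] exists by comparison, and [F2] is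
     obtained by subtraction. *)
  destruct (fun Hle => nnsum_le_ex (t 1) _ _ Hle H') as [F1 [HF1 _]].
  { intros mn; assert (A := Ht 1 mn ltac:(lra)); assert (B := Ht 2 mn ltac:(lra)); lra. }
  assert (HF2 : nnsum (t 2) (2 * (/ PI * (16 * J / PI ^ 3) - F1))).
  { apply (nnsum_ext (fun mn => 2 * (/ 2 * t 2 mn))); [intros; field|].
    apply nnsum_scal; [lra|]. apply (nnsum_minus _ (t 1)); auto.
    - intros mn; assert (B := Ht 2 mn ltac:(lra)); lra.
    - revert H'; apply nnsum_ext; intros; ring. }
  exists F1, (2 * (/ PI * (16 * J / PI ^ 3) - F1)).
  split; [apply is_kdf_intro; [lra|exact HF1]|].
  split; [apply is_kdf_intro; [lra|exact HF2]|].
  (* The unevaluated [F1] cancels: [2 F1 + F2 = 32 J / PI^4], and [32 * 24 = 768]. *)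
  replace (PI ^ 4 / 768 * (2 * F1 + 2 * (/ PI * (16 * J / PI ^ 3) - F1))) with (J / 24) by (field; lra).
  exact HL.
Qed.
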